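(* Let $1\le\kappa<K<N$ be integers. In the Best-2 case of the Sliding-Window Secretary Problem with $N$ applicants, let $d^*_{K1},d^*_{K2}$ denote the optimal first and second thresholds for a sliding window of size $K$, and let $d^*_{\kappa1},d^*_{\kappa2}$ denote those for a sliding window of size $\kappa$. Then $$\Pr(\mathrm{Win}\mid\kappa,d^*_{\kappa1},d^*_{\kappa2})<\Pr(\mathrm{Win}\mid K,d^*_{K1},d^*_{K2}).$$
   Context: Setting (Best-2 case with window size $K$). There are $N$ applicants, seen in the order of their indices $1,\dots,N$. $R$ is a uniformly random permutation of $\{1,\dots,N\}$; $R(m)$ is the absolute rank of the applicant at index $m$, with $1$ the best rank. The interviewer observes only relative ranks of the applicants seen so far. When the window starts at index $i$, it consists of applicants $i,\dots,\min(i+K-1,N)$, and exactly the applicants $1,\dots,\min(i+K-1,N)$ have been seen. The interviewer may then choose any applicant in the window (ending the process) or reject applicant $i$ and move the window to start at $i+1$; rejected applicants cannot be recalled. One applicant can be chosen, and the interviewer wins iff the chosen applicant has rank $1$ or $2$. Under the sliding rule (reject applicants until the best candidate in the window is at the window's first index), applicant $i$ is a 1-candidate iff, when the window starts at $i$, applicant $i$ is the best of applicants $1,\dots,\min(i+K-1,N)$; applicant $i$ is a 2-candidate iff applicant $i$ is the second best of these and the best of these has index less than $i$. The strategy with thresholds $d_1\le d_2$ stops at the first index $i$ such that either $i>d_1$ and $i$ is a 1-candidate, or $i>d_2$ and $i$ is a 2-candidate. $\Pr(\mathrm{Win}\mid K,d_1,d_2)$ is its probability of winning for window size $K$. Optimal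 thresholds: for $l\in\{1,2\}$, $d^*_{Kl}+1$ is the smallest index $i$ (with $i\ge2$ if $l=2$, since a 2-candidate cannot occur at index 1) such that, conditionally on the window of size $K$ starting at $i$ and applicant $i$ being an $l$-candidate, choosing applicant $i$ gives a strictly larger probability of winning than rejecting applicant $i$ and continuing optimally. The strategy with thresholds $d^*_{K1},d^*_{K2}$ is the optimal strategy for window size $K$. *)

(* Defs.v *)
From mathcomp Require Import all_boot all_order all_fingroup all_algebra.

Set Implicit Arguments.
Unset Strict Implicit.
Unset Printing Implicit Defensive.

Import Order.TTheory GRing.Theory Num.Theory.
Local Open Scope ring_scope.

(* Conventions.  Everything is counted from 0: the applicant at index m
   (1 <= m <= N) is the ordinal of value m - 1, and [s m = 0] means that the
   applicant m has absolute rank 1 under the permutation s.  Hence "i > d" for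
   a 1-based index i reads [d <= i] for the corresponding ordinal, and a
   threshold d with "d + 1 is the smallest 1-based index such that ..." is the
   smallest 0-based index such that ....                                      *)

Definition cprob (N : nat) (E A : {set 'S_N}) : rat :=
  #|A :&: E|%:R / #|E|%:R.

Definition prob (N : nat) (A : {set 'S_N}) : rat := cprob [set: 'S_N] A.

Definition seen (N K i : nat) : nat := minn (i + K)%N N.

(* The rank (1 = best) of applicant m relative to the first n applicants. *)
Definition rel_rank (N : nat) (s : 'S_N) (n : nat) (m : 'I_N) : nat :=
  #|[set j : 'I_N | (j < n)%N && (s j < s m)%N]|.+1.

Definition candidate (N K l : nat) (s : 'S_N) (i : 'I_N) : bool :=
  match l with
  | 1 => rel_rank s (seen N K i) i == 1%N
  | 2 => (rel_rank s (seen N K i) i == 2%N) &&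
         [exists j : 'I_N, (j < i)%N && (rel_rank s (seen N K i) j == 1%N)]
  | _ => false
  end.

Definition top2 (N : nat) (s : 'S_N) (m : 'I_N) : bool := (s m < 2)%N.

(* [p i s = Some m]: when the window starts at i, choose applicant m;
   [p i s = None]: reject applicant i and move the window. *)
Definition policy (N : nat) := {ffun 'I_N -> {ffun 'S_N -> option 'I_N}}.

Definition same_obs (N : nat) (n : nat) (s t : 'S_N) : bool :=
  [forall a : 'I_N, forall b : 'I_N,
     (a < n)%N && (b < n)%N ==> ((s a < s b)%N == (t a < t b)%N)].

(* A policy may only choose inside the current window, and its decisions
   may only depend on the relative ranks observed so far. *)
Definition admissible (N K : nat) (p : policy N) : bool :=
  [forall i : 'I_N, forall s : 'S_N,
     (if p i s is Some m then (i <= m < seen N K i)%N else true) &&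
     [forall t : 'S_N, same_obs (seen N K i) s t ==> (p i s == p i t)]].

(* The applicant chosen by p once the window starts at k (None if there is
   none, in particular when k = N). *)
Definition chosen (N : nat) (p : policy N) (s : 'S_N) (k : nat) : option 'I_N :=
  ohead (pmap (fun i : 'I_N => p i s) [seq i : 'I_N <- enum 'I_N | (k <= i)%N]).

Definition wins_from (N : nat) (p : policy N) (k : nat) : {set 'S_N} :=
  [set s : 'S_N | if chosen p s k is Some m then top2 s m else false].

Definition threshold_policy (N K d1 d2 : nat) : policy N :=
  [ffun i : 'I_N => [ffun s : 'S_N =>
     if (d1 <= i)%N && candidate K 1 s i || (d2 <= i)%N && candidate K 2 s i
     then Some i else None]].

Definition Pr_win (N K d1 d2 : nat) : rat :=
  prob (wins_from (threshold_policy N K d1 d2) 0).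

Definition choose_value (N K l : nat) (i : 'I_N) : rat :=
  cprob [set s : 'S_N | candidate K l s i] [set s : 'S_N | top2 s i].

(* The optimum is over all admissible policies, not only those with
   thresholds. *)
Definition continue_value (N K l : nat) (i : 'I_N) : rat :=
  \big[Num.max/0]_(p : policy N | admissible K p)
     cprob [set s : 'S_N | candidate K l s i] (wins_from p i.+1).

(* [enum 'I_N] is increasing, so [find] returns the smallest index.  For
   l = 2 the first index is excluded: no 2-candidate can occur there. *)
Definition opt_threshold (N K l : nat) : nat :=
  find (fun i : 'I_N => ((l == 2%N) ==> (0 < i)%N) &&
                        (continue_value K l i < choose_value K l i))
       (enum 'I_N).

(* Main.v *)
(* The window is enlarged by one index at a time, from k to k + 1.  With the same
   thresholds the larger window wins for every permutation for which the smaller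
   one wins: the only case in which it does not stop at the same index i is that
   the overall best applicant is at i + k, and then it waits and chooses it.
   Next, the optimal thresholds satisfy d_k1 <= d_k2 and do not increase with k,
   and lowering a threshold of the window k + 1 to its optimal value cannot
   decrease the winning probability, because at the indices in between choosing
   the candidate is at least as good as any admissible way to continue.  (The
   threshold strategy is not optimal among all admissible policies, which may also
   use the position of the second best applicant; only these local comparisons are
   available.)  To compare thresholds of different windows, the dynamic programme,
   whose states are the positions of the two best applicants seen, is reduced to
   two sequences t and g.  For the second threshold a bound on t_{k+1} - t_k
   suffices; for the first one needs g_k(p) - g_{k+1}(p + 1) >= 2 / p. *)

Require Import Defs.
From mathcomp Require Import all_boot all_order all_fingroup all_algebra.
From mathcomp Require Import zify ring lra.

Set Implicit Arguments.
Unset Strict Implicit.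
Unset Printing Implicit Defensive.

Import Order.TTheory GRing.Theory Num.Theory.
Local Open Scope ring_scope.

(** Values are divided by n(n-1)/(N(N-1)), the probability that the two best of n applicants are the
    overall best two. The chance (n-1)/(n+1) that they survive one more applicant is the ratio of
    consecutive normalisers, so it cancels, and the option of choosing a second best applicant later
    enters as a fixed summand [pospart (1 - t (p + k))]. At the same window start the two windows
    have seen n and n + 1 applicants. Widening raises the values, the later position lowers them,
    and the second effect has to win. The constant in the gap 2 / p is the drop by 2 of (n - 1) *
    best_ratio n = 2N - n - 1 between the window ends p + k and p + k + 2. All other losses must be
    paid by the gaps at later positions; this budget is (4k - 2) / u with u = p + k + 2, and it
    makes the polynomial inequalities necessary. Inclusion of the winning sets gives no strictness.
    That comes either from one explicit permutation or from a threshold that really drops, according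
    to how close the thresholds are to N. *)

Ltac nlia :=
  repeat match goal with
  | H : is_true (@Order.le _ _ _ _) |- _ => clear H
  | H : is_true (@Order.lt _ _ _ _) |- _ => clear H
  | H : @eq ?T _ _ |- _ =>
      lazymatch T with nat => fail | bool => fail | _ => clear H end
  end; lia.

(** * Positive parts, downward induction and telescoping sums *)

Definition pospart (x : rat) : rat := Num.max x 0.

Lemma pospart_ge0 x : 0 <= pospart x.
Proof. by rewrite /pospart le_max lexx orbT. Qed.

Lemma pospart_ge x : x <= pospart x.
Proof. by rewrite /pospart le_max lexx. Qed.

Lemma pospart_le x y : x <= y -> 0 <= y -> pospart x <= y.
Proof. by move=> h1 h2; rewrite /pospart ge_max h1 h2. Qed.

Lemma le_pospart x y : x <= y -> pospart x <= pospart y.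
Proof. by move=> h; apply: pospart_le (pospart_ge0 y); apply: le_trans h (pospart_ge y). Qed.

Lemma pospartE x : (x <= 0 /\ pospart x = 0) \/ (0 <= x /\ pospart x = x).
Proof. by rewrite /pospart; case: leP => h; [left|right]; split=> //; apply: ltW. Qed.

Lemma backward_ind (N : nat) (P : nat -> Prop) :
  (forall n, (n <= N)%N -> (forall m, (n < m <= N)%N -> P m) -> P n) ->
  forall n, (n <= N)%N -> P n.
Proof.
move=> H n; have [d] := ubnP (N - n)%N; elim: d n => // d IH n hd hn.
by apply: H => // m /andP[h1 h2]; apply: IH => //; lia.
Qed.

Lemma natR_le (a b : nat) : (a <= b)%N -> (a%:R : rat) <= b%:R.
Proof. by rewrite ler_nat. Qed.

Lemma sum_const (a b : nat) (c : rat) :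
  (a <= b)%N -> \sum_(a <= j < b) c = (b%:R - a%:R) * c.
Proof. by move=> h; rewrite big_const_nat iter_addr addr0 -natrB // mulr_natl. Qed.

Lemma sum_inv_pair (a b : nat) (c : rat) : (0 < a)%N -> (a <= b)%N ->
  \sum_(a <= j < b) c / (j.+1%:R * j%:R) = c / a%:R - c / b%:R.
Proof.
move=> ha hab; rewrite (@telescope_sumr_eq _ _ _ (fun j => - c / j%:R)) //.
  by rewrite !mulNr; ring.
move=> j /andP[h1 h2]; have hj : (1:rat) <= j%:R by apply: (natR_le (a:=1)); lia.
by rewrite -natr1; field; apply/andP; split; lra.
Qed.

(** * The reduced dynamic programme *)

Section Sys.
Variable N : nat.
Hypothesis hN : (2 < N)%N.

Definition pair_count : rat := N%:R * (N%:R - 1).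
(** Winning probability of the best of [e] applicants seen, divided by that of the second best. *)
Definition best_ratio (e : nat) : rat := (2 * N%:R - e%:R - 1) / (e%:R - 1).
(** A certain win in the same units, hence a ceiling for every normalised value. *)
Definition pair_ratio (n : nat) : rat := pair_count / (n%:R * (n%:R - 1)).

(* Values are measured in units of the value of choosing the second best of all
   applicants seen; [pair_count N] is the number of ordered pairs of ranks.
   [t n] is the value of a position in which [n] applicants have been seen and
   the two best of them are lost.  [g p] and [newcomer_second k t p] are, up to
   the same normalisation, the values right after the applicant at (0-based)
   position [p] has turned out to be the best, respectively second best with the
   best one lost. *)
Definition newcomer_second (k : nat) (t : nat -> rat) (p : nat) : rat :=
  t p.+1 + pospart (1 - t (p + k)%N).

(** In the equation for [g], the newcomer at [p] has become the first of its window and [e]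
    applicants are seen. Either it was overtaken at some [j], or it is still the best; then the
    second best is at one of the [p] lost positions, or at some [j] after [p], where it keeps an
    option. *)
Definition system (k : nat) (t g : nat -> rat) : Prop :=
  [/\ forall n, (N <= n)%N -> t n = 0,
      forall p, (2 <= p < N)%N ->
        t p = t p.+1 + (g p + newcomer_second k t p) / (p%:R - 1)
    & forall p, (2 <= p < N)%N -> let e := seen N k p in
        p%:R * g p = \sum_(p.+1 <= j < e) g j + p%:R * Num.max (best_ratio e) (t e)
          + \sum_(p.+1 <= j < e)
              Num.max (best_ratio e) (t e + pospart (1 - t (j + k)%N))].

Lemma pair_count_gt0 : 0 < pair_count.
Proof. by rewrite /pair_count; have := natR_le hN; nra. Qed.

Lemma pair_ratioS n : (1 < n)%N -> pair_ratio n - pair_ratio n.+1 = 2 * pair_count / (n.+1%:R * n%:R * (n%:R - 1)).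
Proof.
move=> hn; have h := natR_le hn; rewrite /pair_ratio -natr1.
by field; apply/and3P; split; lra.
Qed.

Lemma pair_ratioN : pair_ratio N = 1.
Proof. by rewrite /pair_ratio divff // lt0r_neq0 // pair_count_gt0. Qed.

Lemma best_ratioS n : (1 < n)%N -> best_ratio n - best_ratio n.+1 = (2 * N%:R - 2) / (n%:R * (n%:R - 1)).
Proof.
move=> hn; have h := natR_le hn; rewrite /best_ratio -natr1.
by field; apply/andP; split; lra.
Qed.

Lemma best_ratio_ge1 n : (1 < n <= N)%N -> 1 <= best_ratio n.
Proof.
move=> /andP[h1 h2]; have := natR_le h1; have := natR_le h2 => H2 H1.
by rewrite /best_ratio ler_pdivlMr; lra.
Qed.

Lemma natR_gap_ge0 (n : nat) : (n <= N)%N -> 0 <= (N%:R - n%:R) * (N%:R - n%:R - 1) :> rat.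
Proof.
move=> h; case: (ltnP n N) => h'.
  have := natR_le h'; rewrite -natr1 => H; nra.
have -> : n = N by lia.
by rewrite subrr mul0r.
Qed.

Lemma best_ratio_le n : (1 < n <= N)%N -> best_ratio n <= pair_ratio n.
Proof.
move=> /andP[h1 h2]; have := natR_le h1; have := natR_gap_ge0 h2 => H2 H1.
have -> : pair_ratio n = best_ratio n + (N%:R - n%:R) * (N%:R - n%:R - 1) / (n%:R * (n%:R - 1)).
  by rewrite /pair_ratio /best_ratio /pair_count; field; apply/andP; split; lra.
by rewrite lerDl divr_ge0 // mulr_ge0; lra.
Qed.

Section One.
Variables (k : nat) (t g : nat -> rat).
Hypotheses (hk : (0 < k)%N) (Hs : system k t g).

Lemma seen_bounds p : (p < N)%N -> (p.+1 <= seen N k p <= N)%N.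
Proof. by rewrite /seen; lia. Qed.

(** A leader can always be chosen when its window arrives. Monotonicity of [t] has to be carried
    along: it follows from the bounds on [g] and [newcomer_second], and the latter uses it at later
    indices. *)
Lemma system_lower n : (n <= N)%N -> (2 <= n)%N ->
  (forall m, (n <= m)%N -> t m <= t n) /\
  ((n < N)%N -> best_ratio n.+1 <= g n /\ 1 <= newcomer_second k t n).
Proof.
case: Hs => H0 Ht Hg; move: n.
apply: (@backward_ind N (fun n => (2 <= n)%N ->
  (forall m, (n <= m)%N -> t m <= t n) /\
  ((n < N)%N -> best_ratio n.+1 <= g n /\ 1 <= newcomer_second k t n))) => n hn IH h2.
case: (ltnP n N) => hnN; last first.
  by split=> // m hm; rewrite !H0 //; lia.
have Hmono : forall m, (n < m)%N -> t m <= t n.+1.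
  by move=> m hm; have [h _] := IH n.+1 ltac:(nlia) ltac:(nlia); apply: h.
have hs : 1 <= newcomer_second k t n.
  rewrite /newcomer_second; have := pospart_ge (1 - t (n + k)%N).
  by have := Hmono (n + k)%N ltac:(nlia); lra.
have R1 := natR_le h2.
have hg : best_ratio n.+1 <= g n.
  have /andP[he1 he2] := seen_bounds hnN.
  have := Hg n ltac:(nlia) => /=; set e := seen N k n in he1 he2 *.
  move=> E; have Re := natR_le he1; rewrite -natr1 in Re.
  have hs1 : \sum_(n.+1 <= j < e) 1 <= \sum_(n.+1 <= j < e) g j.
    rewrite big_nat_cond [leRHS]big_nat_cond; apply: ler_sum => j /andP[/andP[h3 h4] _].
    have [_ h] := IH j ltac:(nlia) ltac:(nlia); have [h5 _] := h ltac:(nlia).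
    by apply: le_trans h5; apply: best_ratio_ge1; lia.
  have hs2 : \sum_(n.+1 <= j < e) best_ratio e <=
     \sum_(n.+1 <= j < e) Num.max (best_ratio e) (t e + pospart (1 - t (j + k)%N)).
    by apply: ler_sum => j _; rewrite le_max lexx.
  have hm : best_ratio e <= Num.max (best_ratio e) (t e) by rewrite le_max lexx.
  rewrite sum_const // mulr1 -natr1 in hs1; rewrite sum_const // -natr1 in hs2.
  have Er : (e%:R - 1) * best_ratio e = 2 * N%:R - e%:R - 1.
    by rewrite /best_ratio mulrC divfK //; lra.
  rewrite /best_ratio -natr1 ler_pdivrMr; last lra.
  nra.
split=> // m; rewrite leq_eqVlt => /orP[/eqP<- //|hm].
apply: (le_trans (Hmono m hm)); rewrite (Ht n) ?h2 // lerDl divr_ge0 //; last lra.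
have : 1 <= best_ratio n.+1 by apply: best_ratio_ge1; lia.
by lra.
Qed.

Lemma t_mono a b : (2 <= a)%N -> (a <= b)%N -> t b <= t a.
Proof.
move=> h2 hab; case: (leqP a N) => ha; first by have [h _] := system_lower ha h2; apply: h.
by case: Hs => H0 _ _; rewrite !H0 //; lia.
Qed.

Lemma t_ge0 a : (2 <= a)%N -> 0 <= t a.
Proof.
case: (Hs) => H0 _ _ ha; rewrite -(H0 (a + N)%N) ?leq_addl //.
by apply: t_mono => //; lia.
Qed.

Lemma g_ge p : (2 <= p < N)%N -> best_ratio p.+1 <= g p.
Proof. by case/andP=> h1 h2; have [_ h] := system_lower (ltnW h2) h1; case: (h h2). Qed.

Lemma s_ge1 p : (2 <= p < N)%N -> 1 <= newcomer_second k t p.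
Proof. by case/andP=> h1 h2; have [_ h] := system_lower (ltnW h2) h1; case: (h h2). Qed.

Lemma t_step_ge p : (2 <= p < N)%N -> best_ratio p - best_ratio p.+1 <= t p - t p.+1.
Proof.
move=> hp; case: (Hs) => _ Ht _; rewrite (Ht p hp) best_ratioS; last lia.
have := g_ge hp; have := s_ge1 hp; move: (hp) => /andP[h2 _] hs hg; have R1 := natR_le h2.
have Eg : p%:R * best_ratio p.+1 = 2 * N%:R - p%:R - 2.
  by rewrite /best_ratio -natr1; field; lra.
rewrite addrAC subrr add0r.
rewrite [leLHS](_ : _ = ((2 * N%:R - 2) / p%:R) / (p%:R - 1)); last first.
  by field; apply/andP; split; lra.
rewrite ler_pM2r ?invr_gt0; last lra.
rewrite ler_pdivrMr; last lra.
nra.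
Qed.

Lemma t_diff_ge a b : (2 <= a)%N -> (a <= b <= N)%N -> best_ratio a - best_ratio b <= t a - t b.
Proof.
move=> ha /andP[hab]; elim: b hab => [|b IH]; first by lia.
rewrite leq_eqVlt => /orP[/eqP<- _|hab hb]; first by rewrite !subrr.
have := IH ltac:(nlia) ltac:(nlia); have := @t_step_ge b ltac:(nlia); lra.
Qed.

Lemma best_ratioN : best_ratio N = 1.
Proof. by rewrite /best_ratio; have := natR_le hN => H; field; lra. Qed.

Lemma t_ge a : (2 <= a <= N)%N -> best_ratio a - 1 <= t a.
Proof.
move=> /andP[h1 h2]; have := @t_diff_ge a N h1 ltac:(nlia).
by case: (Hs) => H0 _ _; rewrite (H0 N) // best_ratioN; lra.
Qed.

(** Nothing beats a certain win. For [t] the bound is on differences, because an option contributes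
    [t a + 1 - t q], which a bound on [t a] alone would not keep below [pair_ratio a]. *)
Lemma system_upper n : (n <= N)%N -> (2 <= n)%N ->
  (forall m, (n <= m <= N)%N -> t n - t m <= pair_ratio n - pair_ratio m) /\
  ((n < N)%N -> g n <= pair_ratio n.+1 /\ newcomer_second k t n <= pair_ratio n.+1).
Proof.
case: (Hs) => H0 Ht Hg; move: n.
apply: (@backward_ind N (fun n => (2 <= n)%N ->
  (forall m, (n <= m <= N)%N -> t n - t m <= pair_ratio n - pair_ratio m) /\
  ((n < N)%N -> g n <= pair_ratio n.+1 /\ newcomer_second k t n <= pair_ratio n.+1))) => n hn IH h2.
case: (ltnP n N) => hnN; last first.
  split=> // m hm; have <- : n = m by lia.
  by rewrite !subrr.
have Hd : forall a m, (n < a)%N -> (a <= m <= N)%N -> t a - t m <= pair_ratio a - pair_ratio m.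
  by move=> a m h3 h4; have [h _] := IH a ltac:(nlia) ltac:(nlia); apply: h.
have U1 : forall a, (2 <= a <= N)%N -> 1 <= pair_ratio a.
  by move=> a h; exact: le_trans (best_ratio_ge1 h) (best_ratio_le h).
have HY : forall a q, (n < a <= N)%N -> (a <= q)%N -> t a + pospart (1 - t q) <= pair_ratio a.
  move=> a q h3 h4; have h5 := Hd a (minn q N) ltac:(nlia) ltac:(nlia).
  have h6 := Hd (minn q N) N ltac:(nlia) ltac:(nlia).
  have E : t (minn q N) = t q.
    by case: (leqP q N) => // h; rewrite !H0 //; lia.
  rewrite E (H0 N) // pair_ratioN in h6; rewrite E in h5.
  have := U1 (minn q N) ltac:(nlia).
  by case: (pospartE (1 - t q)) => -[h7 ->]; lra.
have hs : newcomer_second k t n <= pair_ratio n.+1 by apply: HY; lia.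
have R1 := natR_le h2.
have hg : g n <= pair_ratio n.+1.
  have /andP[he1 he2] := seen_bounds hnN.
  have := Hg n ltac:(nlia) => /=; set e := seen N k n in he1 he2 *.
  move=> E; have Re := natR_le he1; rewrite -natr1 in Re.
  have hs1 : \sum_(n.+1 <= j < e) g j <= pair_count / n.+1%:R - pair_count / e%:R.
    rewrite -sum_inv_pair // big_nat_cond [leRHS]big_nat_cond; apply: ler_sum => j /andP[/andP[h3 h4] _].
    have [_ h] := IH j ltac:(nlia) ltac:(nlia); have [h5 _] := h ltac:(nlia).
    apply: le_trans h5 _.
    by rewrite /pair_ratio -natr1 addrK.
  have hr : best_ratio e <= pair_ratio e by apply: best_ratio_le; lia.
  have hs2 : \sum_(n.+1 <= j < e) Num.max (best_ratio e) (t e + pospart (1 - t (j + k)%N)) <=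
       \sum_(n.+1 <= j < e) pair_ratio e.
    rewrite big_nat_cond [leRHS]big_nat_cond; apply: ler_sum => j /andP[/andP[h3 h4] _].
    rewrite ge_max hr /=; apply: HY; first by lia.
    by rewrite /e /seen; lia.
  have hm : Num.max (best_ratio e) (t e) <= pair_ratio e.
    rewrite ge_max hr /=; have := HY e e ltac:(nlia) ltac:(nlia).
    by have := pospart_ge0 (1 - t e); lra.
  rewrite sum_const // -natr1 in hs2.
  have EU : (e%:R - 1) * pair_ratio e = pair_count / e%:R.
    by rewrite /pair_ratio; field; apply/andP; split; lra.
  have hm2 : n%:R * Num.max (best_ratio e) (t e) <= n%:R * pair_ratio e by rewrite ler_wpM2l //; lra.
  have h3 : n%:R * g n <= pair_count / n.+1%:R by rewrite -natr1 in hs1 *; lra.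
  rewrite -(ler_pM2l (x := n%:R)); last lra.
  apply: le_trans h3 _; rewrite /pair_ratio -natr1 addrK.
  rewrite [leRHS](_ : _ = pair_count / (n%:R + 1)) //.
  by field; apply/andP; split; lra.
split=> // m; rewrite leq_eqVlt => /andP[/orP[/eqP<- _ |h3 h4]]; first by rewrite !subrr.
have h5 := Hd n.+1 m ltac:(nlia) ltac:(nlia).
have h6 : (g n + newcomer_second k t n) / (n%:R - 1) <= pair_ratio n - pair_ratio n.+1.
  rewrite pair_ratioS // ler_pdivrMr; last lra.
  rewrite [leRHS](_ : _ = 2 * pair_ratio n.+1); first by lra.
  by rewrite /pair_ratio -(@natr1 _ n) addrK; field; apply/and3P; split; lra.
rewrite (Ht n) ?h2 //; move: h5 h6; move: (pair_ratio n) (pair_ratio m) (pair_ratio _) (_ / _) => x y z w; lra.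
Qed.

Lemma g_le p : (2 <= p < N)%N -> g p <= pair_ratio p.+1.
Proof. by case/andP=> h1 h2; have [_ h] := system_upper (ltnW h2) h1; case: (h h2). Qed.

Lemma s_le p : (2 <= p < N)%N -> newcomer_second k t p <= pair_ratio p.+1.
Proof. by case/andP=> h1 h2; have [_ h] := system_upper (ltnW h2) h1; case: (h h2). Qed.

Lemma t_le a : (2 <= a <= N)%N -> t a <= pair_ratio a - 1.
Proof.
move=> /andP[h1 h2]; have [h _] := system_upper h2 h1; have := h N ltac:(nlia).
by case: (Hs) => H0 _ _; rewrite (H0 N) // pair_ratioN; lra.
Qed.

Lemma pair_ratio_ge1 a : (2 <= a <= N)%N -> 1 <= pair_ratio a.
Proof. by move=> h; exact: le_trans (best_ratio_ge1 h) (best_ratio_le h). Qed.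

End One.
End Sys.

(** * Comparison of consecutive windows *)

Section Two.
Variable N : nat.
Hypothesis hN : (2 < N)%N.
Variables (k : nat) (t g t' g' : nat -> rat).
Hypotheses (hk : (0 < k)%N) (Hs : system N k t g) (Hs' : system N k.+1 t' g').

Notation npairs := (pair_count N).
Notation rbest := (best_ratio N).
Notation U := (pair_ratio N).
Notation s := (newcomer_second k t).
Notation s' := (newcomer_second k.+1 t').

Lemma seenE p : (p + k <= N)%N -> seen N k p = (p + k)%N.
Proof. by rewrite /seen => h; apply/minn_idPl. Qed.

Lemma seenN p : (N <= p + k)%N -> seen N k p = N.
Proof. by rewrite /seen => h; apply/minn_idPr. Qed.

(** The window starting at [p] reaches the last applicant, so a leader arriving at [p] leads to a
    certain win for either size. With the two leaders lost, the only failure is that they are the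
    overall best two, which costs exactly one unit. *)
Lemma system_end p : (p < N)%N -> (2 <= p)%N -> (N <= p + k)%N ->
  [/\ g' p = g p, s' p = s p & t' p.+1 = t p.+1] /\
  [/\ g p = U p.+1, s p = U p.+1 & t p.+1 = U p.+1 - 1].
Proof.
move=> hp; have := ltnW hp; move: p hp.
have F : forall p, (p <= N)%N -> (p < N)%N -> (2 <= p)%N -> (N <= p + k)%N ->
  [/\ g' p = g p, s' p = s p & t' p.+1 = t p.+1] /\
  [/\ g p = U p.+1, s p = U p.+1 & t p.+1 = U p.+1 - 1].
  case: (Hs) (Hs') => H0 Ht Hg [H0' Ht' Hg'].
  apply: (@backward_ind N (fun p => (p < N)%N -> (2 <= p)%N -> (N <= p + k)%N -> _ /\ _)).
  move=> p _ IH hp h2 hpk.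
  have R2 := natR_le h2; have RN := natR_le hN.
  have Et : t p.+1 = U p.+1 - 1.
    case: (ltnP p.+1 N) => h3; last first.
      have <- : N = p.+1 by nlia.
      by rewrite H0 // pair_ratioN // subrr.
    have [_ [e1 e2 e3]] := IH p.+1 ltac:(nlia) ltac:(nlia) ltac:(nlia) ltac:(nlia).
    rewrite Ht; last nlia.
    have := @pair_ratioS N p.+1 ltac:(nlia); rewrite e1 e2 e3 => E.
    suff -> : (U p.+2 + U p.+2) / (p.+1%:R - 1) = U p.+1 - U p.+2 :> rat by ring.
    rewrite E /U -(@natr1 _ p.+1) addrK -(@natr1 _ p).
    by field; apply/and3P; split; lra.
  have Et' : t' p.+1 = t p.+1.
    case: (ltnP p.+1 N) => h3; last by rewrite H0 ?H0' //; nlia.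
    have [[e1 e2 e3] _] := IH p.+1 ltac:(nlia) ltac:(nlia) ltac:(nlia) ltac:(nlia).
    rewrite (Ht p.+1); last by nlia.
    rewrite (Ht' p.+1); last by nlia.
    by rewrite e1 e2 e3.
  have Es : s p = U p.+1.
    rewrite /newcomer_second (H0 (p + k)%N) // subr0 Et.
    have -> : pospart 1 = 1 by [].
    by ring.
  have Es' : s' p = s p.
    by rewrite /newcomer_second (H0 (p + k)%N) // (H0' (p + k.+1)%N) ?Et' //; nlia.
  have M1 : Num.max (rbest N) 0 = 1 by rewrite best_ratioN.
  have Z : forall q : nat, (N <= q)%N -> Num.max (rbest N) (t N + pospart (1 - t q)) = 1
           /\ Num.max (rbest N) (t' N + pospart (1 - t' q)) = 1.
    by move=> q hq; rewrite best_ratioN // (H0 N) // (H0 q) // (H0' N) // (H0' q) // subr0 add0r.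
  have eN : seen N k p = N by rewrite seenN.
  have eN' : seen N k.+1 p = N by rewrite /seen; apply/minn_idPr; nlia.
  have := Hg p ltac:(nlia); have := Hg' p ltac:(nlia); rewrite /= eN eN'.
  rewrite (H0 N) // (H0' N) // M1 !mulr1 => E' E.
  have ES : \sum_(p.+1 <= j < N) g j = npairs / p.+1%:R - npairs / N%:R.
    rewrite -sum_inv_pair // big_nat_cond [RHS]big_nat_cond; apply: eq_bigr => j /andP[/andP[h3 h4] _].
    have [_ [-> _ _]] := IH j ltac:(nlia) ltac:(nlia) ltac:(nlia) ltac:(nlia).
    by rewrite /U -(@natr1 _ j) addrK.
  have ES' : \sum_(p.+1 <= j < N) g' j = \sum_(p.+1 <= j < N) g j.
    rewrite big_nat_cond [RHS]big_nat_cond; apply: eq_bigr => j /andP[/andP[h3 h4] _].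
    by have [[-> _ _] _] := IH j ltac:(nlia) ltac:(nlia) ltac:(nlia) ltac:(nlia).
  have SM : \sum_(p.+1 <= j < N) Num.max (rbest N) (0 + pospart (1 - t (j + k)%N)) = N%:R - p.+1%:R.
    rewrite -[RHS]mulr1 -sum_const // big_nat_cond [RHS]big_nat_cond; apply: eq_bigr => j /andP[/andP[h3 h4] _].
    by have [h _] := @Z (j + k)%N ltac:(nlia); rewrite (H0 N) in h.
  have SM' : \sum_(p.+1 <= j < N) Num.max (rbest N) (0 + pospart (1 - t' (j + k.+1)%N)) = N%:R - p.+1%:R.
    rewrite -[RHS]mulr1 -sum_const // big_nat_cond [RHS]big_nat_cond; apply: eq_bigr => j /andP[/andP[h3 h4] _].
    by have [_ h] := @Z (j + k.+1)%N ltac:(nlia); rewrite (H0' N) in h.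
  have Hp0 : (p%:R : rat) != 0 by apply: lt0r_neq0; lra.
  have Eg' : g' p = g p by apply: (mulfI Hp0); rewrite E E' ES' SM SM'.
  have Eg : g p = U p.+1.
    apply: (mulfI Hp0); rewrite E ES SM /U /pair_count -(@natr1 _ p).
    by field; apply/and3P; split; lra.
  by [].
by move=> p h1 h2 h3 h4; apply: F.
Qed.

(** * Increments of [t] and of the options under a common bound [A] *)

Section Step.
Variables (A : rat) (u : nat).
Hypotheses (hu : (2 <= u <= N)%N) (A0 : 0 <= A).
Hypothesis Hlow : forall j, (u <= j < N)%N -> 0 <= (g' j - g j) /\ 0 <= (s' j - s j).
Hypothesis Hupp : forall j, (u <= j < N)%N ->
  (g' j - g j) + (s' j - s j) <= 2 * A / (j.+1%:R * j%:R).

Lemma dt_diff_ge0 a b : (u <= a)%N -> (a <= b <= N)%N -> 0 <= (t' a - t a) - (t' b - t b).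
Proof.
case: (Hs) (Hs') => H0 Ht Hg [H0' Ht' Hg'].
move=> ha /andP[hab]; elim: b hab => [|b IH]; first by nlia.
rewrite leq_eqVlt => /orP[/eqP<- _|hab hb]; first by rewrite !subrr.
have := IH ltac:(nlia) ltac:(nlia).
have Eb := Ht b ltac:(nlia); have Eb' := Ht' b ltac:(nlia).
have [h1 h2] := Hlow (j := b) ltac:(nlia).
have R : (2:rat) <= b%:R by apply: (natR_le (a:=2)); nlia.
have : 0 <= ((g' b - g b) + (s' b - s b)) / (b%:R - 1) by apply: divr_ge0; lra.
have -> : ((g' b - g b) + (s' b - s b)) / (b%:R - 1) = (t' b - t b) - (t' b.+1 - t b.+1) :> rat.
  by rewrite Eb Eb'; field; lra.
by lra.
Qed.

Lemma dt_diff_le a b : (u <= a)%N -> (a <= b <= N)%N ->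
  (t' a - t a) - (t' b - t b) <= A / (a%:R * (a%:R - 1)) - A / (b%:R * (b%:R - 1)).
Proof.
case: (Hs) (Hs') => H0 Ht Hg [H0' Ht' Hg'].
move=> ha /andP[hab]; elim: b hab => [|b IH]; first by nlia.
rewrite leq_eqVlt => /orP[/eqP<- _|hab hb]; first by rewrite !subrr.
have := IH ltac:(nlia) ltac:(nlia).
have Eb := Ht b ltac:(nlia); have Eb' := Ht' b ltac:(nlia).
have h1 := Hupp (j := b) ltac:(nlia).
have R : (2:rat) <= b%:R by apply: (natR_le (a:=2)); nlia.
have : ((g' b - g b) + (s' b - s b)) / (b%:R - 1) <= 2 * A / (b.+1%:R * b%:R) / (b%:R - 1).
  by rewrite ler_pM2r // invr_gt0; lra.
have -> : 2 * A / (b.+1%:R * b%:R) / (b%:R - 1) =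
  A / (b%:R * (b%:R - 1)) - A / (b.+1%:R * (b.+1%:R - 1)) :> rat.
  by rewrite -(@natr1 _ b) addrK; field; apply/and3P; split; lra.
have -> : ((g' b - g b) + (s' b - s b)) / (b%:R - 1) = (t' b - t b) - (t' b.+1 - t b.+1) :> rat.
  by rewrite Eb Eb'; field; lra.
by move: (A / _) (A / _) (A / _) => x y z; lra.
Qed.

Lemma dt_bounds a : (u <= a <= N)%N ->
  0 <= t' a - t a <= A / (a%:R * (a%:R - 1)) - A / npairs.
Proof.
move=> /andP[h1 h2]; have := dt_diff_ge0 (a:=a) (b:=N) h1 ltac:(nlia).
have := dt_diff_le (a:=a) (b:=N) h1 ltac:(nlia).
by case: (Hs) (Hs') => H0 _ _ [H0' _ _]; rewrite (H0 N) // (H0' N) // /pair_count !subr0 => -> ->.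
Qed.

Lemma bound_ge0 : 0 <= A / npairs.
Proof. by apply: divr_ge0 => //; apply: ltW; apply: pair_count_gt0. Qed.

Lemma gain_incr_ge0 a q : (u <= a <= N)%N -> (a <= q)%N ->
  t a + pospart (1 - t q) <= t' a + pospart (1 - t' q.+1).
Proof.
move=> h1 h2; case: (Hs) (Hs') => H0 Ht Hg [H0' Ht' Hg'].
have /andP[d0 _] := dt_bounds h1.
case: (leqP N q.+1) => hq.
  rewrite (H0' q.+1) // subr0.
  have -> : pospart 1 = 1 by [].
  have := t_ge0 hN hk Hs (a:=q) ltac:(nlia).
  by case: (pospartE (1 - t q)) => -[h3 ->]; lra.
have d1 := dt_diff_ge0 (a:=a) (b:=q.+1) ltac:(nlia) ltac:(nlia).
have /andP[d2 _] := dt_bounds (a:=q.+1) ltac:(nlia).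
have := t_mono hN hk Hs (a:=q) (b:=q.+1) ltac:(nlia) ltac:(nlia).
by case: (pospartE (1 - t q)) => -[h3 ->]; case: (pospartE (1 - t' q.+1)) => -[h4 ->]; lra.
Qed.

Lemma gain_incr_le a q : (u <= a <= N)%N -> (a <= q)%N -> 2 * npairs / q.+1%:R <= A ->
  (t' a + pospart (1 - t' q.+1)) - (t a + pospart (1 - t q)) <= A / (a%:R * (a%:R - 1)).
Proof.
move=> h1 h2 hA; case: (Hs) (Hs') => H0 Ht Hg [H0' Ht' Hg'].
have /andP[d0 d3] := dt_bounds h1; have A1 := bound_ge0.
case: (leqP N q) => hq.
  by rewrite (H0' q.+1) ?(H0 q) //; [lra | nlia].
case: (leP 1 (t' q.+1)) => ht.
  have -> : pospart (1 - t' q.+1) = 0 by case: (pospartE (1 - t' q.+1)) => -[h4 ->]; lra.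
  by have := pospart_ge0 (1 - t q); lra.
have d1 := dt_diff_le (a:=a) (b:=q) ltac:(nlia) ltac:(nlia).
have := pospart_ge (1 - t q).
have -> : pospart (1 - t' q.+1) = 1 - t' q.+1.
  by case: (pospartE (1 - t' q.+1)) => -[h4 ->]; lra.
have R : (2:rat) <= q%:R by apply: (natR_le (a:=2)); nlia.
(* The option moves from deadline [q] to [q.+1], which costs one step of [t']. By [hA] this is at
   most A / (q (q - 1)), the amount that [dt_diff_le] between [a] and [q] leaves over. *)
have h5 : t' q - t' q.+1 <= A / (q%:R * (q%:R - 1)).
  have [h _] := system_upper hN (isT : (0 < k.+1)%N) Hs' (n:=q) ltac:(nlia) ltac:(nlia).
  apply: le_trans (h q.+1 ltac:(nlia)) _; rewrite pair_ratioS; last nlia.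
  have -> : 2 * npairs / (q.+1%:R * q%:R * (q%:R - 1)) = (2 * npairs / q.+1%:R) / (q%:R * (q%:R - 1)) :> rat.
    by rewrite -(@natr1 _ q); field; apply/and3P; split; lra.
  by rewrite ler_pM2r // invr_gt0; nra.
by lra.
Qed.

End Step.
End Two.

Lemma maxE (x y : rat) : (x <= y /\ Num.max x y = y) \/ (y <= x /\ Num.max x y = x).
Proof. by case: leP => h; [left|right]; split => //; apply: ltW. Qed.

Lemma max_gap_ge0 (x x' a c d : rat) : x <= x' -> x' <= d -> a <= c -> 0 <= c + d - (x + a).
Proof. by move=> h1 h2 h3; lra. Qed.

Lemma max_gap_le_best (c E a1 a2 B re ru m : rat) :
  c <= E -> E = a1 + a2 -> a1 <= B -> a2 <= re - ru -> re <= m -> c + ru - m <= B.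
Proof. by move=> h1 h2 h3 h4 h5; lra. Qed.

Lemma max_gap_le_cont (w c a q1 q2 B x x' m : rat) :
  w <= q1 -> w = c - a -> q1 + q2 = B -> x' - x <= q2 -> x + a <= m -> c + x' - m <= B.
Proof. by move=> h1 h2 h3 h4 h5; lra. Qed.

(** * Increment of a single maximum term *)

Section Pos.
Variable N : nat.
Hypothesis hN : (2 < N)%N.
Notation npairs := (pair_count N).
Notation rbest := (best_ratio N).
Notation U := (pair_ratio N).

(** The recursion of the wider window has two extra terms, those with j = e; [c] spreads them evenly
    over the e - 1 maximum terms that both windows share. [D] is the resulting increment of one such
    term. *)
Lemma max_incr_ge0 (e : nat) (A x x' gk sk gK sK : rat) :
  (2 <= e < N)%N -> A = 2 * npairs / e.+1%:R ->
  x <= x' -> x' - x <= A / (e.+1%:R * (e.+1%:R - 1)) -> x' <= sK ->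
  gk <= gK -> sk <= sK ->
  (gK - gk) + (sK - sk) <= 2 * A / (e.+1%:R * e%:R) ->
  gK + sK <= 2 * U e.+1 -> rbest e.+1 <= gK -> 0 <= sK ->
  let c : rat := (gK + Num.max (rbest e.+1) sK) / (e%:R - 1) in
  let D : rat := c + Num.max (rbest e.+1) x' - Num.max (rbest e) (x + (gk + sk) / (e%:R - 1)) in
  is_true (0 <= D).
Proof.
intros he hA hx hx' hxs hg hs hd hU hr s0 c D.
have /andP[h1 h2] := he; have R1 := natR_le h1; have := natR_le h2; rewrite -(@natr1 _ e) => R2.
have Er : rbest e - rbest e.+1 = (2 * N%:R - 2) / (e%:R * (e%:R - 1)) by exact: (best_ratioS N h1).
have E1 : rbest e.+1 = (2 * N%:R - e%:R - 2) / e%:R by rewrite /best_ratio -(@natr1 _ e); field; lra.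
have m1 : rbest e.+1 <= Num.max (rbest e.+1) sK by rewrite le_max lexx.
have m2 : sK <= Num.max (rbest e.+1) sK by rewrite le_max lexx orbT.
have m3 : rbest e.+1 <= Num.max (rbest e.+1) x' by rewrite le_max lexx.
have m4 : x' <= Num.max (rbest e.+1) x' by rewrite le_max lexx orbT.
rewrite /D; case: (maxE (rbest e) (x + (gk + sk) / (e%:R - 1))) => -[_ ->].
  have : (gk + sk) / (e%:R - 1) <= c.
    rewrite /c ler_pM2r; first exact: lerD hg (le_trans hs m2).
    by rewrite invr_gt0; lra.
  move=> h; exact: max_gap_ge0 hx m4 h.
have : 2 * rbest e.+1 / (e%:R - 1) <= c.
  rewrite /c ler_pM2r; last by rewrite invr_gt0; lra.
  by rewrite mulr_natl mulr2n; apply: lerD.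
have : (2 * N%:R - 2) / (e%:R * (e%:R - 1)) <= 2 * rbest e.+1 / (e%:R - 1).
  rewrite E1; have -> : 2 * ((2 * N%:R - e%:R - 2) / e%:R) / (e%:R - 1) =
      (2 * (2 * N%:R - e%:R - 2)) / (e%:R * (e%:R - 1)) :> rat.
    by field; apply/andP; split; lra.
  by rewrite ler_pM2r ?invr_gt0; nra.
by rewrite -Er; lra.
Qed.

Lemma max_incr_le (e : nat) (A x x' gk sk gK sK : rat) :
  (2 <= e < N)%N -> A = 2 * npairs / e.+1%:R ->
  x <= x' -> x' - x <= A / (e.+1%:R * (e.+1%:R - 1)) -> x' <= sK ->
  gk <= gK -> sk <= sK ->
  (gK - gk) + (sK - sk) <= 2 * A / (e.+1%:R * e%:R) ->
  gK + sK <= 2 * U e.+1 -> rbest e.+1 <= gK -> 0 <= sK ->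
  let c : rat := (gK + Num.max (rbest e.+1) sK) / (e%:R - 1) in
  let D : rat := c + Num.max (rbest e.+1) x' - Num.max (rbest e) (x + (gk + sk) / (e%:R - 1)) in
  is_true (D <= A / (e%:R * (e%:R - 1))).
Proof.
intros he hA hx hx' hxs hg hs hd hU hr s0 c D.
have /andP[h1 h2] := he; have R1 := natR_le h1; have := natR_le h2; rewrite -(@natr1 _ e) => R2.
have Er : rbest e - rbest e.+1 = (2 * N%:R - 2) / (e%:R * (e%:R - 1)) by exact: (best_ratioS N h1).
have E1 : rbest e.+1 = (2 * N%:R - e%:R - 2) / e%:R by rewrite /best_ratio -(@natr1 _ e); field; lra.
have m1 : rbest e <= Num.max (rbest e) (x + (gk + sk) / (e%:R - 1)) by rewrite le_max lexx.
have m2 : x + (gk + sk) / (e%:R - 1) <= Num.max (rbest e) (x + (gk + sk) / (e%:R - 1)).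
  by rewrite le_max lexx orbT.
have r0 : 1 <= rbest e.+1 by apply: best_ratio_ge1; rewrite // h2 ltnS ltnW.
rewrite /D; case: (maxE (rbest e.+1) x') => -[hx1 ->]; last first.
  have hc : c <= (gK + rbest e.+1 + sK) / (e%:R - 1).
    rewrite /c ler_pM2r ?invr_gt0; last lra.
    by case: (maxE (rbest e.+1) sK) => -[_ ->]; lra.
  have h3 : rbest e.+1 / (e%:R - 1) <= rbest e - rbest e.+1.
    rewrite Er E1; have -> : (2 * N%:R - e%:R - 2) / e%:R / (e%:R - 1) =
        (2 * N%:R - e%:R - 2) / (e%:R * (e%:R - 1)) :> rat.
      by field; apply/andP; split; lra.
    by rewrite ler_pM2r ?invr_gt0; nra.
  have h4 : (gK + sK) / (e%:R - 1) <= A / (e%:R * (e%:R - 1)).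
    have -> : A / (e%:R * (e%:R - 1)) = (2 * U e.+1) / (e%:R - 1).
      by rewrite hA /pair_ratio -(@natr1 _ e) addrK; field; apply/and3P; split; lra.
    by rewrite ler_pM2r // invr_gt0; lra.
  have E5 : (gK + rbest e.+1 + sK) / (e%:R - 1) = (gK + sK) / (e%:R - 1) + rbest e.+1 / (e%:R - 1).
    by field; lra.
  exact: max_gap_le_best hc E5 h4 h3 m1.
(* If it continues, [x' <= sK] makes its other maximum a continuation as well, and the two increment
   bounds add up exactly. *)
have hm : Num.max (rbest e.+1) sK = sK by apply/max_idPr; lra.
have Ec : c = (gK + sK) / (e%:R - 1) by rewrite /c hm.
have h3 : (gK - gk + (sK - sk)) / (e%:R - 1) <= 2 * A / (e.+1%:R * e%:R) / (e%:R - 1).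
  by rewrite ler_pM2r // invr_gt0; lra.
have E3 : (gK - gk + (sK - sk)) / (e%:R - 1) = c - (gk + sk) / (e%:R - 1).
  by rewrite Ec; field; lra.
have E4 : 2 * A / (e.+1%:R * e%:R) / (e%:R - 1) + A / (e.+1%:R * (e.+1%:R - 1)) = A / (e%:R * (e%:R - 1)).
  by rewrite -(@natr1 _ e) addrK; field; apply/and3P; split; lra.
exact: max_gap_le_cont h3 E3 E4 hx' m2.
Qed.
End Pos.

(** * Effect of one more index in the window *)

Section Two.
Variable N : nat.
Hypothesis hN : (2 < N)%N.
Variables (k : nat) (t g t' g' : nat -> rat).
Hypotheses (hk : (0 < k)%N) (Hs : system N k t g) (Hs' : system N k.+1 t' g').

Notation npairs := (pair_count N).
Notation rbest := (best_ratio N).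
Notation U := (pair_ratio N).
Notation s := (newcomer_second k t).
Notation s' := (newcomer_second k.+1 t').

Lemma sum_le (a b : nat) (F G : nat -> rat) :
  (forall j, (a <= j < b)%N -> F j <= G j) ->
  \sum_(a <= j < b) F j <= \sum_(a <= j < b) G j.
Proof.
move=> h; rewrite big_nat_cond [leRHS]big_nat_cond; apply: ler_sum => j /andP[h1 _].
exact: h.
Qed.

(** The profile A / ((p + 1) p) reproduces itself under the recursion: later increments sum to A /
    (p + 1) - A / e, the e - 1 maxima contribute A / (e (e - 1)) each, and the total is A / (p + 1).
    The size of [A] is that of one step of [pair_ratio] at the deadline p + k, and it dominates the
    constants of all later positions. *)
Lemma system_incr p : (p < N)%N -> (2 <= p)%N ->
  [/\ 0 <= g' p - g p, 0 <= s' p - s p,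
      (g' p - g p) <= (2 * npairs / (p.+1 + k)%:R) / (p.+1%:R * p%:R)
    & (s' p - s p) <= (2 * npairs / (p.+1 + k)%:R) / (p.+1%:R * p%:R)].
Proof.
move=> hp; have := ltnW hp; move=> hpN; move: p hpN hp.
apply: (@backward_ind N (fun p => (p < N)%N -> (2 <= p)%N -> _)) => p _ IH hp h2.
have M0 : 0 < npairs by exact: pair_count_gt0.
have B0 : forall q : nat, (2 <= q)%N -> 0 <= (2 * npairs / (q.+1 + k)%:R) / (q.+1%:R * q%:R).
  move=> q _; apply: divr_ge0; last by apply: mulr_ge0.
  by apply: divr_ge0 => //; lra.
case: (leqP N (p + k)) => hpk.
  have [[-> -> _] _] := system_end hN hk Hs Hs' hp h2 hpk.
  by rewrite !subrr; split => //; apply: B0.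
case: (Hs) (Hs') => H0 Ht Hg [H0' Ht' Hg'].
pose A : rat := 2 * npairs / (p.+1 + k)%:R.
pose u := p.+1.
have A0 : 0 <= A by apply: divr_ge0 => //; lra.
have AA : forall i, (p.+1 + k <= i)%N -> 2 * npairs / i%:R <= A.
  move=> i hi; rewrite /A ler_pM2l; last lra.
  by rewrite lef_pV2 ?qualifE /= ?ltr0n ?ler_nat //; nlia.
have Hlow : forall j, (u <= j < N)%N -> 0 <= (g' j - g j) /\ 0 <= (s' j - s j).
  by move=> j hj; have [] := IH j ltac:(nlia) ltac:(nlia) ltac:(nlia).
have Hu1 : forall j, (u <= j < N)%N -> (g' j - g j) <= A / (j.+1%:R * j%:R) /\ (s' j - s j) <= A / (j.+1%:R * j%:R).
  move=> j hj; have [_ _ h3 h4] := IH j ltac:(nlia) ltac:(nlia) ltac:(nlia).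
  have h5 : 2 * npairs / (j.+1 + k)%:R / (j.+1%:R * j%:R) <= A / (j.+1%:R * j%:R).
    rewrite ler_pM2r ?AA //; first by nlia.
    by rewrite invr_gt0 mulr_gt0 ?ltr0n //; nlia.
  by split; [apply: le_trans h3 h5|apply: le_trans h4 h5].
have Hupp : forall j, (u <= j < N)%N ->
    (g' j - g j) + (s' j - s j) <= 2 * A / (j.+1%:R * j%:R).
  move=> j hj; have [h3 h4] := Hu1 j hj.
  by rewrite -mulrA mulr_natl mulr2n; apply: lerD.
have hu : (2 <= u <= N)%N by nlia.
have Ylow := gain_incr_ge0 hN hk Hs Hs' hu Hlow Hupp.
have Yupp := gain_incr_le hN hk Hs Hs' hu A0 Hlow Hupp.
have Tb := dt_bounds hN hk Hs Hs' hu Hlow Hupp.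
have sl : 0 <= s' p - s p.
  by rewrite /newcomer_second addnS; have := Ylow p.+1 (p + k)%N ltac:(nlia) ltac:(nlia); lra.
have su : s' p - s p <= A / (p.+1%:R * p%:R).
  rewrite /newcomer_second addnS; have := Yupp p.+1 (p + k)%N ltac:(nlia) ltac:(nlia).
  by rewrite -(@natr1 _ p) addrK => h; apply: h; apply: AA; nlia.
have R1 := natR_le h2.
pose e := (p + k)%N.
have Re : (2:rat) <= e%:R by apply: (natR_le (a:=2)); nlia.
have he : (2 <= e < N)%N by nlia.
have hA : A = 2 * npairs / e.+1%:R by rewrite /A /e addSn.
have seK : seen N k.+1 p = e.+1 by rewrite /seen /e addnS; apply/minn_idPl; nlia.
have sek : seen N k p = e by rewrite /seen /e; apply/minn_idPl; nlia.
have := Hg p ltac:(nlia); have := Hg' p ltac:(nlia); rewrite /= seK sek.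
have he1 : (p.+1 <= e)%N by rewrite /e; nlia.
rewrite !(big_nat_recr e p.+1) //=.
have -> : t' e.+1 + pospart (1 - t' (e + k.+1)%N) = s' e by [].
set c := (g' e + Num.max (rbest e.+1) (s' e)) / (e%:R - 1).
have Ec : g' e + Num.max (rbest e.+1) (s' e) = (e%:R - 1) * c by rewrite /c mulrC divfK //; lra.
have [ge0 se0] := Hlow e ltac:(nlia).
have D : forall x x', x <= x' -> x' - x <= A / (e.+1%:R * (e.+1%:R - 1)) -> x' <= s' e ->
   0 <= c + Num.max (rbest e.+1) x' - Num.max (rbest e) (x + (g e + s e) / (e%:R - 1)) <= A / (e%:R * (e%:R - 1)).
  move=> x x' i1 i2 i3.
  have j1 : g e <= g' e by lra.
  have j2 : s e <= s' e by lra.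
  have j3 := Hupp e ltac:(nlia).
  have j4 := g_le hN (isT : (0 < k.+1)%N) Hs' he.
  have j5 := s_le hN (isT : (0 < k.+1)%N) Hs' he.
  have j6 := g_ge hN (isT : (0 < k.+1)%N) Hs' he.
  have j7 := s_ge1 hN (isT : (0 < k.+1)%N) Hs' he.
  apply/andP; split; first by apply: max_incr_ge0 => //; lra.
  by apply: max_incr_le => //; lra.
have Te : t e = t e.+1 + (g e + s e) / (e%:R - 1) by apply: Ht.
have D0 := D (t e.+1) (t' e.+1).
have {}D0 : 0 <= c + Num.max (rbest e.+1) (t' e.+1) - Num.max (rbest e) (t e) <= A / (e%:R * (e%:R - 1)).
  rewrite Te; apply: D0.
  - by have /andP[] := Tb e.+1 ltac:(nlia); lra.
  - have /andP[_ h] := Tb e.+1 ltac:(nlia); apply: le_trans h _.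
    by rewrite gerBl; apply: divr_ge0 => //; apply: ltW.
  - by rewrite /newcomer_second lerDl pospart_ge0.
have Dj : forall j, (p.+1 <= j < e)%N -> 0 <= c + Num.max (rbest e.+1) (t' e.+1 + pospart (1 - t' (j + k.+1)%N))
    - Num.max (rbest e) (t e + pospart (1 - t (j + k)%N)) <= A / (e%:R * (e%:R - 1)).
  move=> j hj; rewrite Te [t e.+1 + _ + _]addrAC; apply: D.
  - by rewrite addnS; apply: Ylow; nlia.
  - by rewrite addnS; apply: Yupp; [nlia|nlia|apply: AA; nlia].
  - rewrite /newcomer_second lerD2l; apply: le_pospart.
    have := t_mono hN (isT : (0 < k.+1)%N) Hs' (a := (j + k.+1)%N) (b := (e + k.+1)%N) ltac:(nlia) ltac:(nlia).
    by lra.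
move=> E' E.
have S1 : 0 <= \sum_(p.+1 <= j < e) (g' j - g j) <= A / p.+1%:R - A / e%:R.
  apply/andP; split.
    rewrite big_nat_cond; apply: sumr_ge0 => j /andP[hj _]; have [] := Hlow j ltac:(nlia); lra.
  rewrite -sum_inv_pair //.
  by apply: sum_le => j hj; have [] := Hu1 j ltac:(nlia).
have S2 : 0 <= \sum_(p.+1 <= j < e) (c + Num.max (rbest e.+1) (t' e.+1 + pospart (1 - t' (j + k.+1)%N))
    - Num.max (rbest e) (t e + pospart (1 - t (j + k)%N))) <= (e%:R - p.+1%:R) * (A / (e%:R * (e%:R - 1))).
  apply/andP; split.
    by rewrite big_nat_cond; apply: sumr_ge0 => j /andP[hj _]; have /andP[] := Dj j hj.
  rewrite -sum_const; last by nlia.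
  by apply: sum_le => j hj; have /andP[] := Dj j hj.
rewrite sumrB in S1; rewrite sumrB big_split /= sum_const in S2; last by nlia.
have EE : p%:R * (g' p - g p) =
   (\sum_(p.+1 <= i < e) g' i - \sum_(p.+1 <= i < e) g i)
   + p%:R * (c + Num.max (rbest e.+1) (t' e.+1) - Num.max (rbest e) (t e))
   + ((e%:R - p.+1%:R) * c +
     \sum_(p.+1 <= i < e) Num.max (rbest e.+1) (t' e.+1 + pospart (1 - t' (i + k.+1)%N)) -
     \sum_(p.+1 <= i < e) Num.max (rbest e) (t e + pospart (1 - t (i + k)%N))).
  rewrite mulrBr E E'.
  have := Ec; rewrite -(@natr1 _ p) => Ec'.
  have -> : p%:R * (c + Num.max (rbest e.+1) (t' e.+1) - Num.max (rbest e) (t e)) =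
     (e%:R - 1) * c - (e%:R - (p%:R + 1)) * c + p%:R * Num.max (rbest e.+1) (t' e.+1) - p%:R * Num.max (rbest e) (t e) by ring.
  by rewrite -Ec'; ring.
move: D0 S1 S2 => /andP[d1 d2] /andP[s1 s2] /andP[s3 s4].
have d1' : 0 <= p%:R * (c + Num.max (rbest e.+1) (t' e.+1) - Num.max (rbest e) (t e)) by apply: mulr_ge0; lra.
have d2' : p%:R * (c + Num.max (rbest e.+1) (t' e.+1) - Num.max (rbest e) (t e)) <= p%:R * (A / (e%:R * (e%:R - 1))).
  by rewrite ler_pM2l //; lra.
have G1 : 0 <= p%:R * (g' p - g p) by rewrite EE; apply: addr_ge0 => //; apply: addr_ge0.
have G2 : p%:R * (g' p - g p) <= A / p.+1%:R.
  rewrite EE; apply: le_trans (lerD (lerD s2 d2') s4) _.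
  rewrite le_eqVlt; apply/orP; left; apply/eqP; rewrite -(@natr1 _ p).
  by field; apply/and3P; split; lra.
split => //.
  by rewrite -(@pmulr_rge0 _ p%:R) //; lra.
rewrite -(@ler_pM2l _ p%:R); last lra.
apply: le_trans G2 _; rewrite -/A le_eqVlt; apply/orP; left; apply/eqP.
by rewrite -(@natr1 _ p); field; apply/andP; split; lra.
Qed.

Lemma dt_ge0 n : (2 <= n)%N -> 0 <= t' n - t n.
Proof.
move=> h2; case: (leqP n N) => hn; last first.
  by case: (Hs) (Hs') => H0 _ _ [H0' _ _]; rewrite H0 ?H0' ?subrr //; nlia.
have M0 : 0 < npairs by exact: pair_count_gt0.
have := @dt_diff_ge0 N hN k t g t' g' hk Hs Hs' n ltac:(nlia) _ n N (leqnn _) ltac:(nlia).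
case: (Hs) (Hs') => H0 _ _ [H0' _ _]; rewrite (H0 N) // (H0' N) // !subr0; apply.
by move=> j hj; have [] := @system_incr j ltac:(nlia) ltac:(nlia).
Qed.

Lemma dt_le n : (2 <= n <= N)%N -> t' n - t n <= 2 / (n.+1 + k)%:R * (U n - 1).
Proof.
move=> hn; have M0 : 0 < npairs by exact: pair_count_gt0.
pose A : rat := 2 * npairs / (n.+1 + k)%:R.
have A0 : 0 <= A by apply: divr_ge0 => //; lra.
have := @dt_diff_le N hN k t g t' g' hk Hs Hs' A n ltac:(nlia) _ n N (leqnn _) ltac:(nlia).
case: (Hs) (Hs') => H0 _ _ [H0' _ _]; rewrite (H0 N) // (H0' N) // !subr0.
have R1 : (2:rat) <= n%:R by apply: (natR_le (a:=2)); nlia.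
have R2 : (0:rat) < (n.+1 + k)%:R by rewrite ltr0n; nlia.
have R3 := natR_le hN.
have -> : A / (n%:R * (n%:R - 1)) - A / (N%:R * (N%:R - 1)) = 2 / (n.+1 + k)%:R * (U n - 1).
  rewrite /A /pair_ratio /pair_count; move: (_ + k)%:R R2 => c R2.
  by field; do ?[apply/andP; split]; lra.
apply => j hj.
have [_ _ h3 h4] := @system_incr j ltac:(nlia) ltac:(nlia).
have h5 : 2 * npairs / (j.+1 + k)%:R / (j.+1%:R * j%:R) <= A / (j.+1%:R * j%:R).
  rewrite ler_pM2r; last by rewrite invr_gt0 mulr_gt0 ?ltr0n //; nlia.
  rewrite /A ler_pM2l; last lra.
  by rewrite lef_pV2 ?qualifE /= ?ltr0n ?ler_nat //; nlia.
rewrite -mulrA mulr_natl mulr2n.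
by apply: lerD; [apply: le_trans h3 h5|apply: le_trans h4 h5].
Qed.

End Two.

(* With [n = i + k] applicants seen, [n / pair_count N * best_cont k t n] is the
   value of rejecting the best applicant at the first index [i] of the window:
   the second best one is uniformly distributed over the other [n - 1] positions. *)
Definition best_cont (k : nat) (t : nat -> rat) (n : nat) : rat :=
  (n%:R - 1) * t n + \sum_(n.+1 <= u < n + k) pospart (1 - t u).

(** * The value of rejecting the best applicant *)

Section BestCont.
Variables (N k : nat) (t g : nat -> rat).
Hypotheses (hN : (2 < N)%N) (hk : (0 < k)%N) (Hs : system N k t g).

Lemma best_contS n : (2 <= n < N)%N ->
  best_cont k t n = best_cont k t n.+1 + g n + pospart (1 - t n.+1).
Proof.
move=> hn; have R := natR_le (proj1 (andP hn)).
case: (Hs) => H0 Ht _; rewrite /best_cont [t n in LHS]Ht // /newcomer_second.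
have E : \sum_(n.+1 <= u < n + k) pospart (1 - t u) + pospart (1 - t (n + k)%N) =
   pospart (1 - t n.+1) + \sum_(n.+2 <= u < n.+1 + k) pospart (1 - t u).
  rewrite -big_nat_recr /=; last by lia.
  by rewrite addSn -big_ltn //; lia.
rewrite -natr1 addrK mulrDr mulrCA divff; last by lra.
rewrite mulr1.
move: E; set x := \sum_(n.+1 <= u < n + k) _; set y := \sum_(n.+2 <= u < _) _.
move: (pospart _) (pospart _) => a b E; lra.
Qed.

Lemma best_contN : best_cont k t N = k%:R - 1.
Proof.
case: (Hs) => H0 _ _; rewrite /best_cont H0 // mulr0 add0r.
rewrite (eq_big_nat _ _ (F2 := fun=> 1)); last first.
  by move=> u hu; rewrite H0 ?subr0; [ | lia].
by rewrite sum_const ?mulr1; [rewrite natrD -natr1; lra | lia].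
Qed.

Lemma best_cont_sum n : (2 <= n <= N)%N ->
  best_cont k t n = k%:R - 1 + \sum_(n <= p < N) (g p + pospart (1 - t p.+1)).
Proof.
move=> /andP[h2 hn]; rewrite -best_contN; move: n hn h2.
apply: (@backward_ind N (fun n => (2 <= n)%N -> _)) => n hn IH h2.
case: (ltnP n N) => h.
  by rewrite best_contS ?h2 // (IH n.+1) ?ltnSn ?(leqW h2) // [in RHS]big_ltn //; lra.
have E : n = N by apply/eqP; rewrite eqn_leq hn.
by rewrite big_geq // addr0 E.
Qed.

(** One step lowers the left side by at least [g], which is at least 1, and the right side by
    exactly 1. *)
Lemma best_cont_mono a b : (2 <= a)%N -> (a <= b < N)%N ->
  best_cont k t a < 2 * N%:R - a%:R - 1 -> best_cont k t b < 2 * N%:R - b%:R - 1.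
Proof.
move=> h2 /andP[hab]; elim: b hab => [|b IH]; first by nlia.
rewrite leq_eqVlt => /orP[/eqP<- //|hab hb hA].
have := IH ltac:(nlia) ltac:(nlia) hA; rewrite best_contS; last by nlia.
have h3 := g_ge hN hk Hs (p := b) ltac:(nlia).
have h4 : 1 <= best_ratio N b.+1 by apply: best_ratio_ge1 => //; nlia.
have := pospart_ge0 (1 - t b.+1); rewrite -(@natr1 _ b); lra.
Qed.

(** Dropping the options turns the threshold condition into the comparison that decides the maxima
    in the recursion for [g]. *)
Lemma best_cont_ratio n : (2 <= n <= N)%N ->
  best_cont k t n < 2 * N%:R - n%:R - 1 -> t n < best_ratio N n.
Proof.
move=> /andP[h2 hn] h; have R := natR_le h2.
rewrite /best_ratio ltr_pdivlMr; last by lra.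
have : 0 <= \sum_(n.+1 <= u < n + k) pospart (1 - t u).
  by apply: sumr_ge0 => u _; apply: pospart_ge0.
by rewrite /best_cont in h; move: h; set x := \sum_(_ <= _ < _) _; lra.
Qed.

Lemma pospart_le1 n : (2 <= n)%N -> pospart (1 - t n) <= 1.
Proof.
move=> hn; have := t_ge0 hN hk Hs hn.
by case: (pospartE (1 - t n)) => -[h ->]; lra.
Qed.

(** Since [best_ratio n - 1 <= t n], the hypothesis forces [best_ratio n < 2]. A second best
    applicant is thus worth choosing only in the last third, which leaves room for crude
    estimates. *)
Lemma second_worth_late n : (2 <= n < N)%N -> t n < 1 -> 2 * N%:R + 1 < 3 * n%:R :> rat.
Proof.
move=> hn h; have := t_ge hN hk Hs (a := n) ltac:(nlia); have R := natR_le (proj1 (andP hn)).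
have E : (n%:R - 1) * best_ratio N n = 2 * N%:R - n%:R - 1.
  by rewrite /best_ratio mulrC divfK //; lra.
move=> h'; have : (n%:R - 1) * (best_ratio N n - 2) < 0 by rewrite pmulr_rlt0; lra.
lra.
Qed.

End BestCont.

(** * Threshold conditions passed on to the wider window *)

Section Two.
Variables (N k : nat) (t g t' g' : nat -> rat).
Hypotheses (hN : (2 < N)%N) (hk : (0 < k)%N).
Hypotheses (Hs : system N k t g) (Hs' : system N k.+1 t' g').
Notation rbest := (best_ratio N).
Notation U := (pair_ratio N).

Lemma second_imp_best n : (k < n < N)%N -> t n < 1 -> best_cont k t n < 2 * N%:R - n%:R - 1.
Proof.
move=> /andP[h1 h2] h; have R := natR_le h2; rewrite -natr1 in R.
have R2 := natR_le h1; rewrite -natr1 in R2.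
case: (leqP (n + k) N) => h3.
  have R3 := natR_le h3; rewrite natrD in R3.
  have h4 : \sum_(n.+1 <= u < n + k) pospart (1 - t u) <= k%:R - 1.
    rewrite [leRHS](_ : _ = \sum_(n.+1 <= u < n + k) 1).
      by apply: sum_le => j hj; apply: (pospart_le1 hN hk Hs); nlia.
    by rewrite sum_const; [rewrite mulr1 natrD -(@natr1 _ n); lra | nlia].
  have R4 := natR_le hk.
  have h5 : (n%:R - 1) * t n <= n%:R - 1 by rewrite ler_piMr; lra.
  rewrite /best_cont; move: h4; move: (bigop _ _ _) => x; lra.
rewrite (best_cont_sum hN hk Hs); last by nlia.
(* Here [t p.+1 = U p.+1 - 1] is below 1, so each summand U + (1 - (U - 1)) is exactly 2; the claim
   then reduces to [k < n]. *)
rewrite (eq_big_nat _ _ (F2 := fun=> 2)) => [|p hp].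
  by rewrite sum_const; [lra | exact: ltnW].
have [_ [-> _ E]] := system_end hN hk Hs Hs' (p := p) ltac:(nlia) ltac:(nlia) ltac:(nlia).
have := t_mono hN hk Hs (a := n) (b := p.+1) ltac:(nlia) ltac:(nlia).
rewrite E; case: (pospartE (1 - (U p.+1 - 1))) => -[h4 ->]; lra.
Qed.

(** Moving from [n] to [n.+1] lowers [t] by at least one step of [best_ratio], and widening raises
    it by at most [dt_le]; late enough, the drop is the larger of the two. *)
Lemma second_next n : (2 <= n < N)%N -> t n < 1 -> t' n.+1 < 1.
Proof.
move=> hn h; have h3 := second_worth_late hN hk Hs hn h.
have := t_step_ge hN hk Hs hn; rewrite best_ratioS; last by nlia.
have := dt_le hN hk Hs Hs' (n := n.+1) ltac:(nlia).
suff : 2 / (n.+2 + k)%:R * (U n.+1 - 1) <= (2 * N%:R - 2) / (n%:R * (n%:R - 1)).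
  by move: (_ / _) (_ * _) => x y; lra.
have [h2 hnN] := andP hn; have R2 := natR_le h2; have R1 := natR_le hnN.
have R3 := natR_le hk; rewrite -natr1 in R1.
have -> : U n.+1 - 1 = (N%:R - n%:R - 1) * (N%:R + n%:R) / ((n%:R + 1) * n%:R).
  by rewrite /pair_ratio /pair_count -natr1; field; apply/andP; split; lra.
have -> : (n.+2 + k)%:R = n%:R + k%:R + 2 :> rat by rewrite natrD -[n.+2]addn2 natrD; lra.
move: (n%:R) (N%:R) (k%:R) R1 R2 R3 h3 => x y z R1 R2 R3 h3.
rewrite mulrACA -invfM mulrA ler_pdivrMr; last by rewrite !mulr_gt0 //; lra.
rewrite [leRHS](_ : _ = 2 * (y - 1) * (x + z + 2) * (x + 1) / (x - 1)); last first.
  by field; apply/andP; split; lra.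
rewrite ler_pdivlMr; last by lra.
rewrite -!mulrA ler_pM2l //.
apply: (@le_trans _ _ ((y - 1) * ((x + 1) * (x - 1)))); last first.
  have H1 : (x + 1) * (x - 1) <= (x + z + 2) * (x + 1) by nra.
  have H2 : 0 <= y - 1 by lra.
  exact: ler_wpM2l H2 _ _ H1.
have H1 : (y - x - 1) * (y + x) <= (y - 1) * (x + 1) by nra.
have H2 : 0 <= x - 1 by lra.
by rewrite !mulrA; exact: ler_wpM2r H2 _ _ H1.
Qed.

(** The wider window gains one option whose deadline lies beyond [N], worth exactly 1, while the
    step to [n.+1] loses at least U + (2 - U) = 2. *)
Lemma best_next_end n : (2 <= n < N)%N -> (N <= n + k)%N ->
  best_cont k t n < 2 * N%:R - n%:R - 1 -> best_cont k.+1 t' n.+1 < 2 * N%:R - n.+1%:R - 1.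
Proof.
move=> hn hk'; rewrite (best_contS hN hk Hs) //.
have [[_ _ E] [-> _ Et]] := system_end hN hk Hs Hs' (p := n) ltac:(nlia) ltac:(nlia) hk'.
have -> : best_cont k.+1 t' n.+1 = best_cont k t n.+1 + 1.
  rewrite /best_cont E -addrA; congr (_ + _); rewrite addnS big_nat_recr /=; last by nlia.
  congr (_ + _); last first.
    by case: Hs' => H0 _ _; rewrite H0 ?subr0 //; nlia.
  apply: eq_big_nat => u hu.
  case: (leqP N u) => huN.
    by case: (Hs') (Hs) => H0 _ _ [H0' _ _]; rewrite H0 // H0'.
  case: u hu huN => // u hu huN.
  by have [[_ _ ->] _] := system_end hN hk Hs Hs' (p := u) ltac:(nlia) ltac:(nlia) ltac:(nlia).
rewrite Et -(@natr1 _ n); have := pospart_ge (1 - (U n.+1 - 1)); lra.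
Qed.

(** Crude bounds suffice: [pair_ratio] for [g'], 1 for each option, and slope (N - 1) / (n + 1) at
    most 2. What then remains to be checked is precisely N + k <= 2n. *)
Lemma best_next_late n : (2 <= n)%N -> (n + k < N)%N -> (N + k <= n.*2)%N ->
  best_cont k.+1 t' n.+1 < 2 * N%:R - n.+1%:R - 1.
Proof.
move=> h2 h3 h4; rewrite (best_cont_sum hN (ltn0Sn k) Hs'); last by nlia.
have h5 : \sum_(n.+1 <= p < N) (g' p + pospart (1 - t' p.+1)) <=
  \sum_(n.+1 <= p < N) (pair_count N / (p.+1%:R * p%:R) + 1).
  apply: sum_le => p hp; have R : (3 : rat) <= p%:R by apply: (natR_le (a := 3)); nlia.
  apply: lerD; last by apply: (pospart_le1 hN (ltn0Sn k) Hs'); nlia.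
  by apply: le_trans (g_le hN (ltn0Sn k) Hs' (p := p) _) _; [nlia | rewrite /pair_ratio -natr1 addrK].
rewrite [leRHS]big_split /= sum_inv_pair // ?sum_const in h5; try nlia.
have R4 := natR_le h4; rewrite natrD -muln2 natrM in R4.
have R2 := natR_le h2; have R3 := natR_le h3; have R1 := natR_le hk; rewrite -natr1 natrD in R3.
have E : pair_count N / n.+1%:R - pair_count N / N%:R = (N%:R - 1) / (n%:R + 1) * (N%:R - n%:R - 1).
  by rewrite /pair_count -natr1; field; apply/andP; split; lra.
rewrite E in h5; apply: le_lt_trans (_ : _ <= k.+1%:R - 1 + _) _; first by rewrite lerD2l; exact: h5.
have h6 : (N%:R - 1) / (n%:R + 1) <= 2 :> rat by rewrite ler_pdivrMr; lra.
have h7 : (N%:R - 1) / (n%:R + 1) * (N%:R - n%:R - 1) <= 2 * (N%:R - n%:R - 1) :> rat.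
  by rewrite ler_wpM2r //; lra.
by rewrite -!natr1; lra.
Qed.
End Two.

(* In each range the difference of the two sides is a polynomial with nonnegative
   coefficients in the slacks of the hypotheses. *)
Ltac positivity := lazymatch goal with
  | |- is_true (0 <= _ + _) => apply: addr_ge0; positivity
  | |- is_true (0 <= _ * _) => apply: mulr_ge0; positivity
  | |- is_true (0 <= _%:R) => apply: ler0n
  | |- _ => assumption
  end.

(** * Polynomial inequalities for the options still exposed *)

Lemma poly_early (k u N : rat) : 2 * k + 2 <= u -> 2 * u <= N -> 0 <= 3 * (u + k) - 2 * N - 1 ->
  (3 * (u + k) - 2 * N - 1) * (2 * (u * (u - 1)) + N * (N - 1)) <= (4 * k - 2) * (u + k - 1) * (u - 1).
Proof.
pose P w z x : rat := ((20 * z + (40 * x + 40)) * w + ((62 * z + (212 * x + 290)) * z + ((175 * x + 497) * x + 338))) * w + (((48 * z + (232 * x + 352)) * z + ((368 * x + 1132) * x + 860)) * z + (((192 * x + 896) * x + 1380) * x + 700)).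
have P0 w z x : 0 <= w -> 0 <= z -> 0 <= x -> 0 <= P w z x.
  by move=> *; rewrite /P; positivity.
move=> *; rewrite -subr_ge0.
have -> : (4 * k - 2) * (u + k - 1) * (u - 1) - (3 * (u + k) - 2 * N - 1) * (2 * (u * (u - 1)) + N * (N - 1)) = P (3 * (u + k) - 2 * N - 1) (u - 2 * k - 2) (N - 2 * u).
  by rewrite /P; ring.
by apply: P0; clear P; lra.
Qed.

Lemma poly_middle (k u N : rat) : u + k + 1 <= N -> N - u - k <= k -> 2 * k + 2 <= u ->
  ((N - u) * (N - u - 1) * (u + k - 1) - 2 * (N - u - k) * (u * (u - 1))) * (2 * (u * (u - 1)) + N * (N - 1)) <= (4 * k - 2) * u * (u - 1) ^+ 2 * (u + k - 1).
Proof.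
pose P x y z : rat := ((((128 * y + (208 * z + 416)) * x + ((404 * y + (776 * z + 1908)) * y + ((220 * z + 1524) * z + 2192))) * x + (((472 * y + (1036 * z + 2898)) * y + ((536 * z + 3896) * z + 6090)) * y + (((80 * z + 990) * z + 3774) * z + 4280))) * x + ((((241 * y + (586 * z + 1798)) * y + ((413 * z + 3163) * z + 5305)) * y + (((112 * z + 1481) * z + 5957) * z + 7164)) * y + ((((10 * z + 204) * z + 1390) * z + 3856) * z + 3660))) * x + (((((45 * y + (117 * z + 388)) * y + ((97 * z + 799) * z + 1439)) * y + (((33 * z + 500) * z + 2186) * z + 2816)) * y + ((((4 * z + 117) * z + 925) * z + 2798) * z + 2836)) * y + ((((8 * z + 114) * z + 602) * z + 1384) * z + 1152)).
have P0 x y z : 0 <= x -> 0 <= y -> 0 <= z -> 0 <= P x y z.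
  by move=> *; rewrite /P; positivity.
move=> *; rewrite -subr_ge0.
have -> : (4 * k - 2) * u * (u - 1) ^+ 2 * (u + k - 1) - ((N - u) * (N - u - 1) * (u + k - 1) - 2 * (N - u - k) * (u * (u - 1))) * (2 * (u * (u - 1)) + N * (N - 1)) = P (N - u - k - 1) (k - (N - u - k)) (u - 2 * k - 2).
  by rewrite /P; ring.
by apply: P0; clear P; lra.
Qed.

Lemma poly_middle_far (k u N : rat) : 1 <= k -> k + 1 <= N - u - k -> N <= 2 * u ->
  ((N - u) * (N - u - 1) * (u + k - 1) - 2 * (N - u - k) * (u * (u - 1))) * (2 * (u * (u - 1)) + N * (N - 1)) <= (4 * k - 2) * u * (u - 1) ^+ 2 * (u + k - 1).
Proof.
pose P x y z : rat := ((((80 * y + (208 * z + 80)) * x + ((168 * y + (496 * z + 624)) * y + ((220 * z + 1140) * z + 480))) * x + (((132 * y + (444 * z + 844)) * y + ((364 * z + 2088) * z + 1696)) * y + (((80 * z + 874) * z + 2418) * z + 1036))) * x + ((((46 * y + (176 * z + 416)) * y + ((205 * z + 1261) * z + 1368)) * y + (((88 * z + 993) * z + 2977) * z + 1922)) * y + ((((10 * z + 212) * z + 1194) * z + 2316) * z + 960))) * x + (((((6 * y + (26 * z + 70)) * y + ((39 * z + 251) * z + 320)) * y + (((25 * z + 285) * z + 900) * z + 714)) * y + ((((6 * z + 121) * z + 690) * z + 1421) * z + 774)) * y + ((((14 * z + 146) * z + 554) * z + 834) * z + 324)).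
have P0 x y z : 0 <= x -> 0 <= y -> 0 <= z -> 0 <= P x y z.
  by move=> *; rewrite /P; positivity.
move=> *; rewrite -subr_ge0.
have -> : (4 * k - 2) * u * (u - 1) ^+ 2 * (u + k - 1) - ((N - u) * (N - u - 1) * (u + k - 1) - 2 * (N - u - k) * (u * (u - 1))) * (2 * (u * (u - 1)) + N * (N - 1)) = P (k - 1) (N - u - k - k - 1) (2 * u - N).
  by rewrite /P; ring.
by apply: P0; clear P; lra.
Qed.

Lemma poly_late (k u N : rat) : u + 1 <= N -> N <= u + k -> 2 * k + 2 <= u ->
  (N - u) * (N - u - 1) * (2 * (u * (u - 1)) + N * (N - 1)) <= (4 * k - 2) * u * (u - 1) ^+ 2.
Proof.
pose P x y z : rat := (((15 * x + (100 * y + (34 * z + 104))) * x + ((180 * y + (132 * z + 454)) * y + ((21 * z + 147) * z + 245))) * x + (((128 * y + (144 * z + 516)) * y + ((48 * z + 356) * z + 642)) * y + (((4 * z + 49) * z + 189) * z + 232))) * x + ((((32 * y + (48 * z + 176)) * y + ((24 * z + 184) * z + 344)) * y + (((4 * z + 52) * z + 212) * z + 276)) * y + (((2 * z + 20) * z + 66) * z + 72)).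
have P0 x y z : 0 <= x -> 0 <= y -> 0 <= z -> 0 <= P x y z.
  by move=> *; rewrite /P; positivity.
move=> *; rewrite -subr_ge0.
have -> : (4 * k - 2) * u * (u - 1) ^+ 2 - (N - u) * (N - u - 1) * (2 * (u * (u - 1)) + N * (N - 1)) = P (N - u - 1) (k - (N - u)) (u - 2 * k - 2).
  by rewrite /P; ring.
by apply: P0; clear P; lra.
Qed.

(** To be used with [x = t' u - best_ratio u] and [y] the option with deadline u + k. The factor 2 +
    U is 3 + (U - 1): three unmatched terms, and the total weight of the matched ones. The right
    side is the budget of the later gaps. *)
Lemma window_bound (N k u : nat) (x y : rat) : (0 < k)%N -> (k.*2.+2 <= u <= N)%N ->
  x <= 0 -> x <= pair_ratio N u - 1 - best_ratio N u -> y <= 1 ->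
  ((u + k < N)%N -> y <= 0 \/ y <= 2 - best_ratio N (u + k)) ->
  pospart (x + y) * (2 + pair_ratio N u) <= (4 * k%:R - 2) / u%:R.
Proof.
move=> hk /andP[hu huN] x0 hx y1 hy.
have Rk := natR_le hk; have Ru := natR_le hu; have RN := natR_le huN.
rewrite -!(@natr1 _ _.+1) -!(@natr1 _ k.*2) -muln2 natrM in Ru.
have Rq : (u + k)%:R = u%:R + k%:R :> rat by rewrite natrD.
have V1 : 1 <= pair_ratio N u by apply: pair_ratio_ge1; nlia.
have E0 : 0 <= (4 * k%:R - 2) / u%:R :> rat by apply: divr_ge0; lra.
case: (pospartE (x + y)) => -[xy ->]; first by rewrite mul0r.
have EU : pair_ratio N u = best_ratio N u + (N%:R - u%:R) * (N%:R - u%:R - 1) / (u%:R * (u%:R - 1)).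
  by rewrite /pair_ratio /best_ratio /pair_count; field; apply/andP; split; lra.
suff [c [h1 h2]] : exists c : rat, x + y <= c /\ c * (2 + pair_ratio N u) <= (4 * k%:R - 2) / u%:R.
  apply: le_trans h2; rewrite ler_wpM2r //; lra.
have hN : (2 < N)%N by nlia.
have Gu := natR_gap_ge0 hN huN; move: hx; rewrite EU => hx.
(* If the window reaches the end, [y <= 1] and the bound on [x] give the estimate; for 2u <= N the
   sign of [x] and the bound on [y] do; in between both bounds are added. *)
case: (ltnP (u + k) N) => hq; last first.
  exists ((N%:R - u%:R) * (N%:R - u%:R - 1) / (u%:R * (u%:R - 1))); split; first by lra.
  case: (eqVneq u N) => [<-|hneq]; first by rewrite subrr !mul0r.
  have H1 : (u.+1 <= N)%N by nlia.
  have := natR_le H1; have := natR_le hq; rewrite Rq -(@natr1 _ u) => H2 H3.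
  have H := poly_late (k := k%:R) (u := u%:R) (N := N%:R) ltac:(lra) ltac:(lra) ltac:(lra).
  rewrite -?EU /pair_ratio /pair_count; move: H; move: (u%:R) (k%:R) (N%:R) Ru Rk RN => a b n Ra Rb Rn H.
  rewrite -subr_ge0 (_ : _ - _ = ((4 * b - 2) * a * (a - 1) ^+ 2 - (n - a) * (n - a - 1) * (2 * (a * (a - 1)) + n * (n - 1))) / (a * (a - 1)) ^+ 2).
    by rewrite divr_ge0 ?exprn_even_ge0 // subr_ge0.
  by field; apply/andP; split; lra.
have Rq1 := natR_le hq; rewrite -natr1 Rq in Rq1.
have [y0|y2] := hy hq.
  by exists 0; split; [lra | rewrite mul0r].
rewrite /best_ratio Rq in y2.
case: (leqP u.*2 N) => huu.
  have Ru2 := natR_le huu; rewrite -muln2 natrM in Ru2.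
  exists ((3 * (u%:R + k%:R) - 2 * N%:R - 1) / (u%:R + k%:R - 1)); split.
    rewrite [leRHS](_ : _ = 2 - (2 * N%:R - (u%:R + k%:R) - 1) / (u%:R + k%:R - 1)); first by lra.
    by field; lra.
  case: (leP 0 (3 * (u%:R + k%:R) - 2 * N%:R - 1 : rat)) => hs; last first.
    apply: le_trans E0; rewrite pmulr_lle0; last by lra.
    by rewrite pmulr_lle0 ?invr_gt0; lra.
  have H := poly_early (k := k%:R) (u := u%:R) (N := N%:R) ltac:(lra) ltac:(lra) ltac:(lra).
  rewrite -?EU /pair_ratio /pair_count; move: H; move: (u%:R) (k%:R) (N%:R) Ru Rk RN => a b n Ra Rb Rn H.
  rewrite -subr_ge0 (_ : _ - _ = ((4 * b - 2) * (a + b - 1) * (a - 1) - (3 * (a + b) - 2 * n - 1) * (2 * (a * (a - 1)) + n * (n - 1))) / (a * (a - 1) * (a + b - 1))).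
    by rewrite divr_ge0 ?subr_ge0 // !mulr_ge0; lra.
  by field; apply/and3P; split; lra.
exists ((N%:R - u%:R) * (N%:R - u%:R - 1) / (u%:R * (u%:R - 1)) - 2 * (N%:R - u%:R - k%:R) / (u%:R + k%:R - 1)); split.
  have E : (2 * N%:R - (u%:R + k%:R) - 1) / (u%:R + k%:R - 1) = 1 + 2 * (N%:R - u%:R - k%:R) / (u%:R + k%:R - 1) :> rat.
    by field; lra.
  rewrite E in y2; move: (_ / _) (_ / _) hx y2 => ? ? hx y2; lra.
have H : ((N%:R - u%:R) * (N%:R - u%:R - 1) * (u%:R + k%:R - 1) - 2 * (N%:R - u%:R - k%:R) * (u%:R * (u%:R - 1))) *
   (2 * (u%:R * (u%:R - 1)) + N%:R * (N%:R - 1)) <= (4 * k%:R - 2) * u%:R * (u%:R - 1) ^+ 2 * (u%:R + k%:R - 1) :> rat.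
  have Ru2 := natR_le huu; rewrite -natr1 -muln2 natrM in Ru2.
  (* No single choice of slack variables is used for this range, so it is split at N = u + 2k. *)
  case: (leqP N (u + k + k)%N) => hh.
    have := natR_le hh; rewrite !natrD => hh'; apply: poly_middle; lra.
  have := natR_le hh; rewrite -natr1 !natrD => hh'; apply: poly_middle_far; lra.
rewrite -?EU /pair_ratio /pair_count; move: H; move: (u%:R) (k%:R) (N%:R) Ru Rk RN => a b n Ra Rb Rn H.
rewrite -subr_ge0 (_ : _ - _ = ((4 * b - 2) * a * (a - 1) ^+ 2 * (a + b - 1) - ((n - a) * (n - a - 1) * (a + b - 1) - 2 * (n - a - b) * (a * (a - 1))) *
   (2 * (a * (a - 1)) + n * (n - 1))) / ((a * (a - 1)) ^+ 2 * (a + b - 1))).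
  by rewrite divr_ge0 ?subr_ge0 // mulr_ge0 ?exprn_even_ge0 //; lra.
by field; apply/and3P; split; lra.
Qed.

Lemma sum_tail3 (F : nat -> rat) (c : rat) (a b : nat) :
  0 <= c -> (forall j, (a <= j < b + 3)%N -> F j <= c) ->
  \sum_(a <= j < b + 3) F j <= \sum_(a <= j < b) F j + 3 * c.
Proof.
move=> c0 hF; case: (leqP a b) => hab.
  rewrite !addnS addn0 !big_nat_recr /=; try by nlia.
  have := hF b ltac:(nlia); have := hF b.+1 ltac:(nlia); have := hF b.+2 ltac:(nlia).
  by move: (\sum_(_ <= _ < _) _) => x; lra.
rewrite [X in _ <= X + _]big_geq ?(ltnW hab) // add0r.
case: (leqP a (b + 3)) => h; last by rewrite big_geq ?(ltnW h) // mulr_ge0.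
apply: le_trans (sum_le (G := fun=> c) hF) _; rewrite sum_const // ler_wpM2r //.
have := natR_le hab; rewrite natrD -natr1; lra.
Qed.

Lemma sum_head2 (F : nat -> rat) (a b : nat) :
  (forall j, 0 <= F j) -> \sum_(a.+2 <= j < b) F j <= \sum_(a <= j < b) F j.
Proof.
move=> hF; case: (leqP b a.+2) => h; first by rewrite [leLHS]big_geq //; apply: sumr_ge0.
rewrite (@big_ltn _ _ _ a) ?(@big_ltn _ _ _ a.+1); try by nlia.
by have := hF a; have := hF a.+1; move: (\sum_(_ <= _ < _) _) => x; lra.
Qed.

(* Only the terms within distance [B / w] of the end can be positive. *)
Lemma sum_le_count (H : nat -> rat) (d B w : rat) (b : nat) :
  0 <= d -> 0 <= B -> 0 < w ->
  forall n a, (a + n = b)%N ->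
  (forall j, (a <= j < b)%N -> H j <= d /\ (H j <= 0 \/ (b%:R - j%:R) * w <= B)) ->
  \sum_(a <= j < b) H j <= d * (B / w).
Proof.
move=> d0 B0 w0; elim=> [|n IH] a hab hH.
  rewrite big_geq; first by rewrite mulr_ge0 // divr_ge0 // ltW.
  by rewrite -hab addn0.
have [h1 [h2|h2]] := hH a ltac:(nlia).
  rewrite big_ltn; last by nlia.
  have := IH a.+1 ltac:(nlia) (fun j hj => hH j ltac:(nlia)).
  by move: (\sum_(_ <= _ < _) _) (d * _) => x y; lra.
apply: le_trans (sum_le (G := fun=> d) (fun j hj => proj1 (hH j hj))) _.
by rewrite sum_const; [rewrite mulrC ler_wpM2l // ler_pdivlMr | nlia].
Qed.

(** * The gap between the two windows for a new best applicant *)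

Section Two.
Variables (N k : nat) (t g t' g' : nat -> rat).
Hypotheses (hN : (2 < N)%N) (hk : (0 < k)%N).
Hypotheses (Hs : system N k t g) (Hs' : system N k.+1 t' g').
Notation rbest := (best_ratio N).
Notation U := (pair_ratio N).

Lemma wider_t_end u : (2 <= u)%N -> (N <= u + k)%N -> t' u = t u.
Proof.
move=> h2 h; case: (Hs) (Hs') => H0 Ht _ [H0' Ht' _].
case: (leqP N u) => hu; first by rewrite H0 // H0'.
have [[E1 E2 E3] _] := system_end hN hk Hs Hs' hu h2 h.
by rewrite Ht ?h2 // Ht' ?h2 // E1 E2 E3.
Qed.

Lemma best_ratio_slope a b : (2 <= a)%N -> (a <= b <= N)%N ->
  (b%:R - a%:R) * (2 / b%:R) <= rbest a - rbest b.
Proof.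
move=> h2 /andP[h3 h4]; have R2 := natR_le h2; have R3 := natR_le h3; have R4 := natR_le h4.
rewrite (_ : rbest a - rbest b = (b%:R - a%:R) * ((2 * N%:R - 2) / ((a%:R - 1) * (b%:R - 1)))).
  apply: ler_wpM2l; first by lra.
  rewrite ler_pdivlMr; last by rewrite mulr_gt0; lra.
  by rewrite mulrAC ler_pdivrMr; [nra | lra].
by rewrite /best_ratio; field; apply/andP; split; lra.
Qed.

(* Term [j] on the left is matched with term [j + 1] on the right, where [t'] and
   [t] are taken at the same argument; at most three terms remain, and the number of
   positive matched terms is bounded by the slope of [best_ratio]. *)
Lemma exposed_sum_le p : let u := (p + k).+2 in
  (k <= p)%N -> (2 <= p)%N -> (u <= N)%N -> t' u <= rbest u ->
  \sum_(p.+2 <= j < u) pospart (t' u + pospart (1 - t' (j + k.+1)%N) - rbest u)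
  <= \sum_(p.+1 <= j < p + k)
       pospart (t (p + k)%N + pospart (1 - t (j + k)%N) - rbest (p + k)) +
     (4 * k%:R - 2) / u%:R.
Proof.
move=> u hkp hp huN hu.
pose F j := pospart (t' u + pospart (1 - t' (j + k)%N) - rbest u).
pose G j := pospart (t u + pospart (1 - t' (j + k)%N) - rbest u).
pose bd := pospart ((t' u - rbest u) + pospart (1 - t' (u + k)%N)).
have hk1 : (0 < k.+1)%N by [].
have bd0 : 0 <= bd by apply: pospart_ge0.
have F0 j : 0 <= F j by apply: pospart_ge0.
have Fbd j : (p.+3 <= j <= u)%N -> F j <= bd.
  move=> hj; apply: le_pospart; rewrite addrAC lerD2l; apply: le_pospart.
  by rewrite lerD2l lerN2; apply: (t_mono hN hk1 Hs'); nlia.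
have -> : \sum_(p.+2 <= j < u) pospart (t' u + pospart (1 - t' (j + k.+1)%N) - rbest u)
     = \sum_(p.+3 <= j < p + k + 3) F j.
  rewrite addn3 [RHS]big_add1 /=; apply: eq_bigr => j _.
  by rewrite /F addSnnS.
have S1 := sum_tail3 (F := F) (c := bd) (a := p.+3) (b := p + k) bd0
  (fun j hj => Fbd j ltac:(rewrite /u; nlia)).
have S2 : \sum_(p.+3 <= j < p + k) G j <= \sum_(p.+1 <= j < p + k)
       pospart (t (p + k)%N + pospart (1 - t (j + k)%N) - rbest (p + k)).
  apply: le_trans (sum_head2 _ _ _) => [|j]; last exact: pospart_ge0.
  apply: sum_le => j hj; apply: le_pospart.
  have h1 := t_diff_ge hN hk Hs (a := p + k) (b := u) ltac:(nlia) ltac:(rewrite /u; nlia).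
  have h2 : pospart (1 - t' (j + k)%N) <= pospart (1 - t (j + k)%N).
    apply: le_pospart; have := dt_ge0 hN hk Hs Hs' (n := j + k) ltac:(nlia); lra.
  lra.
have hw := window_bound (N := N) (k := k) (u := u) (x := t' u - rbest u)
  (y := pospart (1 - t' (u + k)%N)) hk ltac:(rewrite /u; nlia) ltac:(lra).
have {hw}hw : bd * (2 + U u) <= (4 * k%:R - 2) / u%:R.
  apply: hw.
  - by have := t_le hN hk1 Hs' (a := u) ltac:(rewrite /u; nlia); lra.
  - by apply: (pospart_le1 hN hk1 Hs'); rewrite /u; nlia.
  move=> hq; have := t_ge hN hk1 Hs' (a := u + k) ltac:(rewrite /u; nlia) => h1.
  case: (pospartE (1 - t' (u + k)%N)) => -[h2 ->]; [left; lra | right; lra].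
suff S3 : \sum_(p.+3 <= j < p + k) F j - \sum_(p.+3 <= j < p + k) G j <= bd * (U u - 1).
  move: S1 S2 S3 hw; move: (\sum_(_ <= _ < _) _) => a1.
  move: (\sum_(_ <= _ < _) _) (\sum_(_ <= _ < _) _) (\sum_(_ <= _ < _) _) (_ / _) => a2 a3 a4 a5.
  have E : bd * (2 + U u) = 3 * bd + bd * (U u - 1) by ring.
  by rewrite E; move: (bd * _) => w; lra.
have U1 : 1 <= U u by apply: pair_ratio_ge1 => //; rewrite /u; nlia.
rewrite -sumrB; case: (leqP N (u + k)) => hq.
  apply: le_trans (_ : _ <= \sum_(p.+3 <= j < p + k) 0) _.
    apply: sum_le => j hj; rewrite /F /G (wider_t_end (u := u)) ?subrr //; rewrite /u; nlia.
  by rewrite big1 // mulr_ge0 //; lra.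
have d0 : 0 <= t' u - t u by apply: (dt_ge0 hN hk Hs Hs'); rewrite /u; nlia.
have Rq : (0 : rat) < (u + k)%:R by rewrite ltr0n; rewrite /u; nlia.
case: (leqP (p + k) p.+3) => h3; first by rewrite big_geq // mulr_ge0 //; lra.
(* A positive [F j] forces [j] to lie within bd (u + k) / 2 of p + k, and each difference is at most
   [t' u - t u]; by [dt_le] the product stays below bd (U u - 1). *)
have := @sum_le_count (fun j => F j - G j) (t' u - t u) bd (2 / (u + k)%:R) (p + k) d0 bd0
  ltac:(by apply: divr_gt0) (p + k - p.+3) p.+3 ltac:(nlia).
move=> h4; apply: (le_trans (h4 _)) => {h4} [j hj|].
  split.
    rewrite /F /G.
    set y := pospart (1 - _).
    case: (pospartE (t' u + y - rbest u)) => -[h4 ->]; case: (pospartE (t u + y - rbest u)) => -[h5 ->]; lra.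
  case: (leP (F j) 0) => hF; [left | right].
    by have := pospart_ge0 (t u + pospart (1 - t' (j + k)%N) - rbest u); rewrite /G; lra.
  have := t_diff_ge hN hk1 Hs' (a := j + k) (b := u + k) ltac:(nlia) ltac:(rewrite /u; nlia).
  have := @best_ratio_slope (j + k) (u + k) ltac:(nlia) ltac:(rewrite /u; nlia).
  have h4 := pospart_ge (t' u - rbest u + pospart (1 - t' (u + k)%N)); rewrite -/bd in h4.
  have h5 := pospart_ge (1 - t' (u + k)%N).
  have h6 : ((p + k)%:R - j%:R) * (2 / (u + k)%:R) <= ((u + k)%:R - (j + k)%:R) * (2 / (u + k)%:R) :> rat.
    have h7 : 0 <= 2 / (u + k)%:R :> rat by apply: divr_ge0 => //; exact: ltW.
    apply: ler_wpM2r h7 _ _ _; rewrite !natrD /u -[(p + k).+2]addn2 !natrD; lra.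
  move: hF; rewrite /F; case: (pospartE (1 - t' (j + k)%N)) => -[h7 ->].
    by case: (pospartE (t' u + 0 - rbest u)) => -[h8 ->]; lra.
  case: (pospartE (t' u + (1 - t' (j + k)%N) - rbest u)) => -[h8 ->]; first by lra.
  by move: h6; move: (_ * _) (_ * _) => a1 a2; lra.

have h5 := dt_le hN hk Hs Hs' (n := u) ltac:(rewrite /u; nlia).
rewrite invfM invrK mulrCA; apply: ler_wpM2l => //.
have R1 : (0 : rat) < (u.+1 + k)%:R by rewrite ltr0n; rewrite /u; nlia.
have h6 : (t' u - t u) * (u.+1 + k)%:R <= 2 * (U u - 1).
  by rewrite -ler_pdivlMr // -mulrAC.
have h7 : (u.+1 + k)%:R = (u + k)%:R + 1 :> rat by rewrite addSn natr1.
rewrite h7 in h6; move: h6 d0; move: (t' u - t u) ((u + k)%:R) => d q h6 d0; lra.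
Qed.

Lemma maxr_pospart (a b : rat) : Num.max a b = a + pospart (b - a).
Proof. by case: (maxE a b) (pospartE (b - a)) => -[h1 ->] [] [h2 ->]; lra. Qed.

Lemma newcomer_gap_end p : (2 <= p)%N -> (p.+1 < N)%N -> (N <= p.+1 + k)%N ->
  2 / p%:R <= g p - g' p.+1.
Proof.
move=> h2 h1 hk1; have R2 := natR_le h2; have R1 := natR_le h1.
rewrite -!natr1 in R1.
have [[-> _ _] [-> _ _]] := system_end hN hk Hs Hs' (p := p.+1) ltac:(nlia) ltac:(nlia) ltac:(nlia).
have hg : U p.+1 <= g p.
  case: (leqP N (p + k)) => h3.
    by have [_ [-> _ _]] := system_end hN hk Hs Hs' (p := p) ltac:(nlia) ltac:(nlia) h3.
  (* The only position not covered by [system_end]. Its N - 2 maximum terms are each at least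
     best_ratio (N - 1) = N / (N - 2), so together they cancel the end N of the telescoped sum. *)
  have E : (p + k)%N = N.-1 by nlia.
  case: (Hs) => _ _ /(_ p ltac:(nlia)) /=; rewrite seenE; last by nlia.
  rewrite E => Eg.
  have Rn : (N.-1%:R : rat) = N%:R - 1 by rewrite -subn1 natrB //; nlia.
  have Er : rbest N.-1 = N%:R / (N%:R - 2).
    by rewrite /best_ratio Rn; field; lra.
  have S1 : \sum_(p.+1 <= j < N.-1) g j = pair_count N / p.+1%:R - pair_count N / (N%:R - 1).
    rewrite -Rn -sum_inv_pair //; last by nlia.
    apply: eq_big_nat => j hj.
    have [_ [-> _ _]] := system_end hN hk Hs Hs' (p := j) ltac:(nlia) ltac:(nlia) ltac:(nlia).
    by rewrite /pair_ratio -natr1 addrK.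
  have S2 : \sum_(p.+1 <= j < N.-1) rbest N.-1 <=
    \sum_(p.+1 <= j < N.-1) Num.max (rbest N.-1) (t N.-1 + pospart (1 - t (j + k)%N)).
    by apply: sum_le => j _; rewrite le_max lexx.
  have S3 : p%:R * rbest N.-1 <= p%:R * Num.max (rbest N.-1) (t N.-1).
    by apply: ler_wpM2l; [lra | rewrite le_max lexx].
  rewrite sum_const in S2; last by nlia.
  have S4 : p%:R * rbest N.-1 + (N.-1%:R - p.+1%:R) * rbest N.-1 = N%:R.
    by rewrite Er Rn -natr1; field; lra.
  have S5 : pair_count N / (N%:R - 1) = N%:R by rewrite /pair_count; field; lra.
  rewrite S1 S5 in Eg; have S6 : pair_count N / p.+1%:R <= p%:R * g p.
    move: Eg S2 S3 S4; move: (p%:R * g p) (p%:R * Num.max _ _) (p%:R * rbest _) ((_ - _) * rbest _).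
    move: (pair_count N / _) (\sum_(_ <= _ < _) _) N%:R => a1 a2 a3 a4 a5 a6 a7; lra.
  rewrite /pair_ratio -(@natr1 _ p) addrK invfM mulrA natr1 mulrC.
  rewrite ler_pdivrMl; last by lra.
  by exact: S6.
have hp1 : (1 < p.+1)%N by nlia.
have := pair_ratioS N hp1; suff : 2 / p%:R <= 2 * pair_count N / (p.+2%:R * p.+1%:R * (p.+1%:R - 1)).
  by move: (_ / _) (_ / _) => x y; lra.
have -> : p.+2%:R = p%:R + 2 :> rat by rewrite -addn2 natrD.
rewrite -(@natr1 _ p) addrK invfM mulrA ler_pM2r ?invr_gt0; last by lra.
rewrite ler_pdivlMr; last by rewrite mulr_gt0; lra.
by rewrite ler_pM2l // /pair_count; nra.
Qed.

(* The recursions for [g p] and [g' p.+1] have windows ending at [p + k] and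
   [p + k + 2]; subtracting them expresses the gap through the later gaps, so the
   lower bound propagates backwards as long as best candidates are chosen. *)
Lemma newcomer_gap n : (2 <= n)%N -> (k <= n)%N ->
  (forall m, (n <= m <= N)%N -> t m <= rbest m) ->
  (forall m, (n.+2 <= m <= N)%N -> t' m <= rbest m) ->
  forall p, (p <= N)%N -> (n <= p)%N -> (p.+1 < N)%N -> 2 / p%:R <= g p - g' p.+1.
Proof.
move=> hn2 hkn H1 H2; apply: (@backward_ind N) => p _ IH hp hpN.
case: (leqP N (p.+1 + k)) => hpk; first by apply: newcomer_gap_end => //; nlia.
have Rp : (2 : rat) <= p%:R by apply: (natR_le (a := 2)); nlia.
have R1 : (1 : rat) <= k%:R by apply: (natR_le (a := 1)).
pose u := (p + k).+2.
have Ru : u%:R = p%:R + k%:R + 2 :> rat by rewrite /u -[(p + k).+2]addn2 !natrD.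
have X := exposed_sum_le (p := p) ltac:(nlia) ltac:(nlia) ltac:(nlia) (H2 (p + k).+2 ltac:(nlia)).
rewrite /= -/u in X.
case: (Hs) => _ _ /(_ p ltac:(nlia)) /=; rewrite seenE; last by nlia.
case: (Hs') => _ _ /(_ p.+1 ltac:(nlia)) /=; rewrite seenE; last by nlia.
rewrite addSn addnS -/u => Eg' Eg.
rewrite (max_l (H1 _ _)) in Eg; last by nlia.
rewrite (max_l (H2 _ _)) in Eg'; last by rewrite /u; nlia.
have S1 : \sum_(p.+1 <= j < p + k) Num.max (rbest (p + k)) (t (p + k)%N + pospart (1 - t (j + k)%N))
  = (k%:R - 1) * rbest (p + k) + \sum_(p.+1 <= j < p + k)
       pospart (t (p + k)%N + pospart (1 - t (j + k)%N) - rbest (p + k)).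
  under eq_bigr => j _ do rewrite maxr_pospart.
  rewrite big_split /= sum_const; last by nlia.
  by congr (_ * _ + _); rewrite natrD -natr1; lra.
have S2 : \sum_(p.+2 <= j < u) Num.max (rbest u) (t' u + pospart (1 - t' (j + k.+1)%N))
  = k%:R * rbest u + \sum_(p.+2 <= j < u)
       pospart (t' u + pospart (1 - t' (j + k.+1)%N) - rbest u).
  under eq_bigr => j _ do rewrite maxr_pospart.
  rewrite big_split /= sum_const; last by rewrite /u; nlia.
  by congr (_ * _ + _); rewrite Ru -addn2 natrD; lra.
rewrite S1 in Eg; rewrite S2 in Eg'.
(* The two chosen totals, 2N - u - 1 and 2N - u + 1, differ by 2: the numerator of the claimed
   gap. *)
have Er : (u%:R - 1) * rbest u = 2 * N%:R - u%:R - 1.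
  by rewrite /best_ratio mulrC divfK //; lra.
have Er' : (u%:R - 3) * rbest (p + k) = 2 * N%:R - u%:R + 1.
  by rewrite /best_ratio natrD Ru; field; lra.
rewrite Ru in Er Er'.
pose del j := g j - g' j.+1.
have S3 : \sum_(p.+2 <= j < u) g' j = \sum_(p.+1 <= j < p + k) g' j.+1 + g' (p + k).+1.
  by rewrite big_add1 /= big_nat_recr //=; nlia.
(* By [g <= g'], each step of the telescoped difference of [g] dominates a gap. The later gaps
   therefore occur twice, here and in the difference of the two sums. *)
have S4 : g p - g (p + k)%N >= del p + \sum_(p.+1 <= j < p + k) del j.
  rewrite -big_ltn; last by nlia.
  have hpk' : (p <= p + k)%N by nlia.
  rewrite -[leRHS]opprB -(telescope_sumr g hpk').
  rewrite -sumrN; apply: sum_le => j hj; rewrite /del opprB lerD2l lerN2.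
  by have [h _] := system_incr hN hk Hs Hs' (p := j.+1) ltac:(nlia) ltac:(nlia); lra.
have S5 : \sum_(p.+1 <= j < p + k) del j = \sum_(p.+1 <= j < p + k) g j - \sum_(p.+1 <= j < p + k) g' j.+1.
  by rewrite sumrB.
have D2 : forall j, (p < j <= p + k)%N -> 2 / u%:R <= del j.
  move=> j hj; have := IH j ltac:(nlia) ltac:(nlia) ltac:(nlia).
  apply: le_trans; rewrite ler_pM2l // lef_pV2 ?posrE ?ltr0n; try by rewrite /u; nlia.
  by rewrite ler_nat /u; nlia.
have S6 : (k%:R - 1) * (2 / u%:R) <= \sum_(p.+1 <= j < p + k) del j.
  have := sum_le (a := p.+1) (b := p + k) (F := fun=> 2 / u%:R) (G := del) (fun j hj => D2 j ltac:(nlia)).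
  rewrite sum_const; last by nlia.
  by rewrite natrD -natr1 (_ : _ - _ = k%:R - 1 :> rat) //; lra.
have S7 := D2 (p + k)%N ltac:(nlia).
(* Twice the k - 1 intermediate gaps plus the last one, each at least 2 / u, pay exactly the loss
   allowed by [exposed_sum_le]. *)
have S8 : (4 * k%:R - 2) / u%:R = 2 * ((k%:R - 1) * (2 / u%:R)) + 2 / u%:R :> rat.
  by rewrite Ru; field; lra.
rewrite S8 in X; rewrite S3 -natr1 in Eg'.
have E7 : g' (p + k).+1 = g (p + k)%N - del (p + k)%N by rewrite /del; lra.
have E8 : g' p.+1 = g p - del p by rewrite /del; lra.
rewrite E7 E8 in Eg'; rewrite -[g p - _]/(del p) ler_pdivrMr; last by lra.
move: X Eg Eg' Er Er' S4 S5 S6 S7.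
move: (\sum_(_ <= _ < _) _) (\sum_(_ <= _ < _) g' _) (\sum_(_ <= _ < _) g _) (\sum_(_ <= _ < _) del _) => a1 a2 a3 a4.
move: (\sum_(_ <= _ < _) _) => a5.
move: (del p) (del _) (g p) (g _) (rbest u) (rbest _) (2 / _) p%:R k%:R N%:R Rp => d1 d2 g1 g2 r1 r2 w q kk nn Rp.
lra.
Qed.

(** Pairing [g p] with [g' p.+1] leaves one early term [g P.-1] unmatched. It must reach 2 together
    with the gaps: 1 for the larger constant [k] of the wider window and 1 for the claim. *)
Lemma best_cont_next n : (2 <= n)%N -> (k <= n)%N -> (n + k < N)%N -> (n.*2 < N + k)%N ->
  (forall m, (n <= m <= N)%N -> t m <= rbest m) ->
  (forall m, (n.+2 <= m <= N)%N -> t' m <= rbest m) ->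
  best_cont k.+1 t' n.+1 + 1 <= best_cont k t n.
Proof.
move=> h2 hkn h3 h4 H1 H2; have hk1 : (0 < k.+1)%N by [].
have J := newcomer_gap h2 hkn H1 H2.
rewrite (best_cont_sum hN hk1 Hs'); last by nlia.
rewrite (best_cont_sum hN hk Hs); last by nlia.
rewrite big_split [in leRHS]big_split /= [\sum_(n <= i < N) pospart _]big_ltn; last by nlia.
pose P := (N - k)%N.
have hP : (n < P < N)%N by rewrite /P; nlia.
have S1 : \sum_(n.+1 <= p < N) pospart (1 - t' p.+1) <= \sum_(n.+1 <= p < N) pospart (1 - t p.+1).
  apply: sum_le => p hp; apply: le_pospart.
  by have := dt_ge0 hN hk Hs Hs' (n := p.+1) ltac:(nlia); lra.
have S2 : \sum_(P <= p < N) g' p = \sum_(P <= p < N) g p.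
  apply: eq_big_nat => p hp.
  by have [[-> _ _] _] := system_end hN hk Hs Hs' (p := p) ltac:(nlia) ltac:(nlia) ltac:(rewrite /P in hp; nlia).
have S3 : \sum_(n.+1 <= p < N) g' p = \sum_(n <= p < P.-1) g' p.+1 + \sum_(P <= p < N) g' p.
  by rewrite (big_cat_nat (n := P)) /=; [rewrite big_add1 | nlia | nlia].
have S4 : \sum_(n <= p < N) g p = \sum_(n <= p < P.-1) g p + g P.-1 + \sum_(P <= p < N) g p.
  rewrite (big_cat_nat (n := P)) /=; [congr (_ + _) | nlia | nlia].
  by rewrite -[in LHS](prednK (n := P)) ?big_nat_recr //=; nlia.
have S5 : \sum_(n <= p < P.-1) (2 / P.-1%:R) <= \sum_(n <= p < P.-1) g p - \sum_(n <= p < P.-1) g' p.+1.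
  rewrite -sumrB; apply: sum_le => p hp; have := J p ltac:(nlia) ltac:(nlia) ltac:(nlia).
  apply: le_trans; rewrite ler_pM2l // lef_pV2 ?posrE ?ltr0n; try by nlia.
  by rewrite ler_nat; nlia.
have h5 := g_ge hN hk Hs (p := P.-1) ltac:(nlia).
rewrite prednK in h5; last by nlia.
rewrite sum_const in S5; last by nlia.
have h6 := pospart_ge0 (1 - t n.+1).
have RP : P%:R = N%:R - k%:R :> rat by rewrite /P natrB //; nlia.
have RP1 : P.-1%:R = N%:R - k%:R - 1 :> rat by rewrite -RP -subn1 natrB //; nlia.
have Rn := natR_le h3; rewrite -natr1 natrD in Rn.
have R2 := natR_le h2; have R4 := natR_le h4; rewrite -natr1 -muln2 natrM natrD in R4.
(* After clearing the denominator this is 2n <= N + k - 1, the complement of the range of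
   [best_next_late]. *)
have h7 : 2 <= (P.-1%:R - n%:R) * (2 / P.-1%:R) + rbest P.
  rewrite RP1 /best_ratio RP.
  rewrite [leRHS](_ : _ = (2 * (N%:R - k%:R - 1 - n%:R) + (2 * N%:R - (N%:R - k%:R) - 1)) / (N%:R - k%:R - 1)).
    by rewrite ler_pdivlMr; lra.
  by field; lra.
have h8 : 2 <= \sum_(n <= p < P.-1) g p - \sum_(n <= p < P.-1) g' p.+1 + g P.-1 by lra.
rewrite S3 S4 S2 -(@natr1 _ k); move: S1 h6 h8.
move: (\sum_(_ <= _ < _) _) (\sum_(_ <= _ < _) pospart _) (\sum_(_ <= _ < _) g _) => a1 a2 a3.
move: (\sum_(_ <= _ < _) _) (\sum_(_ <= _ < _) _) (pospart _) (g _) => a4 a5 a6 a7; lra.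
Qed.

(** The induction runs downwards because [newcomer_gap] needs [t' m <= best_ratio m] at later [m],
    and that is the conclusion at [m.-1] weakened by [best_cont_ratio]. *)
Lemma best_next n : (n <= N)%N -> (2 <= n)%N -> (k <= n)%N -> (n < N)%N ->
  best_cont k t n < 2 * N%:R - n%:R - 1 -> best_cont k.+1 t' n.+1 < 2 * N%:R - n.+1%:R - 1.
Proof.
move: n; apply: (@backward_ind N) => n _ IH h2 hk2 hn hA; have hk1 : (0 < k.+1)%N by [].
have hA' := fun m hm => best_cont_mono hN hk Hs (a := n) (b := m) h2 hm hA.
case: (leqP N (n + k)) => h3; first by apply: (best_next_end hN hk Hs Hs') => //; rewrite h2.
case: (leqP (N + k) n.*2) => h4; first exact: (best_next_late hN hk Hs').
have H1 : forall m, (n <= m <= N)%N -> t m <= rbest m.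
  move=> m hm; case: (ltnP m N) => hmN.
    apply: ltW; apply: (best_cont_ratio (k := k)); first by nlia.
    by apply: hA'; nlia.
  have -> : m = N by nlia.
  by case: (Hs) => -> // _ _; rewrite best_ratioN.
have H2 : forall m, (n.+2 <= m <= N)%N -> t' m <= rbest m.
  case=> // m hm; apply: ltW; apply: (best_cont_ratio (k := k.+1)); first by nlia.
  by apply: IH; [nlia | nlia | nlia | nlia | apply: hA'; nlia].
have := best_cont_next h2 hk2 h3 h4 H1 H2; rewrite -(@natr1 _ n); lra.
Qed.
End Two.

(** * Existence of the programme and the state values it encodes *)

Lemma system_exists (N k : nat) : (0 < k)%N -> exists t g, system N k t g.
Proof.
move=> hk.
(* Apart from [g p] in the equation for [t p], the equations at [p] involve only later indices, so a
   solution is extended downwards by overwriting one index at a time. *)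
have : forall d, exists t g : nat -> rat,
  [/\ forall n, (N <= n)%N -> t n = 0,
      forall p, (2 <= p < N)%N -> (N - d <= p)%N ->
        t p = t p.+1 + (g p + newcomer_second k t p) / (p%:R - 1)
    & forall p, (2 <= p < N)%N -> (N - d <= p)%N -> let e := seen N k p in
        p%:R * g p = \sum_(p.+1 <= j < e) g j + p%:R * Num.max (best_ratio N e) (t e)
          + \sum_(p.+1 <= j < e)
              Num.max (best_ratio N e) (t e + pospart (1 - t (j + k)%N))]; last first.
  move=> /(_ N) [t [g [H0 Ht Hg]]]; exists t, g; split=> // p hp.
    by apply: Ht => //; rewrite subnn.
  by apply: Hg => //; rewrite subnn.
elim=> [|d [t [g [H0 Ht Hg]]]].
  by exists (fun=> 0), (fun=> 0); split=> // p hp; nlia.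
case: (leqP d.+1 (N - 2)) => hd; last first.
  by exists t, g; split=> // p hp hp'; [apply: Ht | apply: Hg] => //; nlia.
pose q := (N - d.+1)%N; have hq : (2 <= q < N)%N by rewrite /q; nlia.
pose e := seen N k q.
have he : (q < e)%N by rewrite /e /seen; nlia.
pose gq := (\sum_(q.+1 <= j < e) g j + q%:R * Num.max (best_ratio N e) (t e)
          + \sum_(q.+1 <= j < e)
              Num.max (best_ratio N e) (t e + pospart (1 - t (j + k)%N))) / q%:R.
pose tq := t q.+1 + (gq + newcomer_second k t q) / (q%:R - 1).
pose g1 n := if n == q then gq else g n.
pose t1 n := if n == q then tq else t n.
have g1E n : (q < n)%N -> g1 n = g n by rewrite /g1; case: eqP => // ->; rewrite ltnn.
have t1E n : (q < n)%N -> t1 n = t n by rewrite /t1; case: eqP => // ->; rewrite ltnn.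
have sE p : (q <= p)%N -> newcomer_second k t1 p = newcomer_second k t p.
  by move=> hp; rewrite /newcomer_second !t1E //; nlia.
have SE p (c d' : rat) : (q <= p)%N -> \sum_(p.+1 <= j < seen N k p) Num.max c (d' + pospart (1 - t1 (j + k)%N)) =
   \sum_(p.+1 <= j < seen N k p) Num.max c (d' + pospart (1 - t (j + k)%N)).
  by move=> hp; apply: eq_big_nat => j hj; rewrite t1E //; nlia.
have GE p : (q <= p)%N -> \sum_(p.+1 <= j < seen N k p) g1 j = \sum_(p.+1 <= j < seen N k p) g j.
  by move=> hp; apply: eq_big_nat => j hj; rewrite g1E //; nlia.
exists t1, g1; split=> [n hn|p hp hpd|p hp hpd].
- by rewrite t1E ?H0 //; nlia.
- have hqp : (q <= p)%N by rewrite /q; nlia.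
  rewrite sE // (t1E p.+1); last by nlia.
  case: (eqVneq p q) => [->|hpq]; first by rewrite /t1 /g1 eqxx.
  have hqp' : (q < p)%N by rewrite ltn_neqAle eq_sym hpq.
  by rewrite t1E // g1E // Ht //; nlia.
have hqp : (q <= p)%N by rewrite /q; nlia.
rewrite /= (t1E (seen N k p)); last by rewrite /seen; nlia.
rewrite GE // SE //.
case: (eqVneq p q) => [->|hpq].
  rewrite /g1 eqxx /gq mulrCA mulfV ?mulr1 // pnatr_eq0; nlia.
have hqp' : (q < p)%N by rewrite ltn_neqAle eq_sym hpq.
by rewrite g1E // Hg //; nlia.
Qed.

(** Probability that the applicant of rank [r] among the first [n] is one of the overall best two:
    rank 1 may be overtaken once, rank 2 never. *)
Definition rank_value (N n r : nat) : rat :=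
  match r with
  | 1 => n%:R * (2 * N%:R - n%:R - 1) / pair_count N
  | 2 => n%:R * (n%:R - 1) / pair_count N
  | _ => 0
  end.

(* Normalised value of rejecting the best applicant, at position [b], when [e]
   applicants have been seen and the second best one is at position [p]. *)
Definition second_gain (k : nat) (t : nat -> rat) (e b p : nat) : rat :=
  t e + (if (b < p)%N then pospart (1 - t (p + k)%N) else 0).

(* Winning probability when [n] applicants have been seen, those before [i] are
   lost, the best is at position [b] and the second best at position [d]. *)
Definition state_value (N k : nat) (t g : nat -> rat) (n i b d : nat) : rat :=
  let e := seen N k b in
  if (i <= b)%N then
    n%:R / pair_count N * (\sum_(n <= j < e) g j
       + (n%:R - 1) * Num.max (best_ratio N e) (second_gain k t e b d)
       + \sum_(n <= p < e) Num.max (best_ratio N e) (second_gain k t e b p))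
  else n%:R * (n%:R - 1) / pair_count N *
    (t n + if (i <= d)%N then pospart (1 - t (d + k)%N) else 0).

Ltac rlra := repeat match goal with H : @eq nat _ _ |- _ => clear H end; lra.

Section Value.
Variables (N k : nat) (t g : nat -> rat).
Hypotheses (hN : (2 < N)%N) (hk : (0 < k)%N) (Hs : system N k t g).
Notation V := (state_value N k t g).
Notation rbest := (best_ratio N).

Lemma system_newcomer n : (2 <= n < N)%N -> let e := seen N k n in
  n%:R * g n = \sum_(n.+1 <= j < e) g j + n%:R * Num.max (rbest e) (t e) +
    \sum_(n.+1 <= p < e) Num.max (rbest e) (second_gain k t e n p).
Proof.
move=> hn /=; case: (Hs) => _ _ /(_ n hn) /= ->; congr (_ + _).
by apply: eq_big_nat => p hp; rewrite /second_gain; case: ifP => //; lia.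
Qed.

Lemma state_value_newcomer n i b : (2 <= n < N)%N -> (i <= n)%N -> (b < n)%N ->
  V n.+1 i n b = (n%:R + 1) / pair_count N * (n%:R * g n).
Proof.
move=> hn hi hb; rewrite system_newcomer // /state_value hi -natr1 addrK.
rewrite /second_gain (_ : (n < b)%N = false) ?addr0 //; lia.
Qed.

(** The next applicant is best, second best or neither with weights 1 : 1 : n - 1; [system] is this
    law in normalised form. *)
Lemma state_value_rec n i b d : (2 <= n)%N -> (n < N)%N -> n = (i + k)%N ->
  (b < n)%N -> (d < n)%N ->
  (n%:R + 1) * V n i.+1 b d =
    V n.+1 i.+1 n b + V n.+1 i.+1 b n + (n%:R - 1) * V n.+1 i.+1 b d.
Proof.
move=> h2 hn hi hb hd.
have M0 : pair_count N != 0 by rewrite gt_eqF // pair_count_gt0.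
have R := natR_le h2.
rewrite state_value_newcomer ?h2 //; last by lia.
rewrite /state_value -natr1 addrK; case: ifP => hib.
  have he : (n < seen N k b)%N by rewrite /seen; lia.
  set e := seen N k b in he *.
  rewrite (big_ltn he) (big_ltn he) /=.
  set a1 := \sum_(n.+1 <= i < e) _; set a2 := \sum_(n.+1 <= i < e) _.
  set m1 := Num.max _ _; set m2 := Num.max _ _.
  by field.
rewrite (_ : (i < n)%N) ?(_ : (n + k)%N = (n + k)%N) //; last by lia.
case: (Hs) => _ /(_ n) Ht _.
have := Ht ltac:(lia); rewrite /newcomer_second => ->.
move: (g n) (t n.+1) (pospart _) (if _ then _ else _) => a b' c d'.
by clear hi; field; rewrite M0 /=; rlra.
Qed.

Lemma sum_ones a b : (a <= b)%N -> \sum_(a <= j < b) (1 : rat) = b%:R - a%:R.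
Proof. by move=> h; rewrite sum_const // mulr1. Qed.

(** An admissible policy may choose the best applicant anywhere in the window. Waiting until that
    applicant is at the first index loses nothing. *)
Lemma rank_value1_le n i b d : (2 <= n)%N -> (i <= b < n)%N -> n = seen N k i ->
  rank_value N n 1 <= V n i b d.
Proof.
move=> h2 /andP[hib hb] hn; rewrite /state_value hib /rank_value.
have M0 := pair_count_gt0 hN; have R := natR_le h2.
have he : (n <= seen N k b <= N)%N by rewrite hn /seen; lia.
set e := seen N k b in he *.
have [he1 he2] := andP he; have Re := natR_le he1.
rewrite mulrAC ler_pM2l; last by apply: divr_gt0 => //; rlra.
have S1 : \sum_(n <= j < e) 1 <= \sum_(n <= j < e) g j.
  apply: sum_le => j hj; apply: le_trans (g_ge hN hk Hs (p := j) _); last by lia.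
  by apply: best_ratio_ge1 => //; lia.
have S2 : \sum_(n <= p < e) rbest e <= \sum_(n <= p < e) Num.max (rbest e) (second_gain k t e b p).
  by apply: sum_le => j _; rewrite le_max lexx.
have S3 : (n%:R - 1) * rbest e <= (n%:R - 1) * Num.max (rbest e) (second_gain k t e b d).
  by apply: ler_wpM2l; [rlra | rewrite le_max lexx].
rewrite sum_ones // in S1; rewrite sum_const // in S2.
have E : (e%:R - 1) * rbest e = 2 * N%:R - e%:R - 1 by rewrite /best_ratio mulrC divfK //; rlra.
move: S1 S2 S3 E; move: (\sum_(_ <= _ < _) _) (\sum_(_ <= _ < _) _) ((_ - _) * Num.max _ _) => a1 a2 a3; rlra.
Qed.

Lemma rank_value21 n : (0 < n <= N)%N -> rank_value N n 2 <= rank_value N n 1.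
Proof.
move=> /andP[h0 hn]; rewrite /rank_value ler_pM2r ?invr_gt0 ?pair_count_gt0 //.
have := natR_le hn; have := natR_le h0 => R0 R1; rewrite ler_wpM2l //; rlra.
Qed.

Lemma state_value_ge0 n i b d : (2 <= n)%N -> (b < n)%N -> n = seen N k i -> 0 <= V n i b d.
Proof.
move=> h2 hb hn; have M0 := pair_count_gt0 hN; have R := natR_le h2.
have hnN : (n <= N)%N by rewrite hn /seen; lia.
have RN := natR_le hnN.
case: (leqP i b) => hib.
  apply: le_trans (rank_value1_le d h2 (i := i) (b := b) _ hn); last by rewrite hib.
  by apply: divr_ge0; [apply: mulr_ge0; rlra | exact: ltW].
rewrite /state_value leqNgt hib /=; apply: mulr_ge0.
  by apply: divr_ge0; [apply: mulr_ge0; rlra | exact: ltW].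
apply: addr_ge0; first exact: (t_ge0 hN hk Hs).
by case: ifP => // _; exact: pospart_ge0.
Qed.

Lemma rank_value2_le n i b d : (2 <= n)%N -> (i <= d < n)%N -> (b < n)%N -> n = seen N k i ->
  rank_value N n 2 <= V n i b d.
Proof.
move=> h2 /andP[hid hd] hb hn; have M0 := pair_count_gt0 hN; have R := natR_le h2.
have hnN : (n <= N)%N by rewrite hn /seen; lia.
case: (leqP i b) => hib.
  apply: le_trans (rank_value21 _) (rank_value1_le d h2 (i := i) (b := b) _ hn); last by rewrite hib.
  by rewrite hnN andbT; lia.
rewrite /state_value leqNgt hib /= hid ler_peMr //.
  by apply: divr_ge0; [apply: mulr_ge0; rlra | exact: ltW].
have h3 : (n <= minn (d + k) N)%N by rewrite hn /seen; lia.
have h4 : t (d + k)%N <= t n.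
  case: (leqP (d + k) N) => h; first by apply: (t_mono hN hk Hs) => //; lia.
  case: (Hs) => H0 _ _; rewrite H0; last by lia.
  exact: (t_ge0 hN hk Hs).
by have := pospart_ge (1 - t (d + k)%N); rlra.
Qed.

Lemma state_value_cont n i b d : (2 <= n)%N -> (b < n)%N -> n = seen N k i ->
  V n i.+1 b d <= V n i b d.
Proof.
move=> h2 hb hn; have M0 := pair_count_gt0 hN; have R := natR_le h2.
have hp : pospart (1 - t (d + k)%N) >= 0 := pospart_ge0 _.
have c0 : 0 <= n%:R * (n%:R - 1) / pair_count N.
  by apply: divr_ge0; [apply: mulr_ge0; rlra | exact: ltW].
rewrite /state_value; case: (ltngtP i b) => hib.
- by rewrite lexx.
- by rewrite ler_wpM2l // lerD2l; case: (ltngtP i d) => //=; rewrite ?lexx.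
rewrite -hib -hn !big_geq // add0r addr0 [leRHS]mulrA [X in _ <= X * _]mulrAC.
by rewrite ler_wpM2l // /second_gain le_max lexx orbT.
Qed.

Lemma state_value_best n i d : (2 <= n)%N -> n = seen N k i ->
  V n i i d = Num.max (rank_value N n 1) (V n i.+1 i d).
Proof.
move=> h2 hn; have M0 := pair_count_gt0 hN; have R := natR_le h2.
have c0 : 0 <= n%:R * (n%:R - 1) / pair_count N.
  by apply: divr_ge0; [apply: mulr_ge0; rlra | exact: ltW].
rewrite /state_value leqnn ltnn -hn !big_geq // add0r addr0 [LHS]mulrA [X in X * _ = _]mulrAC /second_gain.
rewrite maxr_pMr //; congr Num.max.
rewrite /rank_value /best_ratio; field.
by rewrite gt_eqF // /=; rlra.
Qed.

Lemma state_value_second n i b : (2 <= n)%N -> (b < i)%N -> n = seen N k i ->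
  V n i b i = Num.max (rank_value N n 2) (V n i.+1 b i).
Proof.
move=> h2 hb hn; have M0 := pair_count_gt0 hN; have R := natR_le h2.
have c0 : 0 <= n%:R * (n%:R - 1) / pair_count N.
  by apply: divr_ge0; [apply: mulr_ge0; rlra | exact: ltW].
rewrite /state_value leqNgt hb /= (_ : (i < b)%N = false) ?leqnn ?ltnn ?addr0 //; last by lia.
have E : t (i + k)%N = t n.
  by rewrite hn /seen; case: (leqP (i + k) N) => h //; case: (Hs) => H0 _ _; rewrite !H0 //; lia.
rewrite E; rewrite (_ : t n + _ = Num.max 1 (t n)).
  by rewrite maxr_pMr // mulr1.
by case: (pospartE (1 - t n)) (maxE 1 (t n)) => -[h1 ->] [] [h3 ->]; rlra.
Qed.

Lemma state_value_same n i b d : ~~ (i == b) -> ~~ ((b < i)%N && (i == d)) ->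
  V n i b d = V n i.+1 b d.
Proof.
move=> h1 h2; rewrite /state_value; case: (ltngtP i b) h1 h2 => //= hib _.
by case: (ltngtP i d).
Qed.
End Value.

Local Close Scope ring_scope.

(** * Relative ranks and observations *)

Section Ranks.
Variable N : nat.
Implicit Types (s u : 'S_N) (m a b : 'I_N) (n : nat).

Lemma card_below n : (n <= N)%N -> #|[set j : 'I_N | (j < n)%N]| = n.
Proof.
move=> hn; rewrite -sum1_card (eq_bigl (fun v : 'I_N => (v < n)%N)); last by move=> v; rewrite inE.
by rewrite -(big_ord_widen _ (fun=> 1%N)) // sum1_card card_ord.
Qed.

Lemma perm_val_neq s a b : a != b -> (s a < s b)%N || (s b < s a)%N.
Proof. by move=> h; rewrite -neq_ltn; apply: contra h => /eqP /val_inj /perm_inj ->. Qed.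

Lemma rel_rank_le s n a b : (s a < s b)%N -> (rel_rank s n a <= rel_rank s n b)%N.
Proof.
move=> h; apply: subset_leq_card; apply/subsetP => j; rewrite !inE.
by case/andP=> -> /ltn_trans -> //.
Qed.

Lemma rel_rank_lt s n a b : (a < n)%N -> (s a < s b)%N -> (rel_rank s n a < rel_rank s n b)%N.
Proof.
move=> ha h; apply: proper_card; apply/properP; split.
  apply/subsetP => j; rewrite !inE; case/andP=> -> /ltn_trans -> //.
by exists a; rewrite !inE ?ha ?h // ltnn.
Qed.

Lemma rel_rank_inj s n a b : (a < n)%N -> (b < n)%N ->
  rel_rank s n a = rel_rank s n b -> a = b.
Proof.
move=> ha hb E; apply/eqP; apply: contraT => /(perm_val_neq s) /orP[] h.
  by have := rel_rank_lt ha h; rewrite E ltnn.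
by have := rel_rank_lt hb h; rewrite E ltnn.
Qed.

Lemma rel_rank_full s m : rel_rank s N m = (s m).+1.
Proof.
rewrite /rel_rank; congr _.+1.
have -> : [set j : 'I_N | (j < N)%N && (s j < s m)%N] = s @^-1: [set v : 'I_N | (v < s m)%N].
  by apply/setP => j; rewrite !inE ltn_ord.
rewrite card_preimset; last exact: perm_inj.
by rewrite card_below // ltnW.
Qed.

Lemma rel_rankS s m (p : 'I_N) : rel_rank s p.+1 m = (rel_rank s p m + (s p < s m))%N.
Proof.
rewrite /rel_rank addSn; congr _.+1.
case: (boolP (s p < s m)%N) => h; last first.
  rewrite addn0; apply: eq_card => j; rewrite !inE ltnS.
  rewrite leq_eqVlt; case: (eqVneq (j : nat) p) => [/val_inj ->|//].
  by rewrite (negbTE h) andbF ltnn.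
rewrite (_ : [set j : 'I_N | (j < p.+1)%N && (s j < s m)%N] =
   p |: [set j : 'I_N | (j < p)%N && (s j < s m)%N]).
  by rewrite cardsU1 inE ltnn addnC.
apply/setP => j; rewrite !inE ltnS leq_eqVlt.
by case: (eqVneq j p) => [->|hj]; rewrite ?eqxx ?h //= (inj_eq val_inj) (negbTE hj).
Qed.

Lemma rel_rank_new s (p : 'I_N) : rel_rank s p.+1 p = rel_rank s p p.
Proof. by rewrite rel_rankS ltnn addn0. Qed.

Lemma same_obs_lt n s u a b : same_obs n s u -> (a < n)%N -> (b < n)%N ->
  (s a < s b)%N = (u a < u b)%N.
Proof.
move=> /forallP/(_ a)/forallP/(_ b)/implyP h ha hb.
by apply: (eqP (h _)); rewrite ha.
Qed.

Lemma same_obs_le n n' s u : (n <= n')%N -> same_obs n' s u -> same_obs n s u.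
Proof.
move=> h H; apply/forallP => a; apply/forallP => b; apply/implyP => /andP[ha hb].
by apply/eqP; apply: (same_obs_lt H); [exact: leq_trans ha h | exact: leq_trans hb h].
Qed.

Lemma same_obs_rank n s u m : same_obs n s u -> (m < n)%N -> rel_rank s n m = rel_rank u n m.
Proof.
move=> h hm; rewrite /rel_rank; congr _.+1; apply: eq_card => j; rewrite !inE.
by case: (boolP (j < n)%N) => //= hj; rewrite (same_obs_lt h).
Qed.

(** Events decided by the relative order of the first [n] applicants; they replace conditioning on
    the past. *)
Definition obs_closed n (E : {set 'S_N}) : Prop :=
  forall s u, s \in E -> same_obs n s u -> u \in E.

Section Swap.
Variables (p : 'I_N) (E : {set 'S_N}) (flip : bool).
Hypothesis hE : obs_closed p E.

(** [flip] reverses the ranks, so that one injection yields both inequalities between neighbouring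
    rank classes. *)
Let key (x : 'I_N) : nat := if flip then (N - x)%N else x.
Let cnt s := #|[set j : 'I_N | (j < p)%N && (key (s j) < key (s p))%N]|.

Let key_inj a b : key a = key b -> a = b.
Proof. by rewrite /key; case: flip => h; apply: val_inj => //=; have := ltn_ord a; have := ltn_ord b; lia. Qed.

Let key_lt a b : (key a < key b)%N = (if flip then (b < a)%N else (a < b)%N).
Proof. by rewrite /key; case: flip => //; have := ltn_ord a; have := ltn_ord b; lia. Qed.

Let obs_key s u : (forall a b, (a < p)%N -> (b < p)%N ->
  (key (s a) < key (s b))%N = (key (u a) < key (u b))%N) -> same_obs p s u.
Proof.
move=> h; apply/forallP => a; apply/forallP => b; apply/implyP => /andP[ha hb]; apply/eqP.
have := h a b ha hb; have := h b a hb ha; rewrite !key_lt; case: flip => //.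
Qed.

(* Exchanging the newcomer with its immediate successor raises its rank by one
   and leaves the order of the earlier applicants unchanged. *)
Let next s (j : 'I_N) : Prop := [/\ (j < p)%N, (key (s p) < key (s j))%N &
   forall x : 'I_N, (x < p)%N -> (key (s p) < key (s x))%N -> (key (s j) <= key (s x))%N].

Let next_ex s c : (c < p)%N -> cnt s = c -> exists j, next s j.
Proof.
move=> hc h.
have [j0 hj0] : exists j0 : 'I_N, (j0 < p)%N && (key (s p) < key (s j0))%N.
  apply/existsP; apply: contraT => /existsPn H; move: h hc => <-.
  rewrite /cnt (_ : [set _ | _] = [set j : 'I_N | (j < p)%N]).
    by rewrite card_below ?ltnn // ltnW.
  apply/setP => j; rewrite !inE; case: (boolP (j < p)%N) => //= hj.
  have := H j; rewrite hj /= -leqNgt leq_eqVlt => /orP[/eqP /key_inj /perm_inj E1|//].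
  by rewrite E1 ltnn in hj.
case: (@arg_minnP _ j0 (fun j : 'I_N => (j < p)%N && (key (s p) < key (s j))%N) (fun j => key (s j)) hj0).
move=> j /andP[h1 h2] H; exists j; split=> // x hx hx'; apply: H; by rewrite hx.
Qed.

Let swap s j : 'S_N := (tperm p j * s)%g.

Let swapE s j x : swap s j x = s (tperm p j x). Proof. by rewrite permM. Qed.
Let swap_p s j : swap s j p = s j. Proof. by rewrite swapE tpermL. Qed.
Let swap_j s j : swap s j j = s p. Proof. by rewrite swapE tpermR. Qed.
Let swap_x s (j x : 'I_N) : (x < p)%N -> x != j -> swap s j x = s x.
Proof. by move=> h1 h2; rewrite swapE tpermD //; [rewrite neq_ltn h1 orbT | rewrite eq_sym]. Qed.

Let between s (j x : 'I_N) : next s j -> (x < p)%N -> x != j ->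
  (key (s x) < key (s j))%N = (key (s x) < key (s p))%N.
Proof.
move=> [hj h1 h2] hx hxj; apply/idP/idP => [h|/ltn_trans -> //].
rewrite ltnNge leq_eqVlt; apply/negP => /orP[/eqP /key_inj /perm_inj E1|h3].
  by rewrite E1 ltnn in hx.
by have := h2 x hx h3; rewrite leqNgt h.
Qed.

Let next_obs s j : next s j -> same_obs p s (swap s j).
Proof.
move=> hn; have [hj h1 h2] := hn; apply: obs_key => a b ha hb.
have B (x : 'I_N) : (x < p)%N -> x != j -> (key (s j) < key (s x))%N = (key (s p) < key (s x))%N.
  move=> hx hxj; apply/idP/idP => [h|h]; first exact: ltn_trans h.
  by rewrite ltn_neqAle h2 // andbT; apply: contra hxj => /eqP /key_inj /perm_inj ->.
case: (eqVneq a j) => [->|haj]; case: (eqVneq b j) => [->|hbj]; rewrite ?ltnn //.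
- by rewrite swap_j swap_x // B.
- by rewrite swap_j swap_x // between.
by rewrite !swap_x.
Qed.

Let next_cnt s j : next s j -> cnt (swap s j) = (cnt s).+1.
Proof.
move=> hn; have [hj h1 h2] := hn; rewrite /cnt swap_p.
rewrite (_ : [set _ | _] = j |: [set j : 'I_N | (j < p)%N && (key (s j) < key (s p))%N]).
  by rewrite cardsU1 inE hj /= ltnNge (ltnW h1).
apply/setP => x; rewrite !inE; case: (eqVneq x j) => [->|hxj] /=; first by rewrite hj swap_j h1.
by case: (boolP (x < p)%N) => //= hx; rewrite swap_x // between.
Qed.

Let next_inj s s' j j' : next s j -> next s' j' -> swap s j = swap s' j' -> s = s'.
Proof.
move=> hn hn' h; suff E1 : j = j'.
  by move: h; rewrite E1 /swap => /mulgI.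
have K s1 s2 j1 j2 : next s1 j1 -> next s2 j2 -> swap s1 j1 = swap s2 j2 ->
    (key (swap s1 j1 j2) <= key (swap s1 j1 j1))%N.
  move=> n1 n2 E1; case: (eqVneq j1 j2) => [->//|hj].
  have [hj1 _ _] := n1; have [hj2 h2 _] := n2.
  rewrite swap_j swap_x ?(eq_sym j2) // leqNgt; apply/negP => h3.
  have [_ _ /(_ j2 hj2 h3)] := n1; rewrite leqNgt => /negP; apply.
  by rewrite -(swap_x s1 hj2 (j := j1)) ?(eq_sym j2) // -(swap_p s1) E1 swap_j swap_p.
apply/(@perm_inj _ (swap s j))/key_inj/eqP; rewrite eqn_leq; apply/andP; split.
  by rewrite h; apply: (K _ s).
exact: (K _ s').
Qed.

Lemma swap_step c : (c < p)%N -> (#|[set s in E | cnt s == c]| <= #|[set s in E | cnt s == c.+1]|)%N.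
Proof.
move=> hc.
pose f s := if [pick j : 'I_N | [&& (j < p)%N, (key (s p) < key (s j))%N &
   [forall x : 'I_N, (x < p)%N && (key (s p) < key (s x))%N ==> (key (s j) <= key (s x))%N]]] is Some j
   then swap s j else s.
have fP s : cnt s = c -> exists2 j, next s j & f s = swap s j.
  move=> hs; rewrite /f; case: pickP => [j /and3P[h1 h2 /forallP h3]|H].
    by exists j => //; split=> // x hx hx'; apply: (implyP (h3 x)); rewrite hx.
  have [j [h1 h2 h3]] := next_ex hc hs; have := H j; rewrite h1 h2 /=.
  by case/forallP=> x; apply/implyP => /andP[hx hx']; apply: h3.
rewrite -(card_in_imset (f := f)); last first.
  move=> s s'; rewrite !inE => /andP[_ /eqP /fP [j hj ->]] /andP[_ /eqP /fP [j' hj' ->]].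
  exact: next_inj.
apply: subset_leq_card; apply/subsetP => u /imsetP [s]; rewrite !inE => /andP[hs /eqP hc'].
have [j hj ->] := fP s hc' => ->; rewrite next_cnt // hc' eqxx andbT.
by apply: (hE hs); apply: next_obs.
Qed.
End Swap.

(** [swap_step] in both orders makes the p + 1 rank classes equally large: the relative rank of a
    newcomer is uniform and independent of what was observed before. *)
Lemma newcomer_count (p : 'I_N) (E : {set 'S_N}) r : obs_closed p E -> (0 < r <= p.+1)%N ->
  (#|[set s in E | rel_rank s p.+1 p == r]| * p.+1 = #|E|)%N.
Proof.
move=> hE hr.
pose c s := #|[set j : 'I_N | (j < p)%N && (s j < s p)%N]|.
have hc s : (c s <= p)%N.
  rewrite -[leqRHS](card_below (ltnW (ltn_ord p))).
  by apply: subset_leq_card; apply/subsetP => j; rewrite !inE => /andP[].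
have up d : (d < p)%N -> (#|[set s in E | c s == d]| <= #|[set s in E | c s == d.+1]|)%N.
  by move=> hd; have := swap_step false hE hd.
have down d : (d < p)%N -> (#|[set s in E | c s == d.+1]| <= #|[set s in E | c s == d]|)%N.
  move=> hd; have hd' : (p - d.+1 < p)%N by lia.
  have E1 s : #|[set j : 'I_N | (j < p)%N && (N - s j < N - s p)%N]| = (p - c s)%N.
    rewrite -[in RHS](card_below (ltnW (ltn_ord p))).
    rewrite -(cardsID [set j : 'I_N | (s j < s p)%N] [set j : 'I_N | (j < p)%N]) /c.
    rewrite (_ : [set j : 'I_N | (j < p)%N && (s j < s p)%N] =
       [set j : 'I_N | (j < p)%N] :&: [set j : 'I_N | (s j < s p)%N]).
      rewrite addKn; apply: eq_card => j; rewrite !inE andbC; case: (boolP (j < p)%N) => hj; rewrite ?andbF ?andbT //.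
      have : s j != s p by apply/eqP => /perm_inj E1; rewrite E1 ltnn in hj.
      by rewrite -(inj_eq val_inj) /=; have := ltn_ord (s j); have := ltn_ord (s p); lia.
    by apply/setP => j; rewrite !inE.
  have := swap_step true hE hd'; rewrite /swap_step.
  rewrite (_ : [set s in E | _ == (p - d.+1)%N] = [set s in E | c s == d.+1]).
    rewrite (_ : [set s in E | _ == (p - d.+1).+1] = [set s in E | c s == d]) //.
    by apply/setP => s; rewrite !inE E1; congr (_ && _); have := hc s; lia.
  by apply/setP => s; rewrite !inE E1; congr (_ && _); have := hc s; lia.
have cst d : (d <= p)%N -> #|[set s in E | c s == d]| = #|[set s in E | c s == 0%N]|.
  elim: d => // d IH hd; rewrite -IH ?(ltnW hd) //; apply/eqP.
  by rewrite eqn_leq up // down.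
have rE s : (rel_rank s p.+1 p == r) = (c s == r.-1).
  by rewrite rel_rank_new /rel_rank -/(c s); case: r hr.
rewrite (_ : [set s in E | _] = [set s in E | c s == r.-1]); last first.
  by apply/setP => s; rewrite !inE rE.
rewrite cst; last by lia.
transitivity (\sum_(d < p.+1) #|[set s in E | c s == d]|)%N.
  by rewrite (eq_bigr (fun=> #|[set s in E | c s == 0%N]|)) => [|d _]; [rewrite sum_nat_const card_ord mulnC | apply: cst; rewrite -ltnS].
transitivity (\sum_(d < p.+1) \sum_(s in E | inord (c s) == d) 1)%N.
  apply: eq_bigr => d _; rewrite -sum1_card; apply: eq_bigl => s; rewrite !inE; congr (_ && _).
  by rewrite -(inj_eq val_inj) /= inordK // ltnS.
by rewrite -(partition_big (fun s => inord (c s)) xpredT) // sum1_card.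
Qed.
End Ranks.

Local Open Scope ring_scope.

(** * Positions of the two leaders and their transitions *)

Section State.
Variable N : nat.
Implicit Types (s u : 'S_N) (m b d : 'I_N) (E X : {set 'S_N}) (n : nat).

Definition top_state n s b d : bool :=
  [&& (b < n)%N, (d < n)%N, rel_rank s n b == 1%N & rel_rank s n d == 2%N].

Lemma top_state_obs n s u b d : same_obs n s u -> top_state n s b d = top_state n u b d.
Proof.
move=> h; rewrite /top_state; case: (boolP (b < n)%N) => //= hb.
by case: (boolP (d < n)%N) => //= hd; rewrite !(same_obs_rank h).
Qed.

Lemma top_state_uniq n s b d b' d' :
  top_state n s b d -> top_state n s b' d' -> (b, d) = (b', d').
Proof.
move=> /and4P[h1 h2 /eqP h3 /eqP h4] /and4P[h1' h2' /eqP h3' /eqP h4'].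
congr pair; first by apply: (rel_rank_inj (s := s) h1 h1'); rewrite h3.
by apply: (rel_rank_inj (s := s) h2 h2'); rewrite h4.
Qed.

Lemma top_state_ex n s b : (2 <= n <= N)%N -> (b < n)%N -> rel_rank s n b = 1%N ->
  exists2 d, b != d & top_state n s b d.
Proof.
move=> hn hb h1.
have Hb m : (m < n)%N -> (s m < s b)%N = false.
  move=> hm; apply/negP => h; have := rel_rank_lt hm h.
  by rewrite h1 /rel_rank ltnS ltn0.
have [d0 hd0] : exists d0 : 'I_N, (d0 < n)%N && (b != d0).
  case: (eqVneq (b : nat) 0%N) => hb0.
    have h : (1 < N)%N by lia.
    by exists (Ordinal h); rewrite -(inj_eq val_inj) /= hb0; lia.
  have h : (0 < N)%N by lia.
  by exists (Ordinal h); rewrite -(inj_eq val_inj) /=; lia.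
case: (@arg_minnP _ d0 (fun d : 'I_N => (d < n)%N && (b != d)) (fun d => s d) hd0).
move=> d /andP[hd hbd] H; exists d => //; rewrite /top_state hb hd h1 eqxx /= /rel_rank.
rewrite (_ : [set _ | _] = [set b]) ?cards1 //.
apply/setP => j; rewrite !inE; case: (eqVneq j b) => [->|hj].
  by rewrite hb; have := perm_val_neq s hbd; rewrite (Hb d hd) orbF => ->.
apply/negP => /andP[hjn]; apply/negP; rewrite -leqNgt; apply: H.
by rewrite hjn eq_sym.
Qed.

Lemma top_state_new1 (p : 'I_N) s b d :
  top_state p s b d -> rel_rank s p.+1 p = 1%N -> top_state p.+1 s p b.
Proof.
move=> /and4P[h1 h2 /eqP h3 /eqP h4] h; have h' := h; rewrite rel_rank_new in h'.
have hpb : p != b by apply/eqP => E; rewrite E ltnn in h1.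
rewrite /top_state h !ltnSn (leqW h1) !eqxx /= rel_rankS h3.
have /orP[-> //|hb] := perm_val_neq s hpb.
by have := rel_rank_lt h1 hb; rewrite h3 h' ltnn.
Qed.

Lemma top_state_new2 (p : 'I_N) s b d :
  top_state p s b d -> rel_rank s p.+1 p = 2%N -> top_state p.+1 s b p.
Proof.
move=> /and4P[h1 h2 /eqP h3 /eqP h4] h; have h' := h; rewrite rel_rank_new in h'.
rewrite /top_state h !ltnSn (leqW h1) !eqxx /= rel_rankS h3.
case: (boolP (s p < s b)%N) => // hb.
by have := rel_rank_le p hb; rewrite h3 h'.
Qed.

Lemma top_state_new3 (p : 'I_N) s b d :
  top_state p s b d -> (2 < rel_rank s p.+1 p)%N -> top_state p.+1 s b d.
Proof.
move=> /and4P[h1 h2 /eqP h3 /eqP h4]; rewrite rel_rank_new => h'.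
rewrite /top_state (leqW h1) (leqW h2) !rel_rankS h3 h4 /=.
case: (boolP (s p < s b)%N) => hb; first by have := rel_rank_le p hb; rewrite h3; lia.
by case: (boolP (s p < s d)%N) => hd //; have := rel_rank_le p hd; rewrite h4; lia.
Qed.

Definition obs_state n E b d : Prop :=
  obs_closed n E /\ forall s, s \in E -> top_state n s b d.

Lemma obs_state_sub n E F b d : obs_state n E b d -> obs_closed n F -> F \subset E -> obs_state n F b d.
Proof. by move=> [h1 h2] h3 /subsetP h4; split=> // s hs; apply: h2; apply: h4. Qed.

Lemma card_part (T : finType) E X (f : 'S_N -> T) :
  #|E :&: X| = (\sum_y #|[set s in E | f s == y] :&: X|)%N.
Proof.
rewrite -sum1_card (partition_big f xpredT) //; apply: eq_bigr => y _.
by rewrite -sum1_card; apply: eq_bigl => s; rewrite !inE andbAC.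
Qed.

Lemma new_closed (p : 'I_N) E (P : pred nat) : obs_closed p E ->
  obs_closed p.+1 [set s in E | P (rel_rank s p.+1 p)].
Proof.
move=> hE s u; rewrite !inE => /andP[hs hr] h; rewrite -(same_obs_rank h) // hr andbT.
by apply: (hE s) => //; apply: same_obs_le h.
Qed.

Lemma new_split (p : 'I_N) E : obs_closed p E -> (2 <= p)%N ->
  exists E1 E2 E3 : {set 'S_N},
  [/\ [/\ obs_closed p.+1 E1, obs_closed p.+1 E2 & obs_closed p.+1 E3],
      [/\ forall s, s \in E1 -> s \in E /\ rel_rank s p.+1 p = 1%N,
          forall s, s \in E2 -> s \in E /\ rel_rank s p.+1 p = 2%N
        & forall s, s \in E3 -> s \in E /\ (2 < rel_rank s p.+1 p)%N],
      forall X, #|E :&: X| = (#|E1 :&: X| + #|E2 :&: X| + #|E3 :&: X|)%N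
    & [/\ (p%:R + 1) * #|E1|%:R = #|E|%:R :> rat, (p%:R + 1) * #|E2|%:R = #|E|%:R :> rat
        & (p%:R + 1) * #|E3|%:R = (p%:R - 1) * #|E|%:R :> rat]].
Proof.
move=> hE hp.
pose F (P : pred nat) := [set s in E | P (rel_rank s p.+1 p)].
exists (F (pred1 1%N)), (F (pred1 2%N)), (F (ltn 2)).
have S X : #|E :&: X| = (#|F (pred1 1%N) :&: X| + #|F (pred1 2%N) :&: X| + #|F (ltn 2) :&: X|)%N.
  rewrite (card_part _ _ (fun s => rel_rank s p.+1 p == 1%N)) big_bool /=.
  rewrite -addnA; congr (_ + _)%N; first by apply: eq_card => s; rewrite !inE eqb_id.
  rewrite (card_part _ _ (fun s => rel_rank s p.+1 p == 2%N)) big_bool /=.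
  congr (_ + _)%N; apply: eq_card => s; rewrite !inE !(eqbF_neg, eqb_id);
    have := isT : (0 < rel_rank s p.+1 p)%N;
    by case: (s \in E); case: (s \in X); case: (rel_rank s p.+1 p) => [|[|[|r]]].
split.
- by split; [exact: (new_closed (P := pred1 1%N) hE) | exact: (new_closed (P := pred1 2%N) hE)
    | exact: (new_closed (P := ltn 2) hE)].
- by split=> s; rewrite !inE => /andP[-> /= h] //; rewrite ?(eqP h).
- exact: S.
have c1 := newcomer_count (r := 1) hE isT; have c2 := newcomer_count (r := 2) hE ltac:(lia).
have c3 := S [set: 'S_N]; rewrite !setIT in c3.
have R1 : (p%:R + 1) * #|F (pred1 1%N)|%:R = #|E|%:R :> rat by rewrite natr1 mulrC -natrM c1.
have R2 : (p%:R + 1) * #|F (pred1 2%N)|%:R = #|E|%:R :> rat by rewrite natr1 mulrC -natrM c2.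
by split=> //; move: R1 R2; rewrite c3 !natrD => R1 R2; lra.
Qed.

Lemma rank_top2 n s m : (n <= N)%N -> (2 < rel_rank s n m)%N -> top2 s m = false.
Proof.
move=> hn; have : (rel_rank s n m <= rel_rank s N m)%N.
  rewrite ltnS; apply: subset_leq_card; apply/subsetP => j; rewrite !inE ltn_ord.
  by case/andP.
by rewrite rel_rank_full /top2; lia.
Qed.

(** Split by the rank of the next applicant: one ranked at or above [m] pushes [m] down by one, any
    other leaves its rank alone. The closed forms of [rank_value] satisfy this recursion. *)
Lemma rank_count n : (n <= N)%N -> (2 <= n)%N -> forall m E, (m < n)%N -> obs_closed n E ->
  forall r, (r <= 2)%N -> (forall s, s \in E -> rel_rank s n m = r) ->
  #|E :&: [set s | top2 s m]|%:R = rank_value N n r * #|E|%:R.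
Proof.
move: n; apply: (@backward_ind N) => n hn IH h2 m E hm hE r hr hrE.
case: (set_0Vmem E) => [->|[s0 hs0]]; first by rewrite set0I cards0 mulr0.
have r0 : (0 < r)%N by rewrite -(hrE s0).
case: (ltnP n N) => hnN; last first.
  have EN : n = N by lia.
  have M0 : pair_count N != 0.
    have := natR_le h2; rewrite EN => R; rewrite /pair_count mulf_neq0 //; rlra.
  have -> : rank_value N n r = 1.
    rewrite EN; case: r hr r0 {hrE} => [//|[|[|//]]] _ _ /=; last by rewrite divff.
    by rewrite -[RHS](divff M0); congr (_ / _); rewrite /pair_count; ring.
  rewrite mul1r; congr _%:R; apply: eq_card => s; rewrite !inE.
  case: (boolP (s \in E)) => //= hs; have := hrE s hs; rewrite EN rel_rank_full /top2; lia.
pose p := Ordinal hnN.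
have [E1 [E2 [E3 [[c1 c2 c3] [e1 e2 e3] S [n1 n2 n3]]]]] := new_split (p := p) hE h2.
have hm' : (m < n.+1)%N by lia.
have hmp : m != p by apply/eqP => E0; rewrite E0 ltnn in hm.
have RN s : rel_rank s n.+1 p = rel_rank s n p := rel_rank_new s p.
have lt1 s : s \in E -> (rel_rank s n.+1 p <= r)%N -> (s p < s m)%N.
  move=> hs h; have /orP[h1|//] := perm_val_neq s hmp.
  by have := rel_rank_lt hm h1; rewrite (hrE s hs) -RN; lia.
have lt2 s : s \in E -> (r < rel_rank s n.+1 p)%N -> (s p < s m)%N = false.
  move=> hs h; apply/negP => h1; have := rel_rank_le n h1.
  by rewrite (hrE s hs) -RN; lia.
have rS s : s \in E -> rel_rank s n.+1 m = (r + (s p < s m))%N.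
  by move=> hs; rewrite -(hrE s hs); exact: (rel_rankS s m p).
have R2 := natR_le h2; have R3 := natR_le hn.
apply: (@mulfI _ (n%:R + 1)); first by rlra.
have hIH := IH n.+1 ltac:(lia) ltac:(lia) m _ hm'.
rewrite S !natrD; case: r hr r0 hrE lt1 lt2 rS => [//|[|[|//]]] _ _ hrE lt1 lt2 rS.
- rewrite (hIH E1 c1 2) //; last first.
    by move=> s /e1 [hs h]; rewrite rS // lt1 ?h.
  rewrite (hIH E2 c2 1) //; last first.
    by move=> s /e2 [hs h]; rewrite rS // lt2 ?h.
  rewrite (hIH E3 c3 1) //; last first.
    by move=> s /e3 [hs h]; rewrite rS // lt2 //; exact: ltnW h.
  rewrite !mulrDr ![(_ + 1) * (_ * _)]mulrCA n1 n2 n3 /rank_value ?addn1 /= -natr1.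
  by rewrite /pair_count; field; apply/andP; split; rlra.
have z (F : {set 'S_N}) : (forall s, s \in F -> s \in E /\ (rel_rank s n.+1 p <= 2)%N) ->
    #|F :&: [set s | top2 s m]| = 0%N.
  move=> hF; apply/eqP; rewrite cards_eq0; apply/eqP/setP => s; rewrite !inE.
  apply/negP => /andP[/hF [hs h]]; rewrite (rank_top2 (n := n.+1)) // rS // lt1 //.
rewrite (z E1) ?(z E2) ?add0r; last 2 first.
- by move=> s /e2 [hs ->].
- by move=> s /e1 [hs ->].
rewrite (hIH E3 c3 2) //; last first.
  by move=> s /e3 [hs h]; rewrite rS // lt2.
rewrite ![(_ + 1) * (_ * _)]mulrCA n3 /rank_value /= -natr1 /pair_count.
by field; apply/andP; split; rlra.
Qed.
End State.

(** * Values of policies *)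

Section Chosen.
Variable N : nat.
Implicit Types (p : policy N) (s : 'S_N) (E : {set 'S_N}).

Lemma filter_leq_iota k : (k <= N)%N -> [seq j <- iota 0 N | (k <= j)%N] = iota k (N - k).
Proof.
move=> h; rewrite -{1}(subnKC h) iotaD filter_cat add0n.
rewrite (@eq_in_filter _ _ pred0) => [|j]; last by rewrite mem_iota /=; lia.
rewrite filter_pred0 /= (@eq_in_filter _ _ predT) ?filter_predT // => j.
by rewrite mem_iota /=; lia.
Qed.

Lemma chosen_step p s (i : 'I_N) :
  chosen p s i = if p i s is Some m then Some m else chosen p s i.+1.
Proof.
rewrite /chosen; have hi := ltn_ord i.
rewrite (_ : [seq j : 'I_N <- enum 'I_N | (i <= j)%N] =
  i :: [seq j : 'I_N <- enum 'I_N | (i < j)%N]) /=; first by case: (p i s).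
have F k : [seq val j | j <- [seq j : 'I_N <- enum 'I_N | (k <= j)%N]] =
    [seq j <- iota 0 N | (k <= j)%N] by rewrite -val_enum_ord filter_map.
apply: (inj_map val_inj); rewrite map_cons !F !filter_leq_iota ?(ltnW hi) //.
by rewrite -{1}[(N - i)%N]prednK /= ?subnS // subn_gt0.
Qed.

Lemma chosen_end p s k : (N <= k)%N -> chosen p s k = None.
Proof.
move=> hk; rewrite /chosen (eq_filter (a2 := pred0)) ?filter_pred0 // => j /=.
by have := ltn_ord j; lia.
Qed.

Lemma wins_stop p E (i : 'I_N) m : (forall s, s \in E -> p i s = Some m) ->
  E :&: wins_from p i = E :&: [set s | top2 s m].
Proof.
move=> h; apply/setP => s; rewrite !inE; case: (boolP (s \in E)) => //= hs.
by rewrite chosen_step h.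
Qed.

Lemma wins_pass p E (i : 'I_N) : (forall s, s \in E -> p i s = None) ->
  E :&: wins_from p i = E :&: wins_from p i.+1.
Proof.
move=> h; apply/setP => s; rewrite !inE; case: (boolP (s \in E)) => //= hs.
by rewrite chosen_step h.
Qed.

Lemma wins_end p k : (N <= k)%N -> wins_from p k = set0.
Proof. by move=> hk; apply/setP => s; rewrite !inE chosen_end. Qed.

End Chosen.

Section Bounds.
Variables (N k : nat) (t g : nat -> rat).
Hypotheses (hN : (2 < N)%N) (hk : (0 < k)%N) (Hs : system N k t g).
Notation V := (state_value N k t g).
Notation sn := (seen N k).
Implicit Types (p : policy N) (E X : {set 'S_N}) (b d : 'I_N).

Lemma seenS i : (sn i < N)%N -> sn i = (i + k)%N /\ sn i.+1 = (sn i).+1.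
Proof. by rewrite /seen; lia. Qed.

(* With [c = 1] the bounds are upper bounds, with [c = -1] lower bounds. *)
Lemma cont_bound (c : rat) i X : (2 <= sn i)%N ->
  (forall E b d, obs_state (sn i.+1) E b d ->
     c * #|E :&: X|%:R <= c * (V (sn i.+1) i.+1 b d * #|E|%:R)) ->
  forall E b d, obs_state (sn i) E b d ->
     c * #|E :&: X|%:R <= c * (V (sn i) i.+1 b d * #|E|%:R).
Proof.
move=> h2 H E b d [hE hS].
case: (set_0Vmem E) => [->|[s0 hs0]]; first by rewrite set0I cards0 !mulr0.
have /and4P[hb hd _ _] := hS s0 hs0.
case: (leqP N (sn i)) => hi.
  have EN : sn i = sn i.+1 by move: hi; rewrite /seen; lia.
  by rewrite EN; apply: H; split; rewrite -EN.
have [E0 E1] := seenS hi; rewrite E1 in H.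
move: (sn i) h2 H hE hS hb hd hi E0 {E1} => n h2 H hE hS hb hd hi E0.
pose q := Ordinal hi.
have [F1 [F2 [F3 [[c1 c2 c3] [e1 e2 e3] S [n1 n2 n3]]]]] := new_split (p := q) hE h2.
have hS' : forall s, s \in E -> top_state q s b d := hS.
have H1 := H F1 q b (conj c1 (fun s h => top_state_new1 (hS' s (proj1 (e1 s h))) (proj2 (e1 s h)))).
have H2 := H F2 b q (conj c2 (fun s h => top_state_new2 (hS' s (proj1 (e2 s h))) (proj2 (e2 s h)))).
have H3 := H F3 b d (conj c3 (fun s h => top_state_new3 (hS' s (proj1 (e3 s h))) (proj2 (e3 s h)))).
have R := state_value_rec hN hk Hs h2 hi E0 hb hd.
have Rn := natR_le h2.
rewrite -(ler_pM2l (x := n%:R + 1)); last by rlra.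
rewrite [leRHS]mulrCA [X in _ <= _ * X]mulrA R S !natrD.
move: H1 H2 H3 n1 n2 n3 => /=.
set v1 := V _ _ _ _; set v2 := V _ _ _ _; set v3 := V _ _ _ _.
move: #|F1|%:R #|F2|%:R #|F3|%:R #|E|%:R #|F1 :&: X|%:R #|F2 :&: X|%:R #|F3 :&: X|%:R.
move=> f1 f2 f3 e x1 x2 x3 H1 H2 H3 n1 n2 n3.
have -> : c * ((v1 + v2 + (n%:R - 1) * v3) * e) =
    (n%:R + 1) * (c * (v1 * f1) + c * (v2 * f2) + c * (v3 * f3)).
  have -> : (n%:R + 1) * (c * (v1 * f1) + c * (v2 * f2) + c * (v3 * f3)) =
     c * (v1 * ((n%:R + 1) * f1) + v2 * ((n%:R + 1) * f2) + v3 * ((n%:R + 1) * f3)) by ring.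
  by rewrite n1 n2 n3; ring.
have Rn0 : 0 < n%:R + 1 :> rat by rlra.
by rewrite ler_pM2l //; rlra.
Qed.

Lemma upper_bound p : admissible k p -> forall i, (i <= N)%N -> (2 <= sn i)%N ->
  forall E b d, obs_state (sn i) E b d ->
    #|E :&: wins_from p i|%:R <= V (sn i) i b d * #|E|%:R.
Proof.
move=> hp; apply: (@backward_ind N) => i hi IH h2 E b d hE.
case: (set_0Vmem E) => [->|[s0 hs0]]; first by rewrite set0I cards0 !mulr0.
have [cE hS] := hE; have /and4P[hb hd _ _] := hS s0 hs0.
have V0 := state_value_ge0 hN hk Hs d h2 hb (erefl (sn i)).
have nN : (sn i <= N)%N by rewrite /seen; lia.
case: (ltnP i N) => hiN; last by rewrite wins_end // setI0 cards0 mulr_ge0.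
pose I := Ordinal hiN.
(* A decision depends only on the observations, so splitting [E] by it leaves closed pieces in the
   same state. *)
rewrite (card_part E _ (fun s => p I s)) natr_sum.
have -> : #|E|%:R = \sum_(o : option 'I_N) #|[set s in E | p I s == o]|%:R :> rat.
  by rewrite -natr_sum -[E in LHS]setIT (card_part E _ (fun s => p I s)); under eq_bigr do rewrite setIT.
rewrite mulr_sumr; apply: ler_sum => o _; set F := [set s in E | _].
have cF : obs_closed (sn i) F.
  move=> s u; rewrite !inE => /andP[h1 h3] h; rewrite (cE s) //=.
  have /forallP/(_ I)/forallP/(_ s)/andP[_ /forallP/(_ u)/implyP/(_ h)/eqP <-] := hp.
  by [].
have FP s : s \in F -> p I s = o by rewrite inE => /andP[_ /eqP].
have sF : F \subset E by apply/subsetP => s; rewrite inE => /andP[].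
have hF := obs_state_sub hE cF sF.
move: F cF sF hF FP; case: o => [m|] F cF sF hF FP; last first.
  have -> : F :&: wins_from p i = F :&: wins_from p i.+1.
    by apply: (wins_pass (i := I)).
  have := @cont_bound 1 i (wins_from p i.+1) h2 _ F b d hF.
  rewrite !mul1r => H; apply: le_trans (H _) _.
    by move=> E' b' d' hE'; rewrite !mul1r; apply: IH hE'; rewrite /seen in h2 *; lia.
  by rewrite ler_wpM2r // state_value_cont.
case: (set_0Vmem F) => [->|[s1 hs1]]; first by rewrite set0I cards0 !mulr0.
have -> : F :&: wins_from p i = F :&: [set s | top2 s m].
  by apply: (wins_stop (i := I)).
have hm : (i <= m < sn i)%N.
  have h := FP s1 hs1.
  by have /forallP/(_ I)/forallP/(_ s1)/andP[] := hp; rewrite h.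
have [him hmn] := andP hm.
case: (eqVneq m b) => [Emb|hmb].
  rewrite (rank_count nN h2 hmn cF (r := 1)) //; last first.
    by move=> s /(subsetP sF) /hS /and4P[_ _ /eqP + _]; rewrite Emb.
  by rewrite ler_wpM2r // (rank_value1_le hN hk Hs) // -Emb.
case: (eqVneq m d) => [Emd|hmd].
  rewrite (rank_count nN h2 hmn cF (r := 2)) //; last first.
    by move=> s /(subsetP sF) /hS /and4P[_ _ _ /eqP]; rewrite Emd.
  by rewrite ler_wpM2r // (rank_value2_le hN hk Hs) // -Emd.
(* Any other choice already has relative rank above 2 and cannot win. *)
rewrite (_ : F :&: _ = set0) ?cards0 ?mulr_ge0 //.
apply/setP => s; rewrite !inE; apply/negP => /andP[hs0' ].
have hs := subsetP sF s hs0'.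
have /and4P[h1 h3 /eqP h4 /eqP h5] := hS s hs.
rewrite (rank_top2 (n := sn i)) // ltnNge leq_eqVlt; apply/negP => /orP[/eqP E2|].
  by move/eqP: hmd; apply; apply: (rel_rank_inj (s := s) hmn h3); rewrite E2.
rewrite ltnS leq_eqVlt ltnS /rel_rank ltn0 orbF -/(rel_rank _ _ _) => /eqP E2.
by move/eqP: hmb; apply; apply: (rel_rank_inj (s := s) hmn h1); rewrite h4.
Qed.

Definition stops (i : 'I_N) b d : bool :=
  (i == b) && (V (sn i) i.+1 b d <= rank_value N (sn i) 1) ||
  [&& (b < i)%N, i == d & V (sn i) i.+1 b d <= rank_value N (sn i) 2].

(** An admissible policy attaining the programme, so that the maximum in [continue_value] is
    reached. It chooses only at the first index, and rejects while fewer than two applicants have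
    been seen, when no state exists. *)
Definition dp_policy : policy N := [ffun i : 'I_N => [ffun s : 'S_N =>
  if [pick bd : 'I_N * 'I_N | top_state (sn i) s bd.1 bd.2] is Some bd
  then (if stops i bd.1 bd.2 then Some i else None) else None]].

Lemma dp_policyE (i : 'I_N) s b d : top_state (sn i) s b d ->
  dp_policy i s = if stops i b d then Some i else None.
Proof.
move=> h; rewrite !ffunE; case: pickP => [[b' d'] /= h'|/(_ (b, d))]; last by rewrite h.
by case: (top_state_uniq h h') => -> ->.
Qed.

Lemma dp_policy_admissible : admissible k dp_policy.
Proof.
apply/forallP => i; apply/forallP => s; apply/andP; split.
  rewrite !ffunE; case: pickP => // bd _; case: ifP => // _.
  by rewrite leqnn /seen /=; have := ltn_ord i; lia.
apply/forallP => u; apply/implyP => h; apply/eqP; rewrite !ffunE.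
by rewrite (eq_pick (fun bd => top_state_obs bd.1 bd.2 h)).
Qed.

Lemma lower_bound i : (i <= N)%N -> (2 <= sn i)%N ->
  forall E b d, obs_state (sn i) E b d ->
    V (sn i) i b d * #|E|%:R <= #|E :&: wins_from dp_policy i|%:R.
Proof.
move: i; apply: (@backward_ind N) => i hi IH h2 E b d hE.
case: (set_0Vmem E) => [->|[s0 hs0]]; first by rewrite set0I cards0 mulr0.
have [cE hS] := hE; have /and4P[hb hd hrb hrd] := hS s0 hs0.
have nN : (sn i <= N)%N by rewrite /seen; lia.
have hbd : (b : nat) != d.
  by apply/eqP => /val_inj E0; move: hrb hrd; rewrite E0 => /eqP ->.
case: (ltnP i N) => hiN; last first.
  rewrite (_ : V _ _ _ _ = 0) ?mul0r // /state_value.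
  have := ltn_ord b; have := ltn_ord d => h3 h4.
  rewrite [(i <= b)%N]leqNgt [(i <= d)%N]leqNgt (leq_trans h3 hiN) (leq_trans h4 hiN) /=.
  by case: (Hs) => H0 _ _; rewrite H0 ?addr0 ?mulr0 // /seen; lia.
pose I := Ordinal hiN.
have C : E :&: wins_from dp_policy i = E :&: wins_from dp_policy i.+1 ->
    V (sn i) i.+1 b d * #|E|%:R <= #|E :&: wins_from dp_policy i|%:R.
  move=> ->; have := @cont_bound (-1) i (wins_from dp_policy i.+1) h2 _ E b d hE.
  rewrite !mulN1r lerN2; apply=> E' b' d' hE'; rewrite !mulN1r lerN2.
  by apply: IH hE'; rewrite /seen in h2 *; lia.
case: (boolP (stops I b d)) => hst.
  rewrite (wins_stop (i := I) (m := I)) => [|s /hS h]; last by rewrite (dp_policyE (i := I) h) hst.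
  have hI : (I < sn i)%N by rewrite /seen /=; lia.
  case/orP: hst => [/andP[/eqP Eb hle]|/and3P[hbi /eqP Ed hle]].
    rewrite (rank_count nN h2 hI cE (r := 1)) // => [|s /hS /and4P[_ _ /eqP + _]]; last by rewrite Eb.
    have Ei : (b : nat) = i by rewrite -Eb.
    move: hle; rewrite Ei => hle; apply: ler_wpM2r => //.
    by rewrite (state_value_best t g hN d h2 (erefl (sn i))) ge_max lexx; exact: hle.
  rewrite (rank_count nN h2 hI cE (r := 2)) // => [|s /hS /and4P[_ _ _ /eqP]]; last by rewrite Ed.
  have Ei : (d : nat) = i by rewrite -Ed.
  move: hle; rewrite Ei => hle; apply: ler_wpM2r => //.
  by rewrite (state_value_second hN hk Hs h2 hbi (erefl (sn i))) ge_max lexx; exact: hle.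
have {}C := C (wins_pass (i := I) (E := E) _); apply: le_trans (C _); last first.
  by move=> s /hS h; rewrite (dp_policyE (i := I) h) (negbTE hst).
rewrite ler_wpM2r //; move: hst; rewrite /stops negb_or !negb_and.
case: (eqVneq (i : nat) b) => [Eb|hib].
  have EI : I = b by apply: val_inj.
  rewrite EI eqxx -Eb -ltNge /= => /andP[h _].
  by rewrite (state_value_best t g hN d h2 (erefl (sn i))) max_r // ltW.
case: (boolP ((b < i)%N && (i == d :> nat))) => [/andP[hbi /eqP Ed]|h]; last first.
  by move=> _; rewrite (state_value_same _ _ _ _ _ hib h).
have EI : I = d by apply: val_inj.
rewrite EI eqxx -Ed hbi /= => /andP[_ h]; rewrite -ltNge in h.
by rewrite (state_value_second hN hk Hs h2 hbi (erefl (sn i))) ge_max lexx andbT; exact: ltW h.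
Qed.
End Bounds.

(** * Symmetries and sample permutations *)

Section Counting.
Variable N : nat.
Implicit Types (s u : 'S_N) (b d i : 'I_N) (E X : {set 'S_N}) (n : nat).

Lemma card_uniq_part (T : finType) (Q : 'S_N -> T -> bool) E X :
  (forall s, s \in E -> exists y, Q s y) ->
  (forall s y z, Q s y -> Q s z -> y = z) ->
  #|E :&: X| = (\sum_y #|[set s in E | Q s y] :&: X|)%N.
Proof.
move=> ex un; rewrite -sum1_card.
transitivity (\sum_(s in E :&: X) \sum_(y | Q s y) 1)%N.
  apply: eq_bigr => s; rewrite inE => /andP[/ex [y0 h] _]; rewrite sum1_card.
  apply/esym/(@eq_card1 _ y0) => y; apply/idP/eqP => [hy|->]; [exact: un hy h | exact: h].
rewrite (exchange_big_dep xpredT) //=; apply: eq_bigr => y _.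
by rewrite -[RHS]sum1_card; apply: eq_bigl => s; rewrite !inE andbAC.
Qed.

Lemma rel_rank_perm (pi : 'S_N) s n m : (forall j : 'I_N, (pi j < n)%N = (j < n)%N) ->
  rel_rank (pi * s)%g n m = rel_rank s n (pi m).
Proof.
move=> h; rewrite /rel_rank; congr _.+1.
rewrite -[in RHS](card_preimset _ (@perm_inj _ pi)); apply: eq_card => j.
by rewrite !inE !permM h.
Qed.

(** Exchanging two positions shows that, given the best applicant, the second best is uniform over
    the other positions seen. *)
Lemma top_state_swap n i d d' : (i < n)%N -> (d < n)%N -> (d' < n)%N -> d != i -> d' != i ->
  #|[set s | top_state n s i d]| = #|[set s | top_state n s i d']|.
Proof.
move=> hi hd hd' hdi hdi'.
rewrite -(card_preimset _ (@mulgI _ (tperm d d'))).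
apply: eq_card => s; rewrite !inE /top_state hi hd hd' !rel_rank_perm.
- by rewrite tpermL tpermD.
by move=> j; case: tpermP => [->|->|//]; rewrite hd hd'.
by move=> j; case: tpermP => [->|->|//]; rewrite hd hd'.
Qed.

Lemma first_perm i : exists s : 'S_N, (s i : nat) = 0%N.
Proof.
have h : (0 < N)%N by have := ltn_ord i; lia.
by exists (tperm (Ordinal h) i); rewrite tpermR.
Qed.

Lemma second_perm i : (0 < i)%N -> exists s : 'S_N,
  (s i : nat) = 1%N /\ exists2 j : 'I_N, (j : nat) = 0%N & (s j : nat) = 0%N.
Proof.
move=> hi; have h : (1 < N)%N by have := ltn_ord i; lia.
exists (tperm (Ordinal h) i); rewrite tpermR; split=> //.
exists (Ordinal (ltnW h)); rewrite // tpermD //; apply/eqP => /(congr1 val) //=; lia.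
Qed.

Lemma rank1_le s n (m : 'I_N) : (s m : nat) = 0%N -> rel_rank s n m = 1%N.
Proof.
move=> h; rewrite /rel_rank (_ : [set _ | _] = set0) ?cards0 //.
by apply/setP => j; rewrite !inE h andbF.
Qed.

Lemma rank2_le s n (m j : 'I_N) : (j < n)%N -> (s j : nat) = 0%N -> (s m : nat) = 1%N ->
  rel_rank s n m = 2%N.
Proof.
move=> hj h0 h1; rewrite /rel_rank (_ : [set _ | _] = [set j]) ?cards1 //.
apply/setP => x; rewrite !inE h1; case: (eqVneq x j) => [->|hx]; first by rewrite hj h0.
rewrite ltnS leqn0 -h0; apply/negP => /andP[_ /eqP /val_inj /perm_inj E0].
by rewrite E0 eqxx in hx.
Qed.
End Counting.

(** * Choosing against continuing for a candidate at the first index *)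

Section Values.
Variables (N k : nat) (t g : nat -> rat).
Hypotheses (hN : (2 < N)%N) (hk : (0 < k)%N) (Hs : system N k t g).
Notation V := (state_value N k t g).
Notation sn := (seen N k).
Implicit Types (p : policy N) (E X : {set 'S_N}) (i b d : 'I_N).

(** The quantity [best_cont] in terms of the window start, valid also when the window is cut off at
    [N]. *)
Definition best_wait (i : nat) : rat :=
  ((sn i)%:R - 1) * t (sn i) + \sum_(i.+1 <= d < sn i) pospart (1 - t (d + k)%N).

Lemma seen_gt i : (i < sn i <= N)%N.
Proof. by rewrite /seen; have := ltn_ord i; lia. Qed.

Lemma second_closed i : obs_closed (sn i) [set s | candidate k 2 s i].
Proof.
have /andP[h1 h2] := seen_gt i.
move=> s u; rewrite !inE /= => /andP[/eqP h3 /existsP [j /andP[hj h4]]] h.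
rewrite -(same_obs_rank h) // h3 eqxx /=; apply/existsP; exists j; rewrite hj /=.
by rewrite -(same_obs_rank h) //; exact: ltn_trans h1.
Qed.

Lemma second_state i s : candidate k 2 s i -> exists2 b : 'I_N, (b < i)%N & top_state (sn i) s b i.
Proof.
have /andP[h1 h2] := seen_gt i.
move=> /andP[h3 /existsP [j /andP[hj h4]]]; exists j => //.
by rewrite /top_state h3 h4 h1 (ltn_trans hj h1).
Qed.

(** After rejection both leaders are lost, so the value does not depend on where the best one was.
    [E] may be smaller than the set of all 2-candidates, since earlier stops will have to be
    excluded. *)
Lemma second_reject_bound (c : rat) i X E : (2 <= sn i)%N -> obs_closed (sn i) E ->
  (forall s, s \in E -> candidate k 2 s i) ->
  (forall E b d, obs_state (sn i) E b d ->
     c * #|E :&: X|%:R <= c * (V (sn i) i.+1 b d * #|E|%:R)) ->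
  c * #|E :&: X|%:R <= c * (rank_value N (sn i) 2 * t (sn i) * #|E|%:R).
Proof.
move=> h2 cE hE H.
have Q := @card_uniq_part N 'I_N (fun s (b : 'I_N) => (b < i)%N && top_state (sn i) s b i) E.
have {}Q Y : #|E :&: Y| = (\sum_(b : 'I_N) #|[set s in E | (b < i)%N && top_state (sn i) s b i] :&: Y|)%N.
  apply: Q => [s /hE /second_state [b h h']|s b b' /andP[_ h] /andP[_ h']].
    by exists b; rewrite h.
  by have [] := top_state_uniq h h'.
have QT := Q [set: 'S_N]; rewrite setIT in QT; rewrite Q QT !natr_sum !mulr_sumr.
apply: ler_sum => b _; rewrite setIT.
case: (boolP (b < i)%N) => hb; last first.
  rewrite (_ : [set s in E | _] = set0) ?set0I ?cards0 ?mulr0 //.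
  by apply/setP => s; rewrite !inE andbF.
apply: le_trans (H _ b i _) _.
  split=> [|s]; last by rewrite inE => /andP[].
  move=> s u; rewrite !inE /= => /andP[h h'] hu.
  by rewrite (cE s) // -(top_state_obs _ _ hu).
by rewrite /state_value !ltnNge (ltnW hb) leqnn /= addr0 /rank_value.
Qed.

Lemma sum_others (F : nat -> rat) i n : (i < n <= N)%N ->
  \sum_(d : 'I_N | (d < n)%N && (d != i)) F d = \sum_(0 <= d < n) F d - F i.
Proof.
move=> /andP[hi hn].
have -> : \sum_(0 <= d < n) F d = \sum_(d : 'I_N | (d < n)%N) F d.
  by rewrite big_mkord (big_ord_widen _ _ hn).
by rewrite [in RHS](bigD1 i) //= [RHS]addrAC subrr add0r.
Qed.

(** The state values are averaged over the uniform position of the second best; only positions after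
    [i] still carry an option. *)
Lemma best_reject_bound (c : rat) i X : (2 <= sn i)%N ->
  (forall E b d, obs_state (sn i) E b d ->
     c * #|E :&: X|%:R <= c * (V (sn i) i.+1 b d * #|E|%:R)) ->
  c * #|[set s | candidate k 1 s i] :&: X|%:R <=
  c * ((sn i)%:R / pair_count N * best_wait i * #|[set s | candidate k 1 s i]|%:R).
Proof.
move=> h2 H; set E := [set s | candidate k 1 s i]; have hi := seen_gt i; have [hi1 hi2] := andP hi.
set n := sn i in h2 H hi hi1 hi2 *.
pose A d := [set s in E | top_state n s i d].
have Q Y : #|E :&: Y| = (\sum_d #|A d :&: Y|)%N.
  apply: (card_uniq_part (Q := fun s d => top_state n s i d)) => [s|s b b' h h']; last first.
    by have [] := top_state_uniq h h'.
  rewrite inE /= => /eqP h; have [d _ h'] := top_state_ex (n := n) (s := s) ltac:(lia) hi1 h.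
  by exists d.
have hA d : A d = [set s | top_state n s i d].
  apply/setP => s; rewrite !inE /=; case: (boolP (top_state n s i d)); rewrite ?andbF ?andbT //.
  by case/and4P.
have [d0 [hd0 hdi0]] : exists d0 : 'I_N, (d0 < n)%N /\ d0 != i.
  case: (eqVneq (i : nat) 0%N) => hi0.
    have h : (1 < N)%N by lia.
    by exists (Ordinal h); rewrite -(inj_eq val_inj) /= hi0.
  have h : (0 < N)%N by lia.
  by exists (Ordinal h); rewrite -(inj_eq val_inj) /= eq_sym; split=> //; lia.
have cA d : #|A d| = (if (d < n)%N && (d != i) then #|A d0| else 0)%N.
  case: ifP => [/andP[h1 h3]|h]; first by rewrite !hA; apply: top_state_swap.
  apply/eqP; rewrite cards_eq0; apply/eqP/setP => s; rewrite hA !inE.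
  apply/negP => /and4P[_ h3 /eqP h4 /eqP h5]; move: h; rewrite h3 /=.
  by move/negbFE/eqP => E0; rewrite E0 h4 in h5.
have sumA (F : nat -> rat) : \sum_(d : 'I_N) F d * #|A d|%:R =
    #|A d0|%:R * \sum_(d : 'I_N | (d < n)%N && (d != i)) F d.
  rewrite mulr_sumr [RHS]big_mkcond; apply: eq_bigr => d _; rewrite cA.
  by case: ifP => _; rewrite ?mulr0 // mulrC.
have cE : #|E|%:R = #|A d0|%:R * (n%:R - 1) :> rat.
  have := Q [set: 'S_N]; rewrite setIT => ->; rewrite natr_sum.
  under eq_bigr => d _ do rewrite setIT -[_%:R]mul1r.
  rewrite (sumA (fun=> 1)) (sum_others (fun=> 1) hi) sum_ones //; lra.
have -> : n%:R / pair_count N * best_wait i * #|E|%:R = \sum_(d : 'I_N) V n i.+1 i d * #|A d|%:R.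
  pose G (d : nat) := if (i < d)%N then pospart (1 - t (d + k)%N) else 0.
  have VE (d : nat) : V n i.+1 i d = n%:R * (n%:R - 1) / pair_count N * (t n + G d).
    by rewrite /state_value ltnn.
  rewrite (sumA (V n i.+1 i)); under eq_bigr => d _ do rewrite VE.
  rewrite -mulr_sumr (sum_others (fun d : nat => t n + G d) hi) big_split /= sum_const // subr0.
  have -> : \sum_(0 <= d < n) G d = \sum_(i.+1 <= d < n) pospart (1 - t (d + k)%N).
    rewrite (big_cat_nat (n := i.+1)) //= big1_seq ?add0r.
      by apply: eq_big_nat => d hd; rewrite /G; case: ifP => //; lia.
    by move=> d; rewrite mem_index_iota /G => /andP[_ hd]; case: ifP => //; lia.
  by rewrite /G ltnn cE /best_wait -/n; ring.
rewrite Q natr_sum !mulr_sumr; apply: ler_sum => d _.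
apply: H; split; last by move=> s; rewrite hA inE.
by move=> s u; rewrite hA !inE => h hu; rewrite -(top_state_obs _ _ hu).
Qed.

Lemma seenS_ge2 i : (2 <= sn i)%N -> (2 <= sn i.+1)%N.
Proof. by rewrite /seen; lia. Qed.

Lemma reject_le p i : admissible k p -> (2 <= sn i)%N -> forall E b d, obs_state (sn i) E b d ->
  1 * #|E :&: wins_from p i.+1|%:R <= 1 * (V (sn i) i.+1 b d * #|E|%:R) :> rat.
Proof.
move=> hp h2; apply: (cont_bound hN hk Hs) => // E b d hE; rewrite !mul1r.
by apply: (upper_bound hN hk Hs hp) => //; exact: seenS_ge2.
Qed.

Lemma reject_ge i : (2 <= sn i)%N -> forall E b d, obs_state (sn i) E b d ->
  -1 * #|E :&: wins_from (dp_policy N k t g) i.+1|%:R <= -1 * (V (sn i) i.+1 b d * #|E|%:R) :> rat.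
Proof.
move=> h2; apply: (cont_bound hN hk Hs) => // E b d hE; rewrite !mulN1r lerN2.
by apply: (lower_bound hN hk Hs) => //; exact: seenS_ge2.
Qed.

Lemma cont_value_eq l i v : [set s | candidate k l s i] != set0 -> 0 <= v ->
  let E := [set s | candidate k l s i] in
  (forall p, admissible k p -> #|E :&: wins_from p i.+1|%:R <= v * #|E|%:R) ->
  v * #|E|%:R <= #|E :&: wins_from (dp_policy N k t g) i.+1|%:R ->
  continue_value k l i = v.
Proof.
move=> E0 v0 E hle hge.
have c0 : 0 < #|E|%:R :> rat by rewrite ltr0n card_gt0.
apply/eqP; rewrite eq_le; apply/andP; split.
  apply: bigmax_le => // p hp; rewrite /cprob ler_pdivrMr // setIC; exact: hle.
apply: (bigmax_sup (dp_policy N k t g)); first exact: dp_policy_admissible.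
by rewrite /cprob ler_pdivlMr // setIC.
Qed.

Lemma choose_value_eq l i : (2 <= sn i)%N -> (l <= 2)%N -> [set s | candidate k l s i] != set0 ->
  obs_closed (sn i) [set s | candidate k l s i] ->
  (forall s, candidate k l s i -> rel_rank s (sn i) i = l) ->
  choose_value k l i = rank_value N (sn i) l.
Proof.
move=> h2 hl E0 cE hr; have /andP[h1 h3] := seen_gt i.
rewrite /choose_value /cprob setIC (rank_count h3 h2 h1 cE (r := l)) //.
  by rewrite mulfK // pnatr_eq0 cards_eq0.
by move=> s; rewrite inE; exact: hr.
Qed.

Lemma second_candidate_ex i : (0 < i)%N -> [set s | candidate k 2 s i] != set0.
Proof.
move=> hi; have [s [h1 [j hj h2]]] := second_perm hi; have /andP[h3 h4] := seen_gt i.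
apply/set0Pn; exists s; rewrite inE /= (rank2_le (j := j)) ?eqxx //; last by lia.
by apply/existsP; exists j; rewrite hj hi rank1_le.
Qed.

Lemma best_candidate_ex i : [set s | candidate k 1 s i] != set0.
Proof.
have [s h] := first_perm i; apply/set0Pn; exists s.
by rewrite inE /= rank1_le.
Qed.

Lemma best_closed i : obs_closed (sn i) [set s | candidate k 1 s i].
Proof.
have /andP[h1 h2] := seen_gt i.
by move=> s u; rewrite !inE /= => /eqP <- h; rewrite (same_obs_rank h).
Qed.

Lemma seen_pos i : (0 < i)%N -> (2 <= sn i)%N.
Proof. by have /andP[h1 h2] := seen_gt i; lia. Qed.

Lemma second_worth i : (0 < i)%N ->
  (continue_value k 2 i < choose_value k 2 i) = (t (sn i) < 1).
Proof.
move=> hi; have h2 := seen_pos hi; have R := natR_le h2.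
have M0 := pair_count_gt0 hN.
have c0 : 0 < rank_value N (sn i) 2 by rewrite /= divr_gt0 // mulr_gt0; lra.
rewrite (choose_value_eq h2 _ (second_candidate_ex hi)) //; first last.
- by move=> s /andP[/eqP].
- exact: second_closed.
rewrite (cont_value_eq (v := rank_value N (sn i) 2 * t (sn i)) (second_candidate_ex hi)).
- by rewrite gtr_pMr.
- by apply: mulr_ge0; [exact: ltW | exact: (t_ge0 hN hk Hs)].
- move=> p hp; have := second_reject_bound h2 (@second_closed i) _ (reject_le hp h2).
  by rewrite !mul1r; apply=> s; rewrite inE.
have := second_reject_bound h2 (@second_closed i) _ (reject_ge h2).
by rewrite !mulN1r lerN2; apply=> s; rewrite inE.
Qed.

Lemma best_worth i : (2 <= sn i)%N ->
  (continue_value k 1 i < choose_value k 1 i) = (best_wait i < 2 * N%:R - (sn i)%:R - 1).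
Proof.
move=> h2; have R := natR_le h2; have M0 := pair_count_gt0 hN.
have c0 : 0 < (sn i)%:R / pair_count N by rewrite divr_gt0 //; lra.
rewrite (choose_value_eq h2 _ (best_candidate_ex i)) //; first last.
- by move=> s /eqP.
- exact: best_closed.
rewrite (cont_value_eq (v := (sn i)%:R / pair_count N * best_wait i) (best_candidate_ex i)).
- by rewrite /= [X in _ < X]mulrAC ltr_pM2l.
- apply: mulr_ge0; [exact: ltW | apply: addr_ge0].
    by apply: mulr_ge0; [lra | exact: (t_ge0 hN hk Hs)].
  by apply: sumr_ge0 => d _; apply: pospart_ge0.
- by move=> p hp; have := best_reject_bound h2 (reject_le hp h2); rewrite !mul1r.
by have := best_reject_bound h2 (reject_ge h2); rewrite !mulN1r lerN2.
Qed.

Lemma best_waitE i : (i + k < N)%N -> best_wait i = best_cont k t (i + k).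
Proof.
move=> h; rewrite /best_wait /best_cont (_ : sn i = (i + k)%N); last by rewrite /seen; lia.
by congr (_ + _); rewrite -addSn big_addn addnK.
Qed.

Lemma best_wait_end i : (N <= i + k)%N -> best_wait i = N%:R - i%:R - 1.
Proof.
move=> h; rewrite /best_wait (_ : sn i = N); last by rewrite /seen; lia.
case: (Hs) => H0 _ _; rewrite H0 // mulr0 add0r.
rewrite (eq_big_nat _ _ (F2 := fun=> 1)) => [|d hd].
  by rewrite sum_ones // -natr1; lra.
by rewrite H0 ?subr0 //; lia.
Qed.
End Values.

(** * Monotonicity in the window size and in the index *)

Definition worth (N k l : nat) (i : 'I_N) : bool := continue_value k l i < choose_value k l i.

Section Worth.
Variables (N k : nat).
Hypotheses (hk : (0 < k)%N) (hkN : (k.+1 < N)%N).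
Implicit Types i j : 'I_N.

Let hN : (2 < N)%N. Proof. lia. Qed.

Lemma worth_best_end k' i : (0 < k')%N -> (0 < i)%N -> (N <= i + k')%N -> worth k' 1 i.
Proof.
move=> hk' hi hik; have [t [g Hs]] := system_exists N hk'.
rewrite /worth (best_worth hN hk' Hs); last exact: seen_pos.
rewrite (best_wait_end hN hk' Hs hik) seenN //.
by have := natR_le hi; lra.
Qed.

(** Only one applicant is seen, so there is no second best and the programme does not apply. Waiting
    for the last applicant wins equally often, which rules out a strict preference. *)
Lemma worth_first i : k = 1%N -> (i : nat) = 0%N -> ~~ worth k 1 i.
Proof.
move=> k1 i0; rewrite /worth -leNgt k1.
have hl : (N.-1 < N)%N by lia.
pose last := Ordinal hl.
pose q : policy N := [ffun j : 'I_N => [ffun s : 'S_N => if j == last then Some last else None]].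
have hq : admissible 1 q.
  apply/forallP => j; apply/forallP => s; apply/andP; split.
    by rewrite !ffunE; case: eqP => // ->; rewrite /seen /=; lia.
  by apply/forallP => u; apply/implyP => _; rewrite !ffunE.
apply: (bigmax_sup q) => //.
have ET : [set s | candidate 1 1 s i] = [set: 'S_N].
  apply/setP => s; rewrite !inE /= /rel_rank (_ : [set _ | _] = set0) ?cards0 //.
  apply/setP => j; rewrite !inE; apply/negP => /andP[]; rewrite /seen i0 => h1.
  by have -> : j = i by [apply: val_inj => /=; lia]; rewrite ltnn.
rewrite /choose_value /cprob ET ler_pM2r ?invr_gt0 ?ltr0n; last first.
  by rewrite card_gt0; apply/set0Pn; exists 1%g; rewrite inE.
rewrite ler_nat !setIT.
have -> : wins_from q i.+1 = [set s | top2 s last].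
  apply/setP => s; rewrite !inE; suff -> : chosen q s i.+1 = Some last by [].
  have -> : i.+1 = 1%N by rewrite i0.
  have : forall a, (a <= N)%N -> (a < N)%N -> chosen q s a = Some last.
    apply: (@backward_ind N) => a _ IH ha.
    rewrite (chosen_step _ _ (Ordinal ha)) !ffunE; case: eqP => // hne.
    have hne' : a <> N.-1 by move=> E; apply: hne; apply: val_inj.
    by apply: IH => /=; lia.
  by apply; lia.
rewrite -(card_preimset _ (@mulgI _ (tperm last i))).
by apply: subset_leq_card; apply/subsetP => s; rewrite !inE /top2 permM tpermR.
Qed.

Variables (t g t' g' : nat -> rat).
Hypotheses (Hs : system N k t g) (Hs' : system N k.+1 t' g').

Lemma worth_best_next i : worth k 1 i -> worth k.+1 1 i.
Proof.
have hi := ltn_ord i.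
case: (ltnP (seen N k i) 2) => h2.
  have [k1 i0] : k = 1%N /\ (i : nat) = 0%N by move: h2; rewrite /seen; lia.
  by rewrite (negbTE (worth_first k1 i0)).
case: (leqP N (i + k.+1)%N) => h3.
  move=> hw; apply: worth_best_end => //; rewrite lt0n; apply/eqP => i0; lia.
rewrite /worth (best_worth hN hk Hs) // (best_worth hN (ltn0Sn k) Hs'); last by rewrite /seen; lia.
rewrite !best_waitE; try lia.
rewrite !seenE; try lia.
by rewrite addnS; apply: (best_next hN hk Hs Hs'); move: h2; rewrite /seen; lia.
Qed.

Lemma worth_second_next i : (0 < i)%N -> worth k 2 i -> worth k.+1 2 i.
Proof.
move=> hi; rewrite /worth (second_worth hN hk Hs) // (second_worth hN (ltn0Sn k) Hs') //.
case: (leqP N (i + k)%N) => h3.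
  by move=> _; rewrite seenN; [case: (Hs') => H0 _ _; rewrite H0 | lia].
rewrite !seenE; try lia.
by rewrite addnS; apply: (second_next hN hk Hs Hs'); lia.
Qed.

Lemma worth_second_best i : (0 < i)%N -> worth k 2 i -> worth k 1 i.
Proof.
move=> hi; case: (leqP N (i + k)%N) => h3; first by move=> _; exact: worth_best_end.
rewrite /worth (second_worth hN hk Hs) // (best_worth hN hk Hs); last exact: seen_pos.
rewrite best_waitE // seenE; last exact: ltnW.
by apply: (second_imp_best hN hk Hs Hs'); lia.
Qed.

Lemma worth_best_mono i j : (i <= j)%N -> worth k.+1 1 i -> worth k.+1 1 j.
Proof.
move=> hij; case: (eqVneq i j) => [->//|hne].
have {hne}hij : (i < j)%N by rewrite ltn_neqAle hij andbT.
case: (leqP N (j + k.+1)%N) => h3; first by move=> _; apply: worth_best_end => //; lia.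
rewrite /worth !(best_worth hN (ltn0Sn k) Hs'); try by rewrite /seen; lia.
rewrite !best_waitE; try lia.
rewrite !seenE; try lia.
by apply: (best_cont_mono hN (ltn0Sn k) Hs'); lia.
Qed.

Lemma worth_second_mono i j : (0 < i)%N -> (i <= j)%N -> worth k.+1 2 i -> worth k.+1 2 j.
Proof.
move=> hi hij; rewrite /worth !(second_worth hN (ltn0Sn k) Hs'); try lia.
apply: le_lt_trans; apply: (t_mono hN (ltn0Sn k) Hs').
  exact: seen_pos.
by rewrite /seen; lia.
Qed.

Lemma worth_second_end i : (0 < i)%N -> (N <= i + k.+1)%N -> worth k.+1 2 i.
Proof.
move=> hi h; rewrite /worth (second_worth hN (ltn0Sn k) Hs') // seenN //.
by case: (Hs') => H0 _ _; rewrite H0.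
Qed.
End Worth.

(** * Optimal thresholds as least indices *)

Section Threshold.
Variables (N : nat).
Implicit Types i j : 'I_N.

Lemma opt_threshold_min k l i : ((l == 2) ==> (0 < i))%N -> worth k l i -> (opt_threshold N k l <= i)%N.
Proof.
move=> h1 h2; rewrite leqNgt; apply/negP => h.
by have := before_find i h; rewrite nth_ord_enum -/(worth k l i) h1 h2.
Qed.

Lemma opt_threshold_worth k l (h : (opt_threshold N k l < N)%N) :
  ((l == 2) ==> (0 < Ordinal h))%N && worth k l (Ordinal h).
Proof.
have h' : has (fun i : 'I_N => ((l == 2%N) ==> (0 < i)%N) && worth k l i) (enum 'I_N).
  by rewrite has_find size_enum_ord.
have := nth_find (Ordinal h) h'.
by rewrite (_ : nth _ _ _ = Ordinal h) //; exact: (nth_ord_enum (Ordinal h) (Ordinal h)).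
Qed.

Lemma opt_threshold_size k l : (opt_threshold N k l <= N)%N.
Proof. by rewrite -[leqRHS](size_enum_ord N) find_size. Qed.

Lemma opt_threshold_sub k k' l l' :
  (forall i, ((l == 2) ==> (0 < i))%N -> worth k l i -> ((l' == 2) ==> (0 < i))%N && worth k' l' i) ->
  (opt_threshold N k' l' <= opt_threshold N k l)%N.
Proof. by move=> h; apply: sub_find => i /andP[h1 h2]; exact: h. Qed.
End Threshold.

(** * Threshold strategies *)

Section ChosenMore.
Variable N : nat.
Implicit Types (p : policy N) (s : 'S_N) (i j : 'I_N).

Lemma chosen_skip p s a b : (a <= b <= N)%N ->
  (forall j : 'I_N, (a <= j < b)%N -> p j s = None) -> chosen p s a = chosen p s b.
Proof.
move=> /andP[hab hb] h; have : (a <= N)%N by lia.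
move: a hab h; suff : forall a, (a <= N)%N -> (a <= b)%N ->
    (forall j : 'I_N, (a <= j < b)%N -> p j s = None) -> chosen p s a = chosen p s b.
  by move=> H a h1 h2 h3; exact: H.
apply: (@backward_ind N) => a ha IH hab h.
case: (eqVneq a b) => [->//|hne]; have hab' : (a < b)%N by rewrite ltn_neqAle hne.
have haN : (a < N)%N by lia.
rewrite (chosen_step _ _ (Ordinal haN)) h /=; last by lia.
by apply: IH; [lia | lia | move=> j hj; apply: h; lia].
Qed.

Lemma chosen_ext p p' s a :
  (forall j : 'I_N, (a <= j)%N -> p j s = p' j s) -> chosen p s a = chosen p' s a.
Proof.
move=> h; case: (leqP a N) => haN; last by rewrite !chosen_end // ltnW.
move: a haN h; apply: (@backward_ind N) => a ha IH h.
case: (leqP N a) => haN; first by rewrite !chosen_end.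
rewrite !(chosen_step _ _ (Ordinal haN)) h //=; case: (p' _ s) => //.
by apply: IH => /= [|j hj]; [lia | apply: h; lia].
Qed.

Lemma chosen_cut p p' s (i : 'I_N) a : (a <= N)%N ->
  (forall j : 'I_N, (a <= j < i)%N -> p j s = p' j s) ->
  (exists2 j : 'I_N, (a <= j < i)%N & p' j s != None) -> chosen p s a = chosen p' s a.
Proof.
move: a; apply: (@backward_ind N) => a ha IH h [j hj hj'].
have haN : (a < N)%N by have := ltn_ord j; lia.
rewrite !(chosen_step _ _ (Ordinal haN)) h /=; last by lia.
case E : (p' _ s) => [//|].
apply: IH; [lia | by move=> x hx; apply: h; lia |].
exists j => //; rewrite (_ : (a < j)%N) /=; first by lia.
rewrite ltn_neqAle; apply/andP; split; last by lia.
apply/eqP => Ej; move: hj'; rewrite (_ : j = Ordinal haN) ?E //.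
exact: val_inj.
Qed.

Lemma chosen_first p s (a : nat) m : (a <= N)%N -> chosen p s a = Some m ->
  exists i : 'I_N, [/\ (a <= i)%N, p i s = Some m & forall j : 'I_N, (a <= j < i)%N -> p j s = None].
Proof.
move: a; apply: (@backward_ind N) => a ha IH.
case: (leqP N a) => haN; first by rewrite chosen_end.
rewrite (chosen_step _ _ (Ordinal haN)); case E : (p _ s) => [m'|].
  move=> [<-]; exists (Ordinal haN); split=> //= j hj; lia.
move=> /IH [|i [h1 h2 h3]]; first by rewrite /=; lia.
exists i; split=> //; first by move: h1 => /=; lia.
move=> j hj; case: (eqVneq (j : nat) a) => Ej.
  by rewrite (_ : j = Ordinal haN) //; exact: val_inj.
by apply: h3 => /=; lia.
Qed.

Definition stops_at k d1 d2 s i : bool :=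
  (d1 <= i)%N && candidate k 1 s i || (d2 <= i)%N && candidate k 2 s i.

Notation thr := (@threshold_policy N).

Lemma threshold_policyE k d1 d2 i s : thr k d1 d2 i s = if stops_at k d1 d2 s i then Some i else None.
Proof. by rewrite !ffunE. Qed.

Lemma threshold_wins k d1 d2 s i : stops_at k d1 d2 s i ->
  (forall j, (j < i)%N -> ~~ stops_at k d1 d2 s j) ->
  (s \in wins_from (thr k d1 d2) 0) = top2 s i.
Proof.
move=> hi hj; rewrite inE (chosen_skip (b := i)); last 2 first.
- by rewrite /= ltnW.
- by move=> j /= hj'; rewrite threshold_policyE (negbTE (hj j hj')).
by rewrite chosen_step threshold_policyE hi.
Qed.

Lemma threshold_wins_ex k d1 d2 s : s \in wins_from (thr k d1 d2) 0 ->
  exists i, [/\ stops_at k d1 d2 s i, forall j, (j < i)%N -> ~~ stops_at k d1 d2 s j & top2 s i].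
Proof.
rewrite inE; case E : (chosen _ s 0) => [m|//] hm.
have [i [_ h1 h2]] := chosen_first (leq0n N) E.
move: h1; rewrite threshold_policyE; case: ifP => // hi [Em]; exists i; split=> //; last by rewrite Em.
by move=> j hj; have := h2 j hj; rewrite threshold_policyE; case: ifP.
Qed.

Lemma candidate_obs k l i s u : (l <= 2)%N -> same_obs (seen N k i) s u -> (0 < k)%N ->
  candidate k l s i = candidate k l u i.
Proof.
move=> hl h hk; have h1 : (i < seen N k i)%N by rewrite /seen; have := ltn_ord i; lia.
case: l hl => [//|[|[|//]]] _ /=; rewrite (same_obs_rank h) //.
congr (_ && _); apply: eq_existsb => j; case: (boolP (j < i)%N) => //= hj.
by rewrite (same_obs_rank h) //; exact: ltn_trans h1.
Qed.

Lemma threshold_admissible k d1 d2 : (0 < k)%N -> admissible k (thr k d1 d2).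
Proof.
move=> hk; apply/forallP => i; apply/forallP => s; apply/andP; split.
  rewrite threshold_policyE; case: ifP => // _; rewrite leqnn /seen /=; have := ltn_ord i; lia.
apply/forallP => u; apply/implyP => h; apply/eqP.
by rewrite !threshold_policyE /stops_at (candidate_obs (l := 1) _ h hk) ?(candidate_obs (l := 2) _ h hk).
Qed.

Lemma best_position s : (0 < N)%N -> exists z : 'I_N, (s z : nat) = 0%N.
Proof. by move=> h; exists ((s^-1)%g (Ordinal h)); rewrite permKV. Qed.

Lemma zero_uniq s i z : (s z : nat) = 0%N -> i != z -> (s z < s i)%N.
Proof.
move=> hz hiz; rewrite hz lt0n -hz; apply: contra hiz => /eqP /val_inj /perm_inj ->.
exact: eqxx.
Qed.

(** With the overall best further on in the window, [j] is not best, and nobody before [j] is the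
    best seen, as a 2-candidate would require. *)
Lemma no_candidate k l s z j : (s z : nat) = 0%N -> (j < z < seen N k j)%N -> ~~ candidate k l s j.
Proof.
move=> hz /andP[h1 h2].
have R i : (i < z)%N -> (1 < rel_rank s (seen N k j) i)%N.
  move=> hi; have hlt : (s z < s i)%N.
    by apply: zero_uniq => //; apply/eqP => E; rewrite E ltnn in hi.
  exact: (leq_ltn_trans _ (rel_rank_lt h2 hlt)).
case: l => [//|[|[|//]]] /=; first by have := R j h1; lia.
apply/negP => /andP[_ /existsP [b /andP[hb]]].
by have := R b (ltn_trans hb h1); lia.
Qed.

Lemma no_stop k d1 d2 s z j : (s z : nat) = 0%N -> (j < z < seen N k j)%N ->
  ~~ stops_at k d1 d2 s j.
Proof.
move=> hz hj; rewrite /stops_at.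
by rewrite (negbTE (@no_candidate k 1 s z j hz hj)) (negbTE (@no_candidate k 2 s z j hz hj)) !andbF.
Qed.

Lemma rel_rank_seen s n n' i : (n <= n')%N -> (rel_rank s n i <= rel_rank s n' i)%N.
Proof.
move=> h; rewrite ltnS; apply: subset_leq_card; apply/subsetP => j; rewrite !inE.
by case/andP => h1 ->; rewrite (leq_trans h1 h).
Qed.

Lemma candidate_shrink k l s i : (0 < k)%N -> candidate k.+1 l s i -> candidate k l s i.
Proof.
move=> hk; have hn : (seen N k i <= seen N k.+1 i)%N by rewrite /seen; lia.
have hi : (i < seen N k i)%N by rewrite /seen; have := ltn_ord i; lia.
case: l => [//|[|[|//]]] /=.
  by have := rel_rank_seen s i hn => h1 /eqP h2; rewrite h2 in h1; rewrite eqn_leq h1.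
move=> /andP[/eqP h2 /existsP [b /andP[hb /eqP h1]]].
have h3 := rel_rank_seen s b hn; have h4 := rel_rank_seen s i hn; rewrite h1 h2 in h3 h4.
have hbi : (b < seen N k i)%N by lia.
have hlt : (s b < s i)%N.
  have hne : b != i by apply/eqP => E; rewrite E ltnn in hb.
  have /orP[//|hc] := perm_val_neq s hne.
  by have := rel_rank_le (seen N k.+1 i) hc; rewrite h1 h2.
have h5 := rel_rank_lt hbi hlt.
apply/andP; split; first by rewrite eqn_leq h4 (leq_ltn_trans _ h5).
by apply/existsP; exists b; rewrite hb eqn_leq h3.
Qed.

Lemma stops_shrink k d1 d2 s i : (0 < k)%N -> stops_at k.+1 d1 d2 s i -> stops_at k d1 d2 s i.
Proof.
by move=> hk /orP[] /andP[h1 /(candidate_shrink hk) h2]; rewrite /stops_at h1 h2 ?orbT.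
Qed.

Lemma wider_window_wins k d1 d2 : (0 < k)%N ->
  wins_from (thr k d1 d2) 0 \subset wins_from (thr k.+1 d1 d2) 0.
Proof.
move=> hk; apply/subsetP => s /threshold_wins_ex [i [hi hj ht]].
have hj' j : (j < i)%N -> ~~ stops_at k.+1 d1 d2 s j.
  by move=> h; apply: contra (hj j h); exact: stops_shrink.
suff [z [h1 h2 h3]] : exists z, [/\ stops_at k.+1 d1 d2 s z,
    forall j, (j < z)%N -> ~~ stops_at k.+1 d1 d2 s j & top2 s z].
  by rewrite (threshold_wins h1 h2).
have hN : (0 < N)%N by have := ltn_ord i; lia.
have [z hz] := best_position s hN.
have hseen : (i < seen N k i)%N by rewrite /seen; have := ltn_ord i; lia.
have T0 : top2 s z by rewrite /top2 hz.
case: (eqVneq i z) => [Ei|hiz].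
  exists i; split=> //; move: hi; rewrite Ei; case/orP => /andP[h1 h2].
    by rewrite /stops_at h1 /= rank1_le.
  by move: h2 => /= /andP[]; rewrite rank1_le.
have hlt := zero_uniq hz hiz.
have s1 : (s i : nat) = 1%N by move: ht; rewrite /top2 => h; lia.
case/orP: hi => /andP[hd hc].
  have hzi : (i + k <= z)%N.
    rewrite leqNgt; apply/negP => h.
    have h' : (z < seen N k i)%N by rewrite /seen; have := ltn_ord z; lia.
    by move/eqP: hc; have := rel_rank_lt h' hlt; rewrite /rel_rank; lia.
  case: (ltnP z (seen N k.+1 i)) => hzK; last first.
    exists i; split=> //; rewrite /stops_at hd /= /rel_rank (_ : [set _ | _] = set0) ?cards0 //.
    apply/setP => j; rewrite !inE s1; apply/negP => /andP[h1 h2].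
    have Ej : j = z by apply: (@perm_inj _ s); apply: val_inj => /=; lia.
    by rewrite Ej in h1; lia.
  exists z; split=> //; first by rewrite /stops_at /= rank1_le // eqxx andbT (leq_trans hd) //; lia.
  move=> j hjz; case: (ltnP j i) => hji; first exact: hj'.
  have hw : (j < z < seen N k.+1 j)%N by rewrite hjz; move: hzK; rewrite /seen; lia.
  exact: (no_stop _ _ hz hw).
(* A winning 2-candidate other than the overall best has absolute rank 2, so the best seen is the
   overall best, at an index before [i]; the wider window sees the same. *)
move: hc => /= /andP[/eqP h2 /existsP [b /andP[hb /eqP h1]]].
have hzs : (z < seen N k i)%N.
  rewrite ltnNge; apply/negP => h; move: h2; rewrite /rel_rank (_ : [set _ | _] = set0) ?cards0 //.
  apply/setP => j; rewrite !inE s1; apply/negP => /andP[h3 h4].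
  have Ej : j = z by apply: (@perm_inj _ s); apply: val_inj => /=; lia.
  by rewrite Ej in h3; lia.
have Eb : b = z.
  apply/eqP; apply: contraT => hbz; have := rel_rank_lt hzs (zero_uniq hz hbz).
  by rewrite h1.
have hzK : (z < seen N k.+1 i)%N by move: hzs; rewrite /seen; lia.
exists i; split=> //; rewrite /stops_at hd /= (rank2_le hzK hz s1) eqxx /= orbC; apply/orP; left.
by apply/existsP; exists z; rewrite -{1}Eb hb rank1_le.
Qed.

Lemma perm_values (x0 x1 x2 : 'I_N) : x0 != x1 -> x0 != x2 -> x1 != x2 -> exists s : 'S_N,
  [/\ (s x0 : nat) = 0%N, (s x1 : nat) = 1%N & (s x2 : nat) = 2%N].
Proof.
move=> h01 h02 h12.
have h : (2 < N)%N.
  rewrite ltnNge; apply/negP => h; have := max_card [set x0; x1; x2].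
  by rewrite card_ord setUC cardsU1 cards2 !inE negb_or h01 ![x2 == _]eq_sym h02 h12 /=; lia.
have h1 : (1 < N)%N by lia.
have h0 : (0 < N)%N by lia.
pose o0 := Ordinal h0; pose o1 := Ordinal h1; pose o2 := Ordinal h.
pose s0 := tperm x0 o0; pose s1 := (s0 * tperm (s0 x1) o1)%g.
pose s2 := (s1 * tperm (s1 x2) o2)%g.
have E0 : s0 x0 = o0 by rewrite tpermL.
have E10 : s1 x0 = o0.
  by rewrite permM tpermD ?E0 // -E0 (inj_eq perm_inj) eq_sym.
have E11 : s1 x1 = o1 by rewrite permM tpermL.
have P j : s2 j = tperm (s1 x2) o2 (s1 j) by rewrite permM.
exists s2; rewrite !P tpermL E10 E11 !tpermD //.
- by rewrite -E11 (inj_eq perm_inj) eq_sym.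
by rewrite -E10 (inj_eq perm_inj) eq_sym.
Qed.

(** The narrow window takes the third best, while the overall best is the one extra applicant
    visible to the wider window. *)
Lemma wider_window_strict k d1 d2 s (i z : 'I_N) : (0 < k)%N -> (d1 <= z)%N ->
  stops_at k d1 d2 s i -> (forall j, (j < i)%N -> ~~ stops_at k d1 d2 s j) -> (s i : nat) = 2%N ->
  (s z : nat) = 0%N -> (i < z < seen N k.+1 i)%N ->
  (#|wins_from (thr k d1 d2) 0| < #|wins_from (thr k.+1 d1 d2) 0|)%N.
Proof.
move=> hk hd hi hj s2 sz /andP[hiz hz].
apply: proper_card; apply/properP; split; first exact: wider_window_wins.
exists s; last by rewrite (threshold_wins hi hj) /top2 s2.
rewrite (threshold_wins (i := z)) /top2 ?sz //.
  by rewrite /stops_at hd /= rank1_le.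
move=> j hjz; case: (ltnP j i) => hji; first by apply: contra (hj j hji); exact: stops_shrink.
by apply: no_stop sz _; rewrite hjz; move: hz; rewrite /seen; lia.
Qed.

Lemma wider_window_best k d1 d2 : (0 < k)%N -> (d1 + k.+1 < N)%N -> (d1 <= d2)%N ->
  (#|wins_from (thr k d1 d2) 0| < #|wins_from (thr k.+1 d1 d2) 0|)%N.
Proof.
move=> hk hd h12.
have hi : (d1 < N)%N by lia.
have hz : (d1 + k < N)%N by lia.
(* The best applicant is just beyond the narrow window and the second best one further, so the third
   best is a 1-candidate at [d1]. This needs room for two indices behind the window. *)
pose i := Ordinal hi; pose z := Ordinal hz; pose y := Ordinal hd.
have [s [sz sy si]] : exists s : 'S_N, [/\ (s z : nat) = 0%N, (s y : nat) = 1%N & (s i : nat) = 2%N].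
  by apply: perm_values; rewrite -(inj_eq val_inj) /=; lia.
apply: (wider_window_strict (s := s) (i := i) (z := z)) => //=; [lia | | | ].
- rewrite /stops_at leqnn /= /rel_rank (_ : [set _ | _] = set0) ?cards0 //.
  apply/setP => j; rewrite !inE si; apply/negP => /andP[h1 h2].
  have [Ej|Ej] : j = z \/ j = y.
    case: (ltnP (s j) 1) => h3; [left|right]; apply: (@perm_inj _ s); apply: val_inj => /=; lia.
  - by move: h1; rewrite Ej /seen /=; lia.
  by move: h1; rewrite Ej /seen /=; lia.
- by move=> j /= hj; rewrite /stops_at [(d1 <= j)%N]leqNgt [(d2 <= j)%N]leqNgt hj (leq_trans hj h12).
by rewrite /seen; lia.
Qed.

Lemma wider_window_second k d : (0 < k)%N -> (0 < d)%N -> (d + k.+1 = N)%N ->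
  (#|wins_from (thr k d d) 0| < #|wins_from (thr k.+1 d d) 0|)%N.
Proof.
move=> hk hd0 hd.
have hi : (d < N)%N by lia.
have hz : (d + k < N)%N by lia.
have h0 : (0 < N)%N by lia.
(* There is room for only one index behind the window. The second best goes to the front, before the
   threshold, and the third best becomes a 2-candidate at [d]. *)
pose i := Ordinal hi; pose z := Ordinal hz; pose y := Ordinal h0.
have [s [sz sy si]] : exists s : 'S_N, [/\ (s z : nat) = 0%N, (s y : nat) = 1%N & (s i : nat) = 2%N].
  by apply: perm_values; rewrite -(inj_eq val_inj) /=; lia.
have hs : seen N k d = (d + k)%N by rewrite /seen; lia.
apply: (wider_window_strict (s := s) (i := i) (z := z)) => //=; [lia | | | ].
- rewrite /stops_at leqnn /= hs; apply/orP; right; apply/andP; split.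
    rewrite /rel_rank (_ : [set _ | _] = [set y]) ?cards1 //.
    apply/setP => j; rewrite !inE si; apply/idP/eqP => [/andP[h1 h2]|->].
      case: (ltnP (s j) 1) => h3; last first.
        by apply: (@perm_inj _ s); apply: val_inj => /=; lia.
      have Ej : j = z by apply: (@perm_inj _ s); apply: val_inj => /=; lia.
      by move: h1; rewrite Ej ltnn.
    by rewrite sy /=; lia.
  apply/existsP; exists y; rewrite /= hd0 /= /rel_rank (_ : [set _ | _] = set0) ?cards0 //.
  apply/setP => j; rewrite !inE sy; apply/negP => /andP[h1 h2].
  have Ej : j = z by apply: (@perm_inj _ s); apply: val_inj => /=; lia.
  by move: h1; rewrite Ej ltnn.
- by move=> j /= hj; rewrite /stops_at [(d <= j)%N]leqNgt hj.
by rewrite /seen; lia.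
Qed.

Lemma card_split (A E : {set 'S_N}) : #|A| = (#|E :&: A| + #|~: E :&: A|)%N.
Proof. by rewrite -[LHS](cardsID E) setIC setDE [~: E :&: A]setIC. Qed.

(** No stop occurs before [i], so the strategies differ only when [i] is a 1-candidate. The
    comparison is then the one in [worth], which makes the gain strict. *)
Lemma lower_best k (i : 'I_N) d2 : (0 < k)%N -> (i < d2)%N -> worth k 1 i ->
  (#|wins_from (thr k i.+1 d2) 0| < #|wins_from (thr k i d2) 0|)%N.
Proof.
move=> hk hd hw; set p := thr k i d2; set p' := thr k i.+1 d2.
pose E := [set s | candidate k 1 s i].
have hi := ltn_ord i.
have skip (q : nat) s : (i <= q)%N -> chosen (thr k q d2) s 0 = chosen (thr k q d2) s i.
  move=> hq; apply: chosen_skip => [|j /= hj]; first by rewrite /= ltnW.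
  by rewrite threshold_policyE /stops_at [(q <= j)%N]leqNgt [(d2 <= j)%N]leqNgt (leq_trans hj hq) (leq_trans hj (ltnW hd)).
have nd : (d2 <= i)%N = false by rewrite leqNgt hd.
have ext s : chosen p s i.+1 = chosen p' s i.+1.
  by apply: chosen_ext => j hj; rewrite !threshold_policyE /stops_at hj (ltnW hj).
have W' s : (s \in wins_from p' 0) = (s \in wins_from p' i.+1).
  by rewrite !inE skip // chosen_step threshold_policyE /stops_at ltnn nd.
have WE s : s \in E -> (s \in wins_from p 0) = top2 s i.
  by rewrite inE => hs; rewrite inE skip // chosen_step threshold_policyE /stops_at leqnn hs.
have WN s : s \notin E -> (s \in wins_from p 0) = (s \in wins_from p' i.+1).
  by rewrite !inE => hs; rewrite skip // chosen_step threshold_policyE /stops_at nd (negbTE hs) andbF ext.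
rewrite (card_split (wins_from p' 0) E) (card_split (wins_from p 0) E).
have -> : ~: E :&: wins_from p' 0 = ~: E :&: wins_from p 0.
  apply/setP => s; rewrite [LHS]in_setI [RHS]in_setI in_setC; case: (boolP (s \in E)) => //= hs.
  by rewrite W' WN.
have -> : E :&: wins_from p' 0 = wins_from p' i.+1 :&: E.
  by apply/setP => s; rewrite [LHS]in_setI [RHS]in_setI W' andbC.
have -> : E :&: wins_from p 0 = [set s | top2 s i] :&: E.
  apply/setP => s; rewrite [LHS]in_setI [RHS]in_setI andbC.
  have -> : (s \in [set u : 'S_N | top2 u i]) = top2 s i by rewrite in_set.
  by case: (boolP (s \in E)) => hs; rewrite ?andbF ?andbT // WE.
rewrite ltn_add2r -(ltr_nat rat).
have c0 : 0 < #|E|%:R :> rat by rewrite ltr0n card_gt0; exact: best_candidate_ex.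
rewrite -(ltr_pM2r (x := #|E|%:R^-1)) ?invr_gt0 //.
apply: le_lt_trans hw; apply: (bigmax_sup p') => //; exact: threshold_admissible.
Qed.

(** Earlier stops may leave no 2-candidate at [i], whence only a weak inequality in general. For
    [i <= d1] nothing stops before [i], and the gain is strict. *)
Lemma lower_second k (i : 'I_N) d1 : (2 < N)%N -> (0 < k)%N -> (0 < i)%N -> worth k 2 i ->
  (#|wins_from (thr k d1 i.+1) 0| <= #|wins_from (thr k d1 i) 0|)%N /\
  ((i <= d1)%N -> #|wins_from (thr k d1 i.+1) 0| < #|wins_from (thr k d1 i) 0|)%N.
Proof.
move=> hN hk hi0 hw; set p := thr k d1 i; set p' := thr k d1 i.+1.
have [t [g Hs]] := system_exists N hk.
have ht : t (seen N k i) < 1 by rewrite -(second_worth hN hk Hs hi0).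
have hi := ltn_ord i; have h2 : (2 <= seen N k i)%N by exact: seen_pos.
(* The permutations on which lowering changes the decision. [worth] averages over all 2-candidates,
   but the comparison with [t] holds on every closed subset. *)
pose E := [set s | candidate k 2 s i && [forall j : 'I_N, (j <= i)%N ==> (p' j s == None)]].
have same j s : j != i -> p j s = p' j s.
  move=> hj; rewrite !threshold_policyE /stops_at; congr (if _ || _ && _ then _ else _).
  by rewrite ltn_neqAle eq_sym (inj_eq val_inj) hj.
have WE s : s \in E -> (s \in wins_from p 0) = top2 s i /\
    (s \in wins_from p' 0) = (s \in wins_from p' i.+1).
  rewrite inE => /andP[hs /forallP hn].
  have none (j : 'I_N) : (j <= i)%N -> p' j s = None by move=> hj; apply/eqP/(implyP (hn j)).
  split.
    rewrite inE (chosen_skip (b := i)); last 2 first.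
    - by rewrite /= ltnW.
    - by move=> j /= hj; rewrite same ?none 1?ltnW //; apply/eqP => Ej; rewrite Ej ltnn in hj.
    by rewrite chosen_step threshold_policyE /stops_at leqnn hs orbT.
  by rewrite !inE (chosen_skip (b := i.+1)) // => j /= hj; exact: none.
have WN s : s \notin E -> (s \in wins_from p 0) = (s \in wins_from p' 0).
  move=> hs; rewrite !inE; suff -> : chosen p s 0 = chosen p' s 0 by [].
  case: (boolP (p i s == p' i s)) => [/eqP hpi|hpi].
    by apply: chosen_ext => j _; case: (eqVneq j i) => [->//|hj]; exact: same.
  have hpi' : candidate k 2 s i && (p' i s == None).
    move: hpi; rewrite !threshold_policyE /stops_at ltnn leqnn andTb andFb orbF.
    by case: (_ && candidate k 1 s i); case: (candidate k 2 s i); rewrite ?eqxx.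
  move: hs; rewrite inE; have /andP[-> hni] := hpi'; rewrite /= => /forallPn [j].
  rewrite negb_imply => /andP[hj hj']; apply: (chosen_cut (i := i)) => //.
    by move=> x hx; apply: same; apply/eqP => Ex; rewrite Ex ltnn in hx.
  exists j => //=; rewrite ltn_neqAle hj andbT; apply/eqP => /val_inj Ej.
  by rewrite Ej hni in hj'.
rewrite (card_split (wins_from p' 0) E) (card_split (wins_from p 0) E).
have -> : ~: E :&: wins_from p' 0 = ~: E :&: wins_from p 0.
  apply/setP => s; rewrite [LHS]in_setI [RHS]in_setI in_setC; case: (boolP (s \in E)) => //= hs.
  by rewrite WN.
have -> : E :&: wins_from p' 0 = E :&: wins_from p' i.+1.
  apply/setP => s; rewrite [LHS]in_setI [RHS]in_setI; case: (boolP (s \in E)) => //= hs.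
  by case: (WE s hs).
have -> : E :&: wins_from p 0 = E :&: [set s | top2 s i].
  apply/setP => s; rewrite [LHS]in_setI [RHS]in_setI.
  have -> : (s \in [set u : 'S_N | top2 u i]) = top2 s i by rewrite in_set.
  case: (boolP (s \in E)) => //= hs.
  by case: (WE s hs).
have adm : admissible k p' by exact: threshold_admissible.
have cE : obs_closed (seen N k i) E.
  move=> s u; rewrite !inE => /andP[h1 /forallP h3] h.
  rewrite -(candidate_obs (l := 2) _ h hk) // h1 /=; apply/forallP => j; apply/implyP => hj.
  rewrite -(eqP (implyP (h3 j) hj)) eq_sym; have /forallP/(_ j)/forallP/(_ s)/andP[_ /forallP/(_ u)/implyP] := adm.
  by apply; apply: same_obs_le h; rewrite /seen; lia.
have hE s : s \in E -> candidate k 2 s i by rewrite inE => /andP[].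
have U := second_reject_bound hN hk h2 cE hE (reject_le hN hk Hs adm h2); rewrite !mul1r in U.
have hin : (i < seen N k i)%N by rewrite /seen; lia.
have hsN : (seen N k i <= N)%N by rewrite /seen; lia.
have C : #|E :&: [set s | top2 s i]|%:R = rank_value N (seen N k i) 2 * #|E|%:R.
  by apply: (rank_count hsN h2 hin cE) => // s /hE /andP[/eqP].
have R := natR_le h2; have M0 := pair_count_gt0 hN.
have c0 : 0 < rank_value N (seen N k i) 2 by rewrite /= divr_gt0 // mulr_gt0; lra.
rewrite leq_add2r ltn_add2r -(ler_nat rat) -(ltr_nat rat) C; split.
  apply: le_trans U _; rewrite ler_wpM2r // ger_pMr // ltW //.
move=> hd1; apply: le_lt_trans U _; rewrite ltr_pM2r ?gtr_pMr //.
rewrite ltr0n card_gt0; have [s [h1 [j hj hj']]] := second_perm hi0.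
apply/set0Pn; exists s; rewrite inE.
have hc : candidate k 2 s i.
  apply/andP; split; first by rewrite (rank2_le (j := j)) //; lia.
  by apply/existsP; exists j; rewrite hj hi0 rank1_le.
rewrite hc; apply/forallP => x; apply/implyP => hx; rewrite threshold_policyE /stops_at.
rewrite (_ : (i < x)%N = false) /= ?orbF; last by lia.
case: ifP => // /andP[h3 h4]; have Ex : x = i by apply: val_inj => /=; lia.
by move: h4 hc; rewrite Ex /= => /eqP ->.
Qed.
End ChosenMore.

(** * Strict growth of the winning probability with the window *)

Section Final.
Variable N : nat.
Notation wins k d1 d2 := #|wins_from (@threshold_policy N k d1 d2) 0|.

Lemma lower_best_chain k d2 a b : (0 < k)%N -> (a <= b)%N -> (b <= d2)%N -> (b <= N)%N ->
  (forall i : 'I_N, (a <= i < b)%N -> worth k 1 i) ->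
  (wins k b d2 <= wins k a d2)%N /\ ((a < b)%N -> (wins k b d2 < wins k a d2)%N).
Proof.
move=> hk hab hbd; elim: b hab hbd => [|b IH] hab hbd hbN hw.
  have -> : a = 0%N by lia.
  by split.
case: (eqVneq a b.+1) => [->|hne]; first by split=> //; rewrite ltnn.
have hab' : (a <= b)%N by move/eqP: hne; lia.
have [h1 _] := IH hab' (ltnW hbd) (ltnW hbN) (fun i hi => hw i ltac:(lia)).
have h2 := @lower_best N k (Ordinal hbN) d2 hk hbd (hw (Ordinal hbN) ltac:(rewrite /=; lia)).
have h3 := leq_trans h2 h1.
by split=> //; exact: ltnW.
Qed.

Lemma lower_second_chain k d1 a b : (2 < N)%N -> (0 < k)%N -> (a <= b)%N -> (b <= N)%N -> (0 < a)%N ->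
  (forall i : 'I_N, (a <= i < b)%N -> worth k 2 i) ->
  (wins k d1 b <= wins k d1 a)%N /\ ((a < b)%N -> (a <= d1)%N -> (wins k d1 b < wins k d1 a)%N).
Proof.
move=> hN hk hab hbN ha hw.
have H : forall c, (a <= c <= b)%N -> (wins k d1 b <= wins k d1 c)%N.
  move=> c /andP[hac hcb].
  have [m Em] : exists m, b = (c + m)%N by exists (b - c)%N; lia.
  elim: m c hac hcb Em => [|m IH] c hac hcb Em; first by rewrite Em addn0.
  have hcN : (c < N)%N by lia.
  have [h _] := @lower_second N k (Ordinal hcN) d1 hN hk ltac:(rewrite /=; lia) (hw (Ordinal hcN) ltac:(rewrite /=; lia)).
  by apply: leq_trans h; apply: IH => /=; lia.
split; first by apply: H; rewrite leqnn.
move=> hlt hd; have haN : (a < N)%N by lia.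
have [_ h] := @lower_second N k (Ordinal haN) d1 hN hk ha (hw (Ordinal haN) ltac:(rewrite /=; lia)).
by apply: leq_ltn_trans (h hd); apply: H => /=; lia.
Qed.

Notation thr1 k := (opt_threshold N k 1).
Notation thr2 k := (opt_threshold N k 2).

Lemma opt_window_step k : (0 < k)%N -> (k.+1 < N)%N ->
  (wins k (thr1 k) (thr2 k) < wins k.+1 (thr1 k.+1) (thr2 k.+1))%N.
Proof.
move=> hk hkN; have hN : (2 < N)%N by lia.
have [t [g Hs]] := system_exists N hk.
have [t' [g' Hs']] := system_exists N (ltn0Sn k).
have hk1 : (0 < k.+1)%N by [].
have m1 : (thr1 k.+1 <= thr1 k)%N.
  by apply: opt_threshold_sub => i _ h /=; apply: (worth_best_next hk hkN Hs Hs').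
have m2 : (thr2 k.+1 <= thr2 k)%N.
  by apply: opt_threshold_sub => i /= h h'; rewrite h; apply: (worth_second_next hk hkN Hs Hs').
have o12 : (thr1 k <= thr2 k)%N.
  by apply: opt_threshold_sub => i /= h h'; apply: (worth_second_best hk hkN Hs Hs').
have s1 := opt_threshold_size N k 1; have s2 := opt_threshold_size N k 2.
have p2 : (0 < thr2 k.+1)%N.
  case: (ltnP (thr2 k.+1) N) => h; last by lia.
  by have /andP[] := opt_threshold_worth h.
(* Once the window reaches the end, [t] vanishes and every 2-candidate is worth choosing. *)
have e2 : (thr2 k.+1 + k.+1 <= N)%N.
  have h : (N - k.+1 < N)%N by lia.
  have hw : worth k.+1 2 (Ordinal h) by apply: (worth_second_end hk hkN Hs') => /=; lia.
  have h2 : (thr2 k.+1 <= N - k.+1)%N by apply: opt_threshold_min hw => /=; lia.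
  lia.
have w1 : forall i : 'I_N, (thr1 k.+1 <= i < thr1 k)%N -> worth k.+1 1 i.
  move=> i hi; have h : (thr1 k.+1 < N)%N by have := ltn_ord i; lia.
  have /= hw := opt_threshold_worth h.
  by apply: (worth_best_mono hk hkN Hs') hw => /=; lia.
have w2 : forall i : 'I_N, (thr2 k.+1 <= i < thr2 k)%N -> worth k.+1 2 i.
  move=> i hi; have h : (thr2 k.+1 < N)%N by have := ltn_ord i; lia.
  have /andP[_ hw] := opt_threshold_worth h.
  by apply: (worth_second_mono hk hkN Hs') hw => /=; lia.
have [l1 l1s] := lower_best_chain hk1 m1 o12 s1 w1.
have [l2 l2s] := lower_second_chain (thr1 k.+1) hN hk1 m2 s2 p2 w2.
have l0 := subset_leq_card (@wider_window_wins N k (thr1 k) (thr2 k) hk).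
case: (ltnP (thr1 k + k.+1) N) => c1.
  by apply: leq_trans (leq_trans l1 l2); exact: wider_window_best.
case: (ltnP (thr1 k.+1) (thr1 k)) => c2.
  by apply: (leq_ltn_trans l0); apply: leq_trans l2; exact: l1s.
have E1 : thr1 k.+1 = thr1 k by lia.
(* The first threshold is unchanged and at least N - k - 1. In this case the second is below N - k,
   so both equal N - k - 1. *)
case: (ltnP (thr2 k + k) N) => c3.
  have E2 : thr2 k = thr1 k by lia.
  apply: leq_trans (leq_trans l1 l2); rewrite E2; apply: wider_window_second => //; lia.
(* Now the old second threshold is at least N - k and the new one at most N - k - 1: it drops, and
   its new value does not exceed the first threshold, as strictness requires. *)
by apply: (leq_ltn_trans (leq_trans l0 l1)); apply: l2s; lia.
Qed.
End Final.

Theorem lemma4p2 (N kappa K : nat) (h1kappa : (1 <= kappa)%N)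
    (hkappaK : (kappa < K)%N) (hKN : (K < N)%N) :
  Pr_win N kappa (opt_threshold N kappa 1) (opt_threshold N kappa 2)
  < Pr_win N K (opt_threshold N K 1) (opt_threshold N K 2).
Proof.
elim: K hkappaK hKN => // K IH hK hKN.
have c0 : 0 < #|[set: 'S_N]|%:R :> rat by rewrite ltr0n card_gt0; apply/set0Pn; exists 1%g; rewrite inE.
have step k : (0 < k)%N -> (k.+1 < N)%N ->
  Pr_win N k (opt_threshold N k 1) (opt_threshold N k 2) <
  Pr_win N k.+1 (opt_threshold N k.+1 1) (opt_threshold N k.+1 2).
  move=> h1 h2; rewrite /Pr_win /prob /cprob !setIT ltr_pM2r ?invr_gt0 // ltr_nat.
  exact: opt_window_step.
case: (eqVneq kappa K) => [E|hne]; first by rewrite E in h1kappa *; exact: step.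
have hK' : (kappa < K)%N by move/eqP: hne; lia.
by apply: lt_trans (IH hK' (ltnW hKN)) (step K _ hKN); lia.
Qed.
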